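(* Let $n\ge 3$, $K\ge 1$, let $\Omega\subset\mathbb R^n$ be a bounded domain, and let $p\in\left(1,\frac{nK}{K+1}\right)$. Then there exists a mapping $$f\in W^{1,p}(\Omega;\mathbb R^n)\cap C(\Omega;\mathbb R^n)\cap L^\infty(\Omega;\mathbb R^n)$$ which is weakly $K$-quasiregular but is not quasiregular (i.e. $f$ is not $K'$-quasiregular for any $K'\ge 1$).
   Context: For an open set $\Omega\subset\mathbb R^n$ and $f\in W^{1,p}_{\mathrm{loc}}(\Omega;\mathbb R^n)$ with $p\ge 1$, let $Df$ be the distributional (weak) gradient and $J_f=\det Df$ the Jacobian determinant. The mapping $f$ is called weakly $K$-quasiregular ($K\ge1$) if $f\in W^{1,1}_{\mathrm{loc}}(\Omega;\mathbb R^n)$, either $J_f\ge 0$ a.e. in $\Omega$ or $J_f\le 0$ a.e. in $\Omega$, and $$\max_{\xi\in\mathbb S^{n-1}}|Df(x)\xi|\le K\min_{\xi\in\mathbb S^{n-1}}|Df(x)\xi|\quad\text{for a.e. }x\in\Omega.$$ A weakly $K$-quasiregular mapping that additionally belongs to $W^{1,n}_{\mathrm{loc}}(\Omega;\mathbb R^n)$ is called $K$-quasiregular; a mapping is quasiregular if it is $K$-quasiregular for some $K\ge1$. *)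

(* Defs.v *)
From HB Require Import structures.
From mathcomp Require Import all_boot all_order all_algebra.
From mathcomp Require Import all_classical all_reals all_analysis.
Set Implicit Arguments. Unset Strict Implicit. Unset Printing Implicit Defensive.
Import Order.TTheory GRing.Theory Num.Theory.
Import numFieldNormedType.Exports.
Local Open Scope classical_set_scope.
Local Open Scope ring_scope.

(** R^n is ['rV[R]_n] (with its usual topology).  For integration we use
    the alias [Rn R n] carrying the Borel sigma-algebra (generated by the
    open sets of ['rV[R]_n]). *)
Definition Rn (R : realType) (n : nat) := g_sigma_algebraType (@open 'rV[R]_n).

(** n-dimensional Lebesgue measure (on Borel sets), defined by iterated
    integration of the measures of sections (Cavalieri / Tonelli):
    leb_0 is the point mass on the single point of R^0 and
    leb_(m+1)(A) = \int_R leb_m ({v | (x,v) \in A}) dx. *)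
Fixpoint lebn (R : realType) (n : nat) : set 'rV[R]_n -> \bar R :=
  match n with
  | 0 => fun A => if `[< A 0 >] then 1%E else 0%E
  | m.+1 => fun A =>
      (\int[@lebesgue_measure R]_(x in setT)
         @lebn R m [set v : 'rV[R]_m | A (row_mx (const_mx x : 'rV[R]_1) v)])%E
  end.

Definition leb (R : realType) (n : nat) : set (Rn R n) -> \bar R := @lebn R n.

Section Sobolev.
Variables (R : realType) (n : nat).
Local Notation V := 'rV[R]_n.
Local Notation mu := (@leb R n).

Definition enorm (v : V) : R := Num.sqrt (\sum_(i < n) v ord0 i ^+ 2).

Definition ae_in (D : set V) (P : V -> Prop) : Prop :=
  mu.-negligible ([set x | D x /\ ~ P x] : set (Rn R n)).

Definition Lp (D : set V) (p : R) (h : V -> R) : Prop :=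
  measurable_fun (D : set (Rn R n)) (h : Rn R n -> R) /\
  (\int[mu]_(x in (D : set (Rn R n))) ((`|h x| `^ p)%:E) < +oo)%E.

Definition Lp_loc (D : set V) (p : R) (h : V -> R) : Prop :=
  measurable_fun (D : set (Rn R n)) (h : Rn R n -> R) /\
  forall C : set V, compact C -> C `<=` D ->
    (\int[mu]_(x in (C : set (Rn R n))) ((`|h x| `^ p)%:E) < +oo)%E.

Definition Linf (D : set V) (h : V -> R) : Prop :=
  measurable_fun (D : set (Rn R n)) (h : Rn R n -> R) /\
  exists M : R, ae_in D (fun x => `|h x| <= M).

Definition ej (j : 'I_n) : V := delta_mx 0 j.
Definition partial (j : 'I_n) (phi : V -> R) : V -> R := 'D_(ej j) phi.
Fixpoint iter_partial (l : seq 'I_n) (phi : V -> R) : V -> R :=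
  match l with
  | [::] => phi
  | j :: l' => partial j (iter_partial l' phi)
  end.
Definition smooth (phi : V -> R) : Prop :=
  forall l : seq 'I_n, continuous (iter_partial l phi) /\
    forall (j : 'I_n) (x : V), derivable (iter_partial l phi) x (ej j).
Definition test_fun (D : set V) (phi : V -> R) : Prop :=
  smooth phi /\
  exists C : set V, [/\ compact C, C `<=` D & forall x, ~ C x -> phi x = 0].

(** G is a weak (distributional) gradient of f on D, with f in W^{1,1}_loc:
    G x i j = d f_i / d x_j. *)
Definition weak_gradient (D : set V) (f : V -> V) (G : V -> 'M[R]_n) : Prop :=
  [/\ forall i, Lp_loc D 1 (fun x => f x ord0 i),
      forall i j, Lp_loc D 1 (fun x => G x i j) &
      forall phi, test_fun D phi -> forall i j,
        (\int[mu]_(x in (D : set (Rn R n))) ((f x ord0 i * partial j phi x)%:E)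
         = - \int[mu]_(x in (D : set (Rn R n))) ((G x i j * phi x)%:E))%E].

Definition W1p (D : set V) (p : R) (f : V -> V) : Prop :=
  exists G, [/\ weak_gradient D f G,
    forall i, Lp D p (fun x => f x ord0 i) &
    forall i j, Lp D p (fun x => G x i j)].
Definition W1p_loc (D : set V) (p : R) (f : V -> V) : Prop :=
  exists G, [/\ weak_gradient D f G,
    forall i, Lp_loc D p (fun x => f x ord0 i) &
    forall i j, Lp_loc D p (fun x => G x i j)].

Definition Linf_vec (D : set V) (f : V -> V) : Prop :=
  forall i, Linf D (fun x => f x ord0 i).

(** max_{|xi|=1} |A xi| <= K min_{|xi|=1} |A xi|  (A acting on column
    vectors; for a row vector xi, A xi corresponds to xi *m A^T). *)
Definition distortion_le (K : R) (A : 'M[R]_n) : Prop :=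
  forall xi eta : V, enorm xi = 1 -> enorm eta = 1 ->
    enorm (xi *m A^T) <= K * enorm (eta *m A^T).

Definition weakly_K_quasiregular (D : set V) (K : R) (f : V -> V) : Prop :=
  exists G, [/\ weak_gradient D f G,
    ae_in D (fun x => 0 <= \det (G x)) \/ ae_in D (fun x => \det (G x) <= 0) &
    ae_in D (fun x => distortion_le K (G x))].

Definition K_quasiregular (D : set V) (K : R) (f : V -> V) : Prop :=
  weakly_K_quasiregular D K f /\ W1p_loc D n%:R f.

Definition quasiregular (D : set V) (f : V -> V) : Prop :=
  exists K : R, 1 <= K /\ K_quasiregular D K f.

End Sobolev.

(* Main.v *)
Require Import Defs.
From HB Require Import structures.
From mathcomp Require Import all_boot all_order all_algebra.
From mathcomp Require Import all_classical all_reals all_analysis.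
From mathcomp Require Import measurable_realfun ring lra.
Set Implicit Arguments. Unset Strict Implicit. Unset Printing Implicit Defensive.
Import Order.TTheory GRing.Theory Num.Theory.
Import numFieldNormedType.Exports.
Local Open Scope classical_set_scope.
Local Open Scope ring_scope.

(** Start from the identity. On an open set where the current map is a similarity of slope [s], pack a fixed fraction of the measure with small disjoint balls; in each ball of radius [r] replace the map by a rescaled [x |-> x |x|^(-1-1/K)] (orientation reversing, distortion [K]) on the annulus [lam r < |x| < r], and by a steeper similarity in the core [|x| < lam r]; the cores are treated again at the next step. For [lam] small, [lam^(n - (1+1/K) p)] small makes the integral of [slope^p] over the cores decay geometrically, so the maps converge in W^{1,p}, while [lam^(-n/K)] large makes the integral of [slope^n] grow geometrically. Testing weak derivatives against bumps on cubes shows that this energy is lower semicontinuous under uniform convergence, so it blows up for the limit, which excludes W^{1,n}_loc. Taking the balls tiny at each step gives uniform convergence. *)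

(** The obstacle is that membership in W^{1,n}_loc must be refuted for the limit, about which only
    uniform closeness to the stages is known. Lower semicontinuity is therefore used quantitatively:
    every stage comes with a radius such that each map within that uniform distance, with an
    arbitrary weak gradient, carries a fixed share of the energy of the stage. Each move and each
    new radius is at most half the old radius, so the limit stays within the radius of every stage.
    Since local integrability has to fail, the energy is counted on one compact ball [C], and no
    treated cube straddles its boundary.

    Both powers of [lam] have one source: a core is steeper by [c = lam^(-beta)] with
    [beta = 1 + 1/K] and has volume of order [lam^n], so a step multiplies the q-energy of a treated
    ball by about [lam^(n - beta q)]. The exponent is positive at [q = p] exactly because
    [p < nK/(K+1)].

    Cores preserve orientation while annuli reverse it. The sign and distortion conditions are thus
    claimed on the finished part only, and they hold a.e. at the end because the unfinished sets
    shrink to a null set. *)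

Section measure_Rn.
Context {R : realType}.

(** * Borel measurability in R^n and the splitting of R^(n+1) into R and R^n *)

Lemma ball_rVP n (x y : 'rV[R]_n) e :
  0 < e -> ball x e y <-> forall i, `|x 0 i - y 0 i| < e.
Proof.
move=> e0; split=> [[_ h] i|h]; first exact: h.
by split => // i j; rewrite (ord1 i); exact: h.
Qed.

Lemma open_measurable_Rn n (A : set 'rV[R]_n) :
  open A -> measurable (A : set (Rn R n)).
Proof. by move=> oA; apply: sub_sigma_algebra. Qed.

Lemma closed_measurable_Rn n (A : set 'rV[R]_n) :
  closed A -> measurable (A : set (Rn R n)).
Proof.
move=> cA; rewrite -[A]setCK; apply: measurableC.
by apply: open_measurable_Rn; rewrite openC.
Qed.

Lemma continuous_measurable_Rn n (h : 'rV[R]_n -> R) (D : set (Rn R n)) :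
  continuous h -> measurable D -> measurable_fun D (h : Rn R n -> R).
Proof.
move=> ch mD; apply: (@measurability _ _ _ _ _ _ (@RGenOpens.G R)); first exact: RGenOpens.measurableE.
move=> _ [_ [a [b ->] <-]]; apply: measurableI => //.
apply: open_measurable_Rn.
by apply: open_comp => // x _; exact: ch.
Qed.

Lemma coord_measurable n (i : 'I_n) :
  measurable_fun [set: Rn R n] (fun v : Rn R n => (v : 'rV[R]_n) 0 i).
Proof. apply: continuous_measurable_Rn => //; exact: coord_continuous. Qed.

(** The sigma-algebra is generated by open sets, not by boxes. An open set is a countable union of
    sup-norm balls with rational centres and radii [1/(k+1)], and the preimage of each such ball is
    a finite intersection of coordinate preimages. *)
Lemma measurable_fun_Rn d (T : measurableType d) n (g : T -> Rn R n) :
  (forall i : 'I_n, measurable_fun setT (fun t => (g t : 'rV[R]_n) 0 i)) ->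
  measurable_fun setT g.
Proof.
move=> mg; apply: (@measurability _ _ T (Rn R n) setT g (@open 'rV[R]_n)) => //.
move=> _ [W oW <-]; rewrite setTI.
pose q2r (q : 'rV[rat]_n) : 'rV[R]_n := map_mx ratr q.
pose F (qk : 'rV[rat]_n * nat) : set T :=
  if `[< ball (q2r qk.1) (qk.2.+1%:R^-1) `<=` W >]
  then \bigcap_(i in [set: 'I_n])
    ((fun t => (g t : 'rV[R]_n) 0 i) @^-1` (ball (ratr (qk.1 0 i) : R) (qk.2.+1%:R^-1)))
  else set0.
have inF qk t : F qk t -> (g @^-1` W) t.
  rewrite /F; case: asboolP => // sO Ft; apply: sO; apply/ball_rVP => // i.
  by rewrite mxE; exact: (Ft i).
have -> : g @^-1` W = \bigcup_qk F qk.
  apply/seteqP; split => [t Ogt|t [qk _ /inF//]].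
  have /nbhs_ballP[e /= e0 eO] : nbhs (g t : 'rV[R]_n) W.
    by rewrite openE in oW; exact: oW.
  have [k ke] : exists k, k.+1%:R^-1 < e / 2 :> R.
    have e20 : 0 < e / 2 by rewrite divr_gt0.
    exists (Num.truncn (e / 2)^-1); rewrite -[ltRHS]invrK ltf_pV2 ?posrE ?invr_gt0//.
    exact: truncnS_gt.
  have k0 : 0 < k.+1%:R^-1 :> R by rewrite invr_gt0.
  have /choice[q hq] : forall i : 'I_n, exists q : rat,
      `|ratr q - (g t : 'rV[R]_n) 0 i| < k.+1%:R^-1.
    move=> i; set y := (g t : 'rV[R]_n) 0 i.
    have /rat_in_itvoo[q] : y - k.+1%:R^-1 < y + k.+1%:R^-1 by rewrite ltrD2l gtrN.
    rewrite in_itv/= => /andP[h1 h2]; exists q.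
    by rewrite ltr_distl; apply/andP.
  exists (\row_i q i, k) => //; rewrite /F/=.
  have -> : `[< ball (q2r (\row_i q i)) k.+1%:R^-1 `<=` W >].
    apply/asboolP => z /ball_rVP hz; apply: eO; apply/ball_rVP => // i.
    have := hz k0 i; rewrite !mxE => hzi; have := hq i.
    rewrite distrC -[(_ : 'rV_n) 0 i - z 0 i](subrKA (ratr (q i))) => hh.
    by rewrite (le_lt_trans (ler_normD _ _))// (splitr e) ltrD// (lt_trans _ ke).
  move=> i _ /=; rewrite mxE /ball/=; exact: hq.
apply: countable_bigcupT_measurable => [|qk]; first exact: countableP.
rewrite /F; case: asboolP => // _; apply: fin_bigcap_measurable => // i _.
rewrite -[X in measurable X]setTI; apply: mg => //.
exact: measurable_ball.
Qed.

(** The gluing map behind the slices in [lebn]: the measure in dimension n+1 is the image under it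
    of a product measure. *)
Definition consR n (xv : measurableTypeR R * Rn R n) : Rn R n.+1 :=
  row_mx (const_mx xv.1 : 'rV[R]_1) (xv.2 : 'rV[R]_n).

Lemma consR_lshift n x (v : Rn R n) (j : 'I_1) :
  (consR (x, v) : 'rV[R]_(1 + n)) 0 (lshift n j) = x.
Proof. by rewrite /consR (row_mxEl (const_mx x) (v : 'rV_n)) mxE. Qed.

Lemma consR_rshift n x (v : Rn R n) (j : 'I_n) :
  (consR (x, v) : 'rV[R]_(1 + n)) 0 (rshift 1 j) = (v : 'rV_n) 0 j.
Proof. by rewrite /consR (row_mxEr (const_mx x) (v : 'rV_n)). Qed.

Lemma measurable_consR n : measurable_fun setT (@consR n).
Proof.
apply: measurable_fun_Rn => i; case: (split_ordP (i : 'I_(1 + n))) => j ->.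
  rewrite [X in measurable_fun _ X](_ : _ = fst).
    exact: measurable_fst.
  by apply/funext => -[x v]; rewrite consR_lshift.
rewrite [X in measurable_fun _ X](_ : _ = (fun v : Rn R n => (v : 'rV[R]_n) 0 j) \o snd).
  exact: (measurableT_comp (coord_measurable j) measurable_snd).
by apply/funext => -[x v]; rewrite consR_rshift.
Qed.

Lemma lebSE n (A : set 'rV[R]_n.+1) :
  leb A = (\int[@lebesgue_measure R]_x
     @leb R n [set v : 'rV[R]_n | A (consR (x, v))])%E.
Proof. by []. Qed.


(** * The iterated integral [leb] is a sigma-finite measure *)

Definition cubek n (k : nat) : set 'rV[R]_n := [set v | forall i, `|v 0 i| <= k%:R].

Lemma measurable_cubek n k : measurable (@cubek n k : set (Rn R n)).
Proof.
rewrite (_ : cubek _ = \bigcap_(i in [set: 'I_n])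
  ((fun v : Rn R n => (v : 'rV[R]_n) 0 i) @^-1` `[- k%:R, k%:R])).
  apply: fin_bigcap_measurable => // i _; rewrite -[X in measurable X]setTI.
  exact: coord_measurable.
apply/seteqP; split => v /= h i; first by rewrite /= in_itv/= -ler_norml.
by move: (h i I); rewrite /= in_itv/= -ler_norml.
Qed.

Lemma norm_coord_le n (v : 'rV[R]_n) i : `|v 0 i| <= `|v|.
Proof.
rewrite [leRHS]/Num.norm/= mx_normrE.
exact: (le_bigmax _ (fun ij : 'I_1 * 'I_n => `|v ij.1 ij.2|) (0, i)).
Qed.

Lemma bigcup_cubek n : \bigcup_k @cubek n k = setT.
Proof.
apply/seteqP; split => // v _; exists (Num.truncn `|v|).+1 => // i.
apply: le_trans (ltW (truncnS_gt _)).
exact: norm_coord_le.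
Qed.

Lemma consR_preimage_cubek n k :
  @consR n @^-1` (cubek k) = `[- k%:R, k%:R]%classic `*` cubek k.
Proof.
apply/seteqP; split => -[x v]/=.
  move=> h; split => [|i]; last by have := h (rshift 1 i : 'I_(1 + n)); rewrite consR_rshift.
  by have := h (lshift n (ord0 : 'I_1) : 'I_(1 + n)); rewrite consR_lshift /= in_itv/= -ler_norml.
move=> [/=]; rewrite in_itv/= -ler_norml => hx hv i.
by case: (split_ordP (i : 'I_(1 + n))) => j ->; rewrite ?consR_lshift ?consR_rshift.
Qed.

(** Finiteness on cubes belongs to the induction: it yields sigma-finiteness in dimension n, which
    is what allows the product with the measure of the line to be formed. In dimension n+1 the
    iterated integral is the image of that product under [consR], and the properties are read off
    there. *)
Let leb_is_measure n :
  [/\ @leb R n set0 = 0%E, forall A, (0 <= @leb R n A)%E,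
      semi_sigma_additive (@leb R n) & forall k, (@leb R n (@cubek n k) < +oo)%E].
Proof.
elim: n => [|n [h0 hge hs hc]].
  have E : @leb R 0 = @dirac _ (Rn R 0) (0 : 'rV[R]_0) R.
    apply/funext => A; rewrite /dirac/= /indic/= /leb/=.
    by case: asboolP => h; [rewrite mem_set|rewrite memNset].
  rewrite E; split => // [A|k]; last by rewrite diracE; case: (_ \in _); rewrite ltry.
  exact: measure_semi_sigma_additive.
pose m1 := isMeasure.Build _ _ _ (@leb R n) h0 hge hs.
pose L : {measure set (Rn R n) -> \bar R} := HB.pack (@leb R n) m1.
have sL : sigma_finite setT L.
  by exists (@cubek n) => [|k]; [rewrite bigcup_cubek|split; [exact: measurable_cubek|exact: hc]].
pose m2 := Measure_isSigmaFinite.Build _ _ _ L sL.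
pose S : {sigma_finite_measure set (Rn R n) -> \bar R} := HB.pack (@leb R n) m1 m2.
have E : @leb R n.+1 = pushforward (@lebesgue_measure R \x S)%E (@consR n).
  apply/funext => A; rewrite /pushforward /product_measure1 lebSE.
  apply: eq_integral => x _ /=; congr (leb _).
  by apply/seteqP; split => v; rewrite /xsection/= inE.
have mc := @measurable_consR n.
rewrite E; split.
- by rewrite /pushforward preimage_set0 measure0.
- by move=> A; rewrite -E lebSE; apply: integral_ge0 => x _; exact: hge.
- move=> F mF tF mUF; rewrite /pushforward preimage_bigcup.
  apply: measure_semi_sigma_additive.
  + by move=> k; rewrite -[X in measurable X]setTI; exact: mc.
  + apply/trivIsetP => /= i j _ _ ij; rewrite -preimage_setI.
    by move/trivIsetP : tF => /(_ _ _ _ _ ij) ->//; rewrite preimage_set0.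
  + by rewrite -preimage_bigcup -[X in measurable X]setTI; exact: mc.
- move=> k; rewrite /pushforward consR_preimage_cubek.
  have mk := @measurable_cubek n k.
  rewrite product_measure1E//; apply: lte_mul_pinfty => //=.
  have -> : lebesgue_measure `[- k%:R, k%:R]%classic = (k%:R + k%:R : R)%:E.
    rewrite lebesgue_measure_itv/= lte_fin; case: ltrP => [_|h].
      by rewrite -EFinD opprK.
    suff -> : k%:R = 0 :> R by rewrite addr0.
    have := ler0n R k; lra.
  by [].
Qed.

HB.instance Definition _ n := isMeasure.Build _ _ _ (@leb R n)
  (let: And4 h _ _ _ := leb_is_measure n in h)
  (let: And4 _ h _ _ := leb_is_measure n in h)
  (let: And4 _ _ h _ := leb_is_measure n in h).

Let leb_sigma_finite n : sigma_finite setT (@leb R n).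
Proof.
exists (@cubek n) => [|k]; first by rewrite bigcup_cubek.
by split; [exact: measurable_cubek|case: (leb_is_measure n)].
Qed.

HB.instance Definition _ n := Measure_isSigmaFinite.Build _ _ _ (@leb R n)
  (@leb_sigma_finite n).

Lemma leb_cubek_lty n k : (leb (@cubek n k : set (Rn R n)) < +oo)%E.
Proof. by case: (leb_is_measure n). Qed.

Lemma leb_consR n (A : set (Rn R n.+1)) :
  leb A = (@lebesgue_measure R \x @leb R n)%E (@consR n @^-1` A).
Proof.
rewrite /product_measure1 lebSE; apply: eq_integral => x _ /=; congr (leb _).
by apply/seteqP; split => v; rewrite /xsection/= inE.
Qed.


(** * Translation invariance, cubes and spheres *)

Lemma lebesgue_measure_translate (t : R) (A : set (measurableTypeR R)) :
  measurable A ->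
  pushforward (@lebesgue_measure R) (fun x : measurableTypeR R => x + t : measurableTypeR R) A
  = lebesgue_measure A.
Proof.
move=> mA.
have mf : measurable_fun setT (fun x : measurableTypeR R => x + t : measurableTypeR R).
  exact: (@measurable_funD _ _ _ _ id (cst t)).
apply/esym/lebesgue_measure_unique => //= _ [[a b]] _ <-.
rewrite /pushforward (_ : _ @^-1` _ = `]a - t, b - t]%classic).
  by rewrite !lebesgue_measure_itv/= !lte_fin ltrD2r -!EFinD opprB addrA subrK.
by apply/seteqP; split => x/=; rewrite !in_itv/= ltrBlDr lerBrDr.
Qed.

Lemma ge0_integral_translate1 (t : R) (f : measurableTypeR R -> \bar R) :
  measurable_fun setT f -> (forall x, 0 <= f x)%E ->
  (\int[@lebesgue_measure R]_x f (x + t)%R = \int[@lebesgue_measure R]_x f x)%E.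
Proof.
move=> mf f0.
have mt : measurable_fun setT (fun x : measurableTypeR R => x + t : measurableTypeR R).
  exact: (@measurable_funD _ _ _ _ id (cst t)).
rewrite -[LHS](@ge0_integral_pushforward _ _ _ _ _ _ mt (@lebesgue_measure R) setT f)//.
by apply: eq_measure_integral => A mA _; exact: lebesgue_measure_translate.
Qed.

Lemma consRK n (a : 'rV[R]_n.+1) :
  consR (a 0 (lshift n ord0 : 'I_(1 + n)), (\row_j a 0 (rshift 1 j : 'I_(1 + n)) : Rn R n)) = a.
Proof.
apply/rowP => i; case: (split_ordP (i : 'I_(1 + n))) => j ->.
  by rewrite consR_lshift (ord1 j).
by rewrite consR_rshift mxE.
Qed.

Lemma consRD n x (v : 'rV[R]_n) y (w : 'rV[R]_n) :
  (consR (x, v : Rn R n) : 'rV[R]_n.+1) + (consR (y, w : Rn R n) : 'rV[R]_n.+1) =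
  consR (x + y, (v + w : 'rV[R]_n) : Rn R n).
Proof.
apply/rowP => i; case: (split_ordP (i : 'I_(1 + n))) => j ->; rewrite mxE.
  by rewrite !consR_lshift.
by rewrite !consR_rshift mxE.
Qed.

Lemma measurable_consR_preimage n (A : set (Rn R n.+1)) :
  measurable A -> measurable (@consR n @^-1` A).
Proof. by move=> mA; rewrite -[X in measurable X]setTI; exact: measurable_consR. Qed.

Lemma section_consR n (A : set (Rn R n.+1)) x :
  [set v : Rn R n | A (consR (x, v))] = xsection (@consR n @^-1` A) x.
Proof. by apply/seteqP; split => v; rewrite /xsection/= inE. Qed.

(** Slicing splits the translation: the induction hypothesis moves each slice by the tail of [t],
    and invariance on the line absorbs the shift of the slicing variable. *)
Lemma leb_translate n (t : 'rV[R]_n) (A : set (Rn R n)) : measurable A ->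
  leb ([set x : 'rV[R]_n | A (x + t)] : set (Rn R n)) = leb A.
Proof.
elim: n t A => [|n IH] t A mA.
  by congr (leb _); apply/seteqP; split => x/=; rewrite !thinmx0.
rewrite !lebSE.
set t0 := t 0 (lshift n ord0 : 'I_(1 + n)).
set t1 : 'rV[R]_n := \row_j t 0 (rshift 1 j : 'I_(1 + n)).
have mA' := measurable_consR_preimage mA.
transitivity (\int[@lebesgue_measure R]_x
    leb [set v : Rn R n | A (consR ((x + t0)%R, v))])%E.
  apply: eq_integral => x _.
  rewrite -(IH t1 [set v : Rn R n | A (consR (x + t0, v))]); last first.
    rewrite section_consR; exact: measurable_xsection.
  congr (leb _); apply/seteqP; split => v /=.
    by rewrite -[in X in A X -> _](consRK t) consRD.
  by rewrite -[in X in _ -> A X](consRK t) consRD.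
apply: (@ge0_integral_translate1 t0 (fun x => leb [set v : Rn R n | A (consR (x, v))])).
  under eq_fun do rewrite section_consR.
  exact: (@measurable_fun_xsection _ _ (measurableTypeR R) _ _ (@leb R n)).
by move=> x; exact: measure_ge0.
Qed.

Lemma measurable_translate n (t : 'rV[R]_n) :
  measurable_fun setT (fun x : Rn R n => ((x : 'rV[R]_n) + t : Rn R n)).
Proof.
apply: measurable_fun_Rn => i.
rewrite [X in measurable_fun _ X](_ : _ = fun x : Rn R n => (x : 'rV[R]_n) 0 i + t 0 i).
  by apply: measurable_funD => //; exact: coord_measurable.
by apply/funext => x; rewrite mxE.
Qed.

Lemma integral_translate n (t : 'rV[R]_n) (f : Rn R n -> \bar R) :
  (leb (n:=n)).-integrable setT (fun x : Rn R n => f ((x : 'rV[R]_n) + t)) ->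
  measurable_fun setT f ->
  (\int[@leb R n]_x f (((x : 'rV[R]_n) + t)%R) = \int[@leb R n]_x f x)%E.
Proof.
move=> fi mf.
rewrite -[LHS](@integral_pushforward _ _ _ _ _ _ (measurable_translate t) (@leb R n) setT f)//.
by apply: eq_measure_integral => [|? A mA _]; [exact: measurable_translate|exact: (leb_translate t mA)].
Qed.

Definition cube n (a : 'rV[R]_n) (h : R) : set 'rV[R]_n :=
  [set v | forall i, a 0 i <= v 0 i < a 0 i + h].

Lemma measurable_cube n (a : 'rV[R]_n) h : measurable (cube a h : set (Rn R n)).
Proof.
rewrite (_ : cube _ _ = \bigcap_(i in [set: 'I_n])
  ((fun v : Rn R n => (v : 'rV[R]_n) 0 i) @^-1` `[a 0 i, a 0 i + h[)).
  apply: fin_bigcap_measurable => // i _; rewrite -[X in measurable X]setTI.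
  exact: coord_measurable.
apply/seteqP; split => v /= hv i; first by rewrite /= in_itv/=.
by move: (hv i I); rewrite /= in_itv/=.
Qed.

Lemma leb_cube n (a : 'rV[R]_n) (h : R) : 0 <= h -> leb (cube a h : set (Rn R n)) = (h ^+ n)%:E.
Proof.
move=> h0; elim: n a => [|n IH] a.
  by rewrite /leb/= asboolT// => -[].
rewrite leb_consR.
set a0 := a 0 (lshift n ord0 : 'I_(1 + n)).
set a1 : 'rV[R]_n := \row_j a 0 (rshift 1 j : 'I_(1 + n)).
rewrite (_ : _ @^-1` _ = `[a0, a0 + h[%classic `*` cube a1 h).
  transitivity ((@lebesgue_measure R `[a0, (a0 + h)%R[%classic) *
      leb (cube a1 h : set (Rn R n)))%E.
    by apply: product_measure1E => //; exact: measurable_cube.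
  rewrite IH lebesgue_measure_itv/= lte_fin.
  case: ltrP => [_|]; first by rewrite -EFinD -EFinM exprS addrAC subrr add0r.
  rewrite gerDl => h0'; have -> : h = 0 by apply/eqP; rewrite eq_le h0'.
  by rewrite mul0e expr0n.
apply/seteqP; split => -[x v]/=.
  move=> hh; split => [|i]/=.
    by have := hh (lshift n (ord0 : 'I_1) : 'I_(1 + n)); rewrite consR_lshift in_itv.
  by have := hh (rshift 1 i : 'I_(1 + n)); rewrite consR_rshift mxE.
move=> [/=]; rewrite in_itv/= => hx hv i.
case: (split_ordP (i : 'I_(1 + n))) => j ->; first by rewrite consR_lshift (ord1 j).
by have := hv j; rewrite consR_rshift mxE.
Qed.

Section continuous_fun.
Context {T : topologicalType}.
Implicit Types f g : T -> R.

Lemma add_continuous_fun f g :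
  continuous f -> continuous g -> continuous (fun x => f x + g x).
Proof. by move=> cf cg x; exact: (cvgD (cf x) (cg x)). Qed.

Lemma sub_continuous_fun f g :
  continuous f -> continuous g -> continuous (fun x => f x - g x).
Proof. by move=> cf cg x; exact: (cvgB (cf x) (cg x)). Qed.

Lemma mul_continuous_fun f g :
  continuous f -> continuous g -> continuous (fun x => f x * g x).
Proof. by move=> cf cg x; exact: (cvgM (cf x) (cg x)). Qed.

Lemma sum_continuous_fun (I : finType) (P : pred I) (F : I -> T -> R) :
  (forall i, continuous (F i)) -> continuous (fun x => \sum_(i | P i) F i x).
Proof. by move=> h; apply: continuous_big => // ; exact: add_continuous. Qed.

End continuous_fun.

Definition sqd n (a v : 'rV[R]_n) : R := \sum_i (v 0 i - a 0 i) ^+ 2.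

Lemma continuous_sqd n (a : 'rV[R]_n) : continuous (sqd a).
Proof.
rewrite /sqd; apply: sum_continuous_fun => i; apply: mul_continuous_fun;
  by apply: sub_continuous_fun; [exact: coord_continuous|exact: cst_continuous].
Qed.

Lemma closed_sqd_eq n (a : 'rV[R]_n) rho : closed [set v | sqd a v = rho].
Proof.
by apply: (@closed_comp _ _ (sqd a) [set rho]) => [v _|]; [exact: continuous_sqd|exact: closed_eq].
Qed.

(** A slice of such a set is of the same kind one dimension lower, with [rho - (x - a_0)^2] in place
    of [rho]; since [rho] is any real number, the family is closed under slicing. In dimension 1 at
    most two points of the line remain. *)
Lemma leb_sphere n (a : 'rV[R]_n) rho : (0 < n)%N ->
  leb ([set v : 'rV[R]_n | sqd a v = rho] : set (Rn R n)) = 0%E.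
Proof.
have sqdS m (b : 'rV[R]_m.+1) x (v : 'rV[R]_m) : sqd b (consR (x, v : Rn R m)) =
    (x - b 0 (lshift m ord0 : 'I_(1 + m))) ^+ 2 + sqd (\row_j b 0 (rshift 1 j : 'I_(1 + m))) v.
  rewrite /sqd (@big_split_ord _ _ _ 1 m)/= big_ord1 consR_lshift; congr (_ + _).
  by apply: eq_bigr => i _; rewrite consR_rshift mxE.
case: n a rho => // n + + _; elim: n => [|n IH] a rho.
  rewrite leb_consR.
  set a0 := a 0 (lshift 0 ord0 : 'I_(1 + 0)).
  pose F : set R := [set a0 + Num.sqrt rho; a0 - Num.sqrt rho].
  have mF : measurable F by apply: measurableU; exact: measurable_set1.
  have F0 : lebesgue_measure F = 0%E.
    by apply: countable_lebesgue_measure0; apply: finite_set_countable; exact: finite_set2.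
  apply/eqP; rewrite eq_le measure_ge0 andbT.
  rewrite -[leRHS](mul0e (@leb R 0 setT)) -[X in (X * _)%E]F0.
  rewrite -product_measure1E//; apply: le_measure; rewrite ?inE.
  - by apply: measurable_consR_preimage; apply: closed_measurable_Rn; exact: closed_sqd_eq.
  - exact: measurableX.
  - move=> [x v]/=; rewrite sqdS [sqd _ v]big_ord0 addr0 => h; split => //=.
    have : (x - a0) ^+ 2 == Num.sqrt rho ^+ 2 by rewrite sqr_sqrtr -h ?sqr_ge0.
    rewrite eqf_sqr => /orP[] /eqP h'; [left|right]; rewrite -h';
    by rewrite addrCA subrr addr0.
rewrite lebSE integral0_eq// => x _.
rewrite -[RHS](IH (\row_j a 0 (rshift 1 j : 'I_(1 + n.+1)))
  (rho - (x - a 0 (lshift n.+1 ord0 : 'I_(1 + n.+1))) ^+ 2)).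
congr (leb _); apply/seteqP; split => v /=; rewrite sqdS.
  by move=> <-; rewrite addrAC subrr add0r.
by move=> ->; rewrite addrC subrK.
Qed.

End measure_Rn.

(** * Directional derivatives as derivatives along lines *)

Section lines.
Context {R : realType} {n : nat}.
Local Notation V := 'rV[R]_n.
Implicit Types (f g phi : V -> R) (x v : V).

Lemma diffquot_line f x v (u : R) :
  (fun h : R => h^-1 *: ((f \o shift (x + u *: v)) (h *: v) - f (x + u *: v))) =
  (fun h : R => h^-1 *: (((fun w : R => f (x + w *: v)) \o shift u) (h *: 1)
     - (fun w : R => f (x + w *: v)) u)).
Proof.
apply/funext => h /=; congr (_ *: (f _ - _)).
by rewrite [h *: 1]mulr1 scalerDl addrCA.
Qed.

Lemma is_derive_line f x v (u : R) df :
  is_derive (x + u *: v) v f df -> is_derive u (1 : R) (fun w : R => f (x + w *: v)) df.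
Proof.
move=> [h1 h2]; split.
  by move: h1; rewrite /derivable diffquot_line.
by rewrite -h2 /derive diffquot_line.
Qed.

Lemma line_is_derive f x v df :
  is_derive (0 : R) (1 : R) (fun w : R => f (x + w *: v)) df -> is_derive x v f df.
Proof.
have {2}-> : x = x + (0 : R) *: v by rewrite scale0r addr0.
move=> [h1 h2]; split.
  by move: h1; rewrite /derivable diffquot_line.
by rewrite -h2 /derive diffquot_line.
Qed.

Lemma is_derive_cvg_seq f x v df (u : R^nat) : is_derive x v f df ->
  (forall k, u k != 0) -> u @ \oo --> 0 ->
  ((u k)^-1 * (f (x + u k *: v) - f x)) @[k --> \oo] --> df.
Proof.
move=> [h1 h2] u0 cu.
have : (fun h : R => h^-1 *: ((f \o shift x) (h *: v) - f x)) @ 0^' --> df.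
  by rewrite -h2; exact: h1.
move=> /cvgr_dnbhsP /(_ u (conj u0 cu)) /= h.
by under eq_fun do rewrite [x + _]addrC.
Qed.

Lemma line_lipschitz f x v (M : R) :
  (forall y, derivable f y v) -> (forall y, `|'D_v f y| <= M) ->
  forall t : R, `|f (x + t *: v) - f x| <= M * `|t|.
Proof.
move=> df fM.
have dl u : is_derive u (1 : R) (fun w : R => f (x + w *: v)) ('D_v f (x + u *: v)).
  by apply: is_derive_line; exact/derivableP.
have cl a b : {within `[a, b], continuous (fun w : R => f (x + w *: v))}.
  by apply: derivable_within_continuous => u _; exact: ex_derive.
have key a b : a <= b -> `|f (x + b *: v) - f (x + a *: v)| <= M * (b - a).
  move=> ab; have [c _ ->] := MVT_segment ab (fun u _ => dl u) (cl a b).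
  by rewrite normrM (ger0_norm (_ : 0 <= b - a)) ?subr_ge0// ler_wpM2r// subr_ge0.
move=> t; have [t0|t0] := leP 0 t.
  by have := key _ _ t0; rewrite scale0r addr0 subr0 (ger0_norm t0).
by have := key _ _ (ltW t0); rewrite scale0r addr0 sub0r distrC (ltr0_norm t0).
Qed.

End lines.

Lemma integrable_indic_lty d (T : measurableType d) (R : realType)
    (m : {measure set T -> \bar R}) (A : set T) :
  measurable A -> (m A < +oo)%E -> m.-integrable setT (fun x => (\1_A x)%:E).
Proof.
move=> mA Aoo; apply/integrableP; split; first exact/measurable_EFinP.
rewrite (eq_integral (fun x => (\1_A x)%:E)); last first.
  by move=> t _; rewrite gee0_abs// lee_fin.
by rewrite integral_indic// setIT.
Qed.

(** * Integration by parts for Lipschitz functions against test functions *)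

Section integration_by_parts.
Context {R : realType} {n : nat}.
Local Notation V := 'rV[R]_n.
Local Notation mu := (@leb R n).

Lemma continuous_translate (w : V) : continuous (fun x : V => x + w).
Proof.
move=> x; have c1 : {for x, continuous (@id V)} by exact: cvg_id.
have c2 : {for x, continuous (@cst V V w)} by exact: cst_continuous.
exact: (continuousD c1 c2).
Qed.

Lemma comp_translate_continuous (T : topologicalType) (f : V -> T) (w : V) :
  continuous f -> continuous (fun x : V => f (x + w)).
Proof.
move=> cf x; apply: (@continuous_comp _ _ _ (fun x : V => x + w) f).
  exact: continuous_translate.
exact: cf.
Qed.

Lemma compact_sub_cubek (C : set V) : compact C -> exists k, C `<=` @cubek R n k.
Proof.
move=> /compact_bounded[M [_ hM]]; exists (Num.truncn (M + 1)).+1 => x Cx i.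
rewrite (le_trans (norm_coord_le _ _))// (le_trans (hM (M + 1) _ x Cx)) ?ltrDl//.
exact/ltW/truncnS_gt.
Qed.

Lemma compact_cubek k : compact (@cubek R n k).
Proof.
have := @rV_compact R^o n (fun=> `[- k%:R, k%:R]%classic) (fun=> @segment_compact _ _ _).
rewrite (_ : mkset _ = cubek k)//.
apply/seteqP; split => x h i; first by have := h i; rewrite /= in_itv/= -ler_norml.
by rewrite /= in_itv/= -ler_norml.
Qed.

Lemma continuous_bounded_compact (g : V -> R) (C : set V) : continuous g ->
  compact C -> exists M, forall x, C x -> `|g x| <= M.
Proof.
move=> cg cC.
have /compact_bounded[M [_ hM]] : compact (g @` C).
  by apply: continuous_compact => //; exact: continuous_subspaceT.
by exists (M + 1) => x Cx; apply: hM; [rewrite ltrDl|exists x].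
Qed.

Lemma integrable_bounded_cubek (g : V -> R) k M :
  measurable_fun setT (g : Rn R n -> R) ->
  (forall x, `|g x| <= M) -> (forall x, ~ cubek k x -> g x = 0) ->
  mu.-integrable setT (EFin \o (g : Rn R n -> R)).
Proof.
move=> mg gM g0.
have mk := @measurable_cubek R n k.
apply: (@le_integrable _ _ _ mu setT measurableT _ (fun x => (M * \1_(cubek k : set (Rn R n)) x)%:E)).
- exact/measurable_EFinP.
- move=> x _ /=; rewrite lee_fin indicE; have M0 := le_trans (normr_ge0 _) (gM x).
  case: (pselect (cubek k x)) => h; first by rewrite mem_set//= mulr1 (ger0_norm M0).
  by rewrite g0// normr0.
- under eq_fun do rewrite EFinM.
  apply: integrableZl => //; apply: integrable_indic_lty => //.
  exact: leb_cubek_lty.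
Qed.


Lemma cubek_shift k x (t : R) (j : 'I_n) :
  `|t| <= 1 -> @cubek R n k x -> cubek k.+1 (x + t *: ej R j).
Proof.
move=> t1 kx i; rewrite !mxE eqxx/= (le_trans (ler_normD _ _))//.
rewrite -natr1 lerD ?kx// (le_trans _ t1)// normrM ler_piMr//.
by case: (i == j); rewrite ?normr1 ?normr0.
Qed.

Lemma test_fun_bounds (D : set V) (phi : V -> R) (j : 'I_n) : test_fun D phi ->
  exists k M, (forall x, ~ cubek k x -> phi x = 0 /\ partial j phi x = 0) /\
    forall x, `|phi x| <= M /\ `|partial j phi x| <= M.
Proof.
move=> [sphi [C [cC CD phi0]]].
have [k Ck] := compact_sub_cubek cC.
have [cphi _] := sphi [::]; have [cdphi _] := sphi [:: j].
have dphi0 x : ~ C x -> partial j phi x = 0.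
  move=> nCx; rewrite /partial.
  have oC : open (~` C) by rewrite openC; apply: compact_closed => //; exact: norm_hausdorff.
  have near0 : \forall y \near x, phi y = (cst 0 : V -> R) y.
    have : nbhs x (~` C) by rewrite openE in oC; exact: oC.
    by apply: filterS => y; exact: phi0.
  by rewrite (near_eq_derive _ near0) derive_cst.
have [M1 h1] := continuous_bounded_compact cphi cC.
have [M2 h2] := continuous_bounded_compact cdphi cC.
exists k, (`|M1| + `|M2|); split => x.
  move=> nk; have nC : ~ C x by move=> /Ck.
  by rewrite phi0// dphi0.
case: (pselect (C x)) => Cx; last by rewrite phi0// dphi0// normr0 addr_ge0.
split; [rewrite (le_trans (h1 x Cx))//|rewrite (le_trans (h2 x Cx))//].
  by rewrite (le_trans (ler_norm _))// lerDl.
by rewrite (le_trans (ler_norm _))// lerDr.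
Qed.

(** Translation invariance moves the difference quotient from [phi] to [g], and dominated
    convergence lets the step tend to 0 on both sides; the Lipschitz bound dominates the quotients
    of [g]. Differentiability is asked only a.e. because the maps of the construction have kinks on
    spheres. *)
Lemma ibp_lipschitz (g g' phi : V -> R) (D : set V) (j : 'I_n) (L : R) :
  continuous g -> measurable_fun setT (g' : Rn R n -> R) ->
  (forall x (t : R), `|g (x + t *: ej R j) - g x| <= L * `|t|) ->
  ae_in setT (fun x => is_derive x (ej R j) g (g' x)) -> test_fun D phi ->
  mu.-integrable setT (fun x : Rn R n => (g' x * phi x)%:E) /\
  (\int[mu]_(x in setT) (g x * partial j phi x)%:E =
   - \int[mu]_(x in setT) (g' x * phi x)%:E)%E.
Proof.
move=> cg mg' gL aeg tphi.
have [k [M [phi0 phiM]]] := test_fun_bounds j tphi.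
have [sphi _] := tphi; have [cphi dphi] := sphi [::]; have [cdphi _] := sphi [:: j].
pose e := ej R j.
pose t (i : nat) : R := i.+1%:R^-1.
have t0 i : 0 < t i by rewrite invr_gt0.
have ti0 i : 0 < (t i)^-1 by rewrite invr_gt0.
have t1 i : t i <= 1 by rewrite invf_le1// ler1n.
have tn i : `|t i| <= 1 by rewrite gtr0_norm.
have mct (h : V -> R) : continuous h -> measurable_fun setT (h : Rn R n -> R).
  by move=> ch; exact: continuous_measurable_Rn.
have [Mg hMg] := continuous_bounded_compact cg (@compact_cubek k.+1).
have M0 : 0 <= M by rewrite (le_trans (normr_ge0 (phi 0)))//; exact: (phiM 0).1.
pose N := `|Mg|.
have N0 : 0 <= N by exact: normr_ge0.
have gN x : cubek k.+1 x -> `|g x| <= N.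
  by move=> h; rewrite (le_trans (hMg _ h))// ler_norm.
have kk x : cubek k x -> @cubek R n k.+1 x.
  by move=> h i; rewrite (le_trans (h i))// ler_nat.
(* Steps have length at most 1, so the shifted supports stay in the next larger cube, which serves
   as common domain. *)
have phiS x s : `|s| <= 1 -> ~ cubek k.+1 x -> phi (x + s *: e) = 0.
  move=> s1 nk; apply: (phi0 _ _).1 => h; apply: nk.
  have := @cubek_shift k _ (- s) j _ h; rewrite normrN -addrA -scalerDl subrr scale0r addr0.
  by apply.
(* The quotients are cut into products that are integrable one by one: [g] times the backward
   quotient of [phi] is [P - Q], minus the forward quotient of [g] times [phi] is [P - Q'], and [Q]
   is a translate of [Q']. *)
pose P i x := (t i)^-1 * (g x * phi x).
pose Q i x := (t i)^-1 * (g x * phi (x - t i *: e)).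
pose Q' i x := (t i)^-1 * (g (x + t i *: e) * phi x).
have bound3 i (a b : R) : `|a| <= N -> `|b| <= M -> `|(t i)^-1 * (a * b)| <= (t i)^-1 * (N * M).
  by move=> ha hb; rewrite normrM (gtr0_norm (ti0 i)) ler_pM2l// normrM ler_pM.
have zero3 i (a : R) : `|(t i)^-1 * (a * 0)| <= (t i)^-1 * (N * M).
  by rewrite !mulr0 normr0; apply: mulr_ge0; [exact/ltW|exact: mulr_ge0].
have iP i : mu.-integrable setT (EFin \o (P i : Rn R n -> R)).
  apply: (@integrable_bounded_cubek _ k ((t i)^-1 * (N * M))).
  - apply: mct; apply: mul_continuous_fun; first exact: cst_continuous.
    exact: mul_continuous_fun.
  - move=> x; case: (pselect (cubek k x)) => h; last by rewrite /P (phi0 x h).1.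
    by apply: bound3; [exact/gN/kk|exact: (phiM x).1].
  - by move=> x /phi0[h _]; rewrite /P h !mulr0.
have iQ i : mu.-integrable setT (EFin \o (Q i : Rn R n -> R)).
  apply: (@integrable_bounded_cubek _ k.+1 ((t i)^-1 * (N * M))).
  - apply: mct; apply: mul_continuous_fun; first exact: cst_continuous.
    by apply: mul_continuous_fun => //; exact: comp_translate_continuous.
  - move=> x; case: (pselect (cubek k.+1 x)) => h.
      by apply: bound3; [exact/gN|exact: (phiM _).1].
    by rewrite /Q -scaleNr phiS// normrN.
  - by move=> x h; rewrite /Q -scaleNr phiS ?mulr0// normrN.
have iQ' i : mu.-integrable setT (EFin \o (Q' i : Rn R n -> R)).
  apply: (@integrable_bounded_cubek _ k ((t i)^-1 * (N * M))).
  - apply: mct; apply: mul_continuous_fun; first exact: cst_continuous.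
    by apply: mul_continuous_fun => //; exact: comp_translate_continuous.
  - move=> x; case: (pselect (cubek k x)) => h; last by rewrite /Q' (phi0 x h).1.
    by apply: bound3; [exact/gN/cubek_shift|exact: (phiM x).1].
  - by move=> x /phi0[h _]; rewrite /Q' h !mulr0.
have QQ' i : (\int[mu]_x (Q i x)%:E = \int[mu]_x (Q' i x)%:E)%E.
  rewrite -(@integral_translate _ _ (- t i *: e) (fun x => (Q' i x)%:E)).
  - by apply: eq_integral => x _; rewrite /Q /Q' -scaleNr -addrA -scalerDl addNr scale0r addr0.
  - rewrite (_ : (fun x => _) = EFin \o (Q i : Rn R n -> R))//.
    by apply/funext => x; rewrite /Q /Q'/= -scaleNr -addrA -scalerDl addNr scale0r addr0.
  - by have /integrableP[] := iQ' i.
pose a i (x : V) := g x * ((- t i)^-1 * (phi (x - t i *: e) - phi x)).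
pose b i (x : V) := - (t i)^-1 * (g (x + t i *: e) - g x) * phi x.
pose A i (x : Rn R n) := (a i x)%:E.
pose B i (x : Rn R n) := (b i x)%:E.
have AB i : (\int[mu]_x A i x = \int[mu]_x B i x)%E.
  transitivity (\int[mu]_x ((P i x)%:E - (Q i x)%:E))%E.
    by apply: eq_integral => x _; rewrite /A /a /P /Q -EFinB invrN; congr EFin; ring.
  rewrite integralB_EFin// QQ' -integralB_EFin//.
  by apply: eq_integral => x _; rewrite /B /b /P /Q' -EFinB; congr EFin; ring.
have idom (m : nat) (c : R) : 0 <= c ->
    mu.-integrable setT (fun x => (c * \1_(cubek m : set (Rn R n)) x)%:E).
  move=> c0; apply: (@integrable_bounded_cubek (fun x => c * \1_(cubek m) x) m c).
  - apply: measurable_funM => //; apply: measurable_indic; exact: measurable_cubek.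
  - move=> x; rewrite indicE; case: (_ \in _); rewrite ?mulr1 ?mulr0 ?normr0// ger0_norm//.
  - by move=> x h; rewrite indicE memNset// mulr0.
have dle x : `|partial j phi x| <= M by exact: (phiM x).2.
have tNinv i : `|(- t i)^-1| = (t i)^-1.
  by rewrite invrN normrN gtr0_norm.
have mA i : measurable_fun setT (A i).
  apply/measurable_EFinP; apply: mct; apply: mul_continuous_fun => //.
  apply: mul_continuous_fun; first exact: cst_continuous.
  by apply: sub_continuous_fun => //; exact: comp_translate_continuous.
have mB i : measurable_fun setT (B i).
  apply/measurable_EFinP; apply: mct; apply: mul_continuous_fun => //.
  apply: mul_continuous_fun; first exact: cst_continuous.
  by apply: sub_continuous_fun => //; exact: comp_translate_continuous.
have mA' : measurable_fun setT (fun x : Rn R n => (g x * partial j phi x)%:E).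
  by apply/measurable_EFinP; apply: mct; exact: mul_continuous_fun.
have mB' : measurable_fun setT (fun x : Rn R n => (- (g' x) * phi x)%:E).
  apply/measurable_EFinP; apply: measurable_funM; last exact: mct.
  exact: measurableT_comp.
have tneq i : t i != 0 by rewrite gt_eqF.
have tNneq i : - t i != 0 by rewrite oppr_eq0.
have ct0 : t @ \oo --> (0 : R) by exact: cvg_harmonic.
have cNt0 : (fun i => - t i) @ \oo --> (0 : R) by rewrite -oppr0; exact: cvgN.
have cvgA : {ae mu, forall x, setT x -> A ^~ x @ \oo --> (g x * partial j phi x)%:E}.
  apply: aeW => x _; apply: cvg_EFin; first by apply: nearW.
  apply: cvgM; first exact: cvg_cst.
  have dx : is_derive (x : V) e phi (partial j phi x) by apply/derivableP; exact: dphi.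
  have := is_derive_cvg_seq dx tNneq cNt0.
  by under eq_fun do rewrite scaleNr.
have cvgB : {ae mu, forall x, setT x -> B ^~ x @ \oo --> (- (g' x) * phi x)%:E}.
  have [Z [mZ Z0 sZ]] := aeg; exists Z; split => // x /= nx; apply: sZ; split => // dx.
  apply: nx => _; apply: cvg_EFin; first by apply: nearW.
  apply: cvgM; last exact: cvg_cst.
  have /cvgN := is_derive_cvg_seq dx tneq ct0; apply: cvg_trans.
  by apply: near_eq_cvg; apply: nearW => i; rewrite /= mulNr.
have domA : {ae mu, forall x i, setT x ->
    `|A i x| <= (N * M * \1_(cubek k.+1 : set (Rn R n)) x)%:E}%E.
  apply: aeW => x i _; rewrite /A/= lee_fin indicE.
  case: (pselect (cubek k.+1 x)) => h.
    rewrite mem_set// mulr1 /a normrM ler_pM// ?gN// normrM tNinv.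
    rewrite mulrC ler_pdivrMr// -scaleNr.
    have := @line_lipschitz _ _ phi x e M (fun y => dphi j y) dle (- t i).
    by rewrite normrN (gtr0_norm (t0 i)).
  by rewrite /a -scaleNr phiS ?normrN// (phi0 _ _).1 ?subrr ?mulr0 ?normr0 ?mulr_ge0// => /kk.
have domB : {ae mu, forall x i, setT x ->
    `|B i x| <= (`|L| * M * \1_(cubek k : set (Rn R n)) x)%:E}%E.
  apply: aeW => x i _; rewrite /B/= lee_fin indicE.
  case: (pselect (cubek k x)) => h.
    rewrite mem_set// mulr1 /b normrM ler_pM//; last exact: (phiM x).1.
    rewrite normrM normrN (gtr0_norm (ti0 i)) mulrC ler_pdivrMr//.
    rewrite (le_trans (gL x (t i)))// (gtr0_norm (t0 i)) ler_pM2r//.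
    exact: ler_norm.
  by rewrite /b (phi0 x h).1 mulr0 normr0 !mulr_ge0.
have [_ _ cA] := dominated_convergence measurableT mA mA' cvgA
  (idom k.+1 _ (mulr_ge0 (normr_ge0 _) M0)) domA.
have [iB _ cB] := dominated_convergence measurableT mB mB' cvgB
  (idom k _ (mulr_ge0 (normr_ge0 _) M0)) domB.
have ig' : mu.-integrable setT (fun x : Rn R n => (g' x * phi x)%:E).
  have := integrableN iB; congr (_.-integrable _ _).
  by apply/funext => x /=; rewrite mulNr opprK.
split => //.
have -> : (\int[mu]_x (g x * partial j phi x)%:E = \int[mu]_x (- (g' x) * phi x)%:E)%E.
  apply: (cvg_unique _ cA); first exact: ereal_hausdorff.
  rewrite (_ : (fun i => _) = (fun i => \int[mu]_x B i x)%E)//.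
  by apply/funext => i; exact: AB.
rewrite -integralN; last exact: integrable_add_def.
by apply: eq_integral => x _; rewrite -EFinN mulNr.
Unshelve. all: by end_near. Qed.

End integration_by_parts.

(** * Flat functions [P(1/x) exp(-1/x)] of one variable *)

Section flat_exponential.
Context {R : realType}.
Implicit Types (P : {poly R}) (x y : R).

(** Carrying the polynomial [P] makes the family closed under differentiation: the derivative has
    the same shape with [X^2 (P - P')]. The case [P = 1] is the classical flat function. *)
Definition flatexp P x : R := if 0 < x then P.[x^-1] * expR (- x^-1) else 0.

Lemma monomial_expR_le k y : 0 <= y -> y ^+ k * expR (- y) <= k`!%:R.
Proof.
move=> y0; rewrite expRN ler_pdivrMr ?expR_gt0//.
case: k => [|k]; first by rewrite expr0 fact0 mul1r (le_trans _ (expR_ge1Dx _))// lerDl.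
rewrite mulrC -ler_pdivrMr ?ltr0n ?fact_gt0//.
by rewrite (le_trans _ (expR_ge1Dxn k y0))// lerDr.
Qed.

Lemma poly_expR_bounded P : exists2 C, 0 <= C & forall y, 0 <= y -> `|P.[y] * expR (- y)| <= C.
Proof.
exists (\sum_(i < size P) `|P`_i| * i`!%:R).
  by apply: sumr_ge0 => i _; rewrite mulr_ge0.
move=> y y0; rewrite horner_coef mulr_suml (le_trans (ler_norm_sum _ _ _))//.
apply: ler_sum => i _; rewrite -mulrA normrM ler_wpM2l//.
by rewrite ger0_norm ?mulr_ge0 ?exprn_ge0 ?expR_ge0// monomial_expR_le.
Qed.

Lemma flatexp_bounded P : exists2 C, 0 <= C & forall x, `|flatexp P x| <= C.
Proof.
have [C C0 hC] := poly_expR_bounded P; exists C => // x.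
by rewrite /flatexp; case: ifPn => [x0|_]; rewrite ?normr0// hC// invr_ge0 ltW.
Qed.

(** Every member of the family is bounded, so each use of this identity shows one more order of
    vanishing at 0. *)
Lemma flatexp_mulX P x : flatexp P x = x * flatexp ('X * P) x.
Proof.
rewrite /flatexp; case: ifPn => [x0|_]; last by rewrite mulr0.
by rewrite hornerM hornerX !mulrA mulfV ?mul1r// gt_eqF.
Qed.

Lemma is_derive_flatexp P x :
  is_derive x 1 (flatexp P) (flatexp ('X^2 * (P - P^`())) x).
Proof.
have [x0|x0|->] := ltgtP x 0.
- have -> : flatexp ('X^2 * (P - P^`())) x = 0 by rewrite /flatexp ltNge (ltW x0).
  apply: (@near_eq_is_derive _ _ _ (cst (0 : R) : R -> R)).
  near=> y; rewrite /flatexp ltNge (_ : y <= 0)//; apply/ltW.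
  by near: y; exact: lt_nbhsl.
- have xn : x != 0 by rewrite gt_eqF.
  have di : is_derive x 1 (fun y : R => y^-1) (- x ^- 2).
    have := @is_deriveV _ id x 1 1 xn (is_derive_id _ _).
    by rewrite /= [_ *: _]mulr1.
  have dP : is_derive x 1 (horner P \o (fun y : R => y^-1)) (P^`().[x^-1] * (- x ^- 2)).
    exact: is_derive1_comp.
  have dN : is_derive x 1 (fun y : R => - y^-1) (x ^- 2).
    by have := @is_deriveN _ _ _ _ _ _ _ di; rewrite opprK.
  have dE : is_derive x 1 (expR \o (fun y : R => - y^-1)) (expR (- x^-1) * x ^- 2).
    exact: is_derive1_comp.
  have key : is_derive x 1 ((horner P \o (fun y : R => y^-1)) * (expR \o (fun y : R => - y^-1)))
      (flatexp ('X^2 * (P - P^`())) x).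
    apply: (is_derive_eq (is_deriveM dP dE)).
    rewrite /flatexp x0 !hornerE /= /GRing.scale/= exprVn; ring.
  apply: (near_eq_is_derive _ key).
  near=> y; rewrite /flatexp (_ : 0 < y)//.
  by near: y; exact: lt_nbhsr.
- have -> : flatexp ('X^2 * (P - P^`())) 0 = 0 by rewrite /flatexp ltxx.
  (* The factor [x] is extracted twice: once to cancel the denominator of the quotient, once to
     leave a bound [C |h|]. *)
  have [C C0 hC] := flatexp_bounded ('X * ('X * P)).
  have lim0 : (fun h : R => h^-1 *: ((flatexp P \o shift 0) (h *: 1) - flatexp P 0)) @ 0^' --> 0.
    apply/cvgr0Pnorm_le => e e0; near=> h.
    have h0 : h != 0 by near: h; exact: nbhs_dnbhs_neq.
    rewrite /= addr0 [h *: 1]mulr1 {2}/flatexp ltxx subr0 flatexp_mulX.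
    rewrite [_ *: _]mulrA mulVf// mul1r flatexp_mulX normrM.
    rewrite (le_trans (ler_wpM2l _ (hC h)))//.
    have hd : `|h| <= e / (C + 1) by near: h; apply: dnbhs0_le; rewrite divr_gt0// ltr_wpDl.
    rewrite (le_trans (ler_wpM2r C0 hd))// mulrAC ler_pdivrMr ?ltr_wpDl//.
    by rewrite ler_wpM2l ?(ltW e0)// lerDl.
  split; first by apply/cvg_ex; exists 0.
  exact/cvg_lim.
Unshelve. all: by end_near. Qed.

Lemma continuous_flatexp P : continuous (flatexp P).
Proof.
move=> x; apply: differentiable_continuous; apply/derivable1_diffP.
by have [] := is_derive_flatexp P x.
Qed.

Lemma flatexp1_ge0 x : 0 <= flatexp 1 x.
Proof. by rewrite /flatexp; case: ifP; rewrite ?hornerE ?mul1r ?expR_ge0. Qed.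

Lemma flatexp1_le1 x : flatexp 1 x <= 1.
Proof.
rewrite /flatexp; case: ifPn => // x0; rewrite hornerE mul1r -expR0 ler_expR.
by rewrite oppr_le0 invr_ge0 ltW.
Qed.

Lemma flatexp1_ge x y : 0 < y -> y <= x -> expR (- y^-1) <= flatexp 1 x.
Proof.
move=> y0 yx; have x0 := lt_le_trans y0 yx.
by rewrite /flatexp x0 hornerE mul1r ler_expR lerN2 lef_pV2.
Qed.

End flat_exponential.

(** * Smooth bumps supported on cubes *)

Section cbump.
Context {R : realType} {n : nat}.
Local Notation V := 'rV[R]_n.

(** [smooth] quantifies over all iterated partial derivatives. Membership in this algebra passes to
    every partial derivative, so smoothness of all orders follows from a single closure lemma. *)
Inductive bumpalg : (V -> R) -> Prop :=
| bumpalg_gen P s b j : bumpalg (fun x => flatexp P (s * x 0 j + b))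
| bumpalg_cst c : bumpalg (fun=> c)
| bumpalg_add f g : bumpalg f -> bumpalg g -> bumpalg (fun x => f x + g x)
| bumpalg_mul f g : bumpalg f -> bumpalg g -> bumpalg (fun x => f x * g x).

Lemma bumpalg_continuous f : bumpalg f -> continuous f.
Proof.
elim=> [P s b j|c|{}f g _ cf _ cg|{}f g _ cf _ cg].
- move=> x; apply: (@continuous_comp _ _ _ (fun x : V => s * x 0 j + b) (flatexp P)).
    apply: add_continuous_fun; last exact: cst_continuous.
    by apply: mul_continuous_fun; [exact: cst_continuous|exact: coord_continuous].
  exact: continuous_flatexp.
- exact: cst_continuous.
- exact: add_continuous_fun.
- exact: mul_continuous_fun.
Qed.

Lemma bumpalg_derive f (i : 'I_n) : bumpalg f ->
  exists2 df, bumpalg df & forall x, is_derive x (ej R i) f (df x).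
Proof.
elim=> [P s b j|c|{}f g bf [df bdf hf] bg [dg bdg hg]|{}f g bf [df bdf hf] bg [dg bdg hg]].
- exists (fun x => flatexp ('X^2 * (P - P^`())) (s * x 0 j + b) * (s * (i == j)%:R)).
    by apply: bumpalg_mul; [exact: bumpalg_gen|exact: bumpalg_cst].
  move=> x; apply: line_is_derive.
  pose c : R := s * (i == j)%:R.
  pose l : R -> R := c *: (id : R -> R) + cst (s * x 0 j + b).
  have dl : is_derive (0 : R) 1 l c.
    apply: (is_derive_eq (is_deriveD (is_deriveZ c (is_derive_id (0 : R) (1 : R)))
      (is_derive_cst (s * x 0 j + b) (0 : R) (1 : R)))).
    by rewrite addr0 [_ *: _]mulr1.
  have lE w : l w = c * w + (s * x 0 j + b) by [].
  rewrite (_ : (fun w => _) = flatexp P \o l).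
    have -> : s * x 0 j + b = l 0 by rewrite lE mulr0 add0r.
    exact: (is_derive1_comp (is_derive_flatexp P (l 0)) dl).
  by apply/funext => w /=; congr flatexp; rewrite lE /c !mxE eqxx/= (eq_sym j); ring.
- by exists (fun=> 0); [exact: bumpalg_cst|move=> x; exact: is_derive_cst].
- by exists (fun x => df x + dg x); [exact: bumpalg_add|move=> x; exact: is_deriveD].
- exists (fun x => f x * dg x + g x * df x).
    by apply: bumpalg_add; exact: bumpalg_mul.
  by move=> x; exact: (is_deriveM (hf x) (hg x)).
Qed.

Lemma bumpalg_smooth f : bumpalg f -> smooth f.
Proof.
move=> bf l; have bl : bumpalg (iter_partial l f).
  elim: l => //= j l bl; have [df bdf hdf] := bumpalg_derive j bl.
  rewrite (_ : partial j _ = df)//; apply/funext => x.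
  by have [_ hx] := hdf x; exact: hx.
split; first exact: bumpalg_continuous.
move=> j x; have [df _ h] := bumpalg_derive j bl; by have [] := h x.
Qed.

Lemma bumpalg_prod (I : Type) (r : seq I) (F : I -> V -> R) :
  (forall i, bumpalg (F i)) -> bumpalg (fun x => \prod_(i <- r) F i x).
Proof.
move=> h; elim: r => [|i r IH].
  by under eq_fun do rewrite big_nil; exact: bumpalg_cst.
by under eq_fun do rewrite big_cons; exact: bumpalg_mul.
Qed.

(** In each coordinate the two arguments are [(x_j - a_j)/h] and [(a_j + h - x_j)/h], both positive
    only strictly inside the cube. They are written in the affine form of the generators of
    [bumpalg]. *)
Definition cbump (a : V) (h : R) (x : V) : R :=
  \prod_(j < n) (flatexp 1 (h^-1 * x 0 j + (- a 0 j / h)) *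
                 flatexp 1 (- h^-1 * x 0 j + (a 0 j + h) / h)).

Definition ccube (a : V) (h : R) : set V := [set v | forall i, a 0 i <= v 0 i <= a 0 i + h].

Lemma closed_ccube a h : closed (ccube a h).
Proof.
rewrite (_ : ccube _ _ = \bigcap_(i in [set: 'I_n])
  ((fun v : V => v 0 i) @^-1` `[a 0 i, a 0 i + h])).
  apply: closed_bigI => i _; apply: closed_comp => [v _|]; first exact: coord_continuous.
  exact: interval_closed.
apply/seteqP; split => v /= hv i; first by rewrite /= in_itv/=.
by move: (hv i I); rewrite /= in_itv/=.
Qed.

Lemma cube_sub_ccube a h : cube a h `<=` ccube a h.
Proof. by move=> x hx i; case/andP: (hx i) => -> /ltW ->. Qed.

Lemma compact_ccube a h : compact (ccube a h).
Proof.
apply: (@subclosed_compact _ _ (@cubek R n (Num.truncn (`|a| + `|h|)).+1)).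
- exact: closed_ccube.
- exact: compact_cubek.
- move=> x hx i; apply: le_trans (ltW (truncnS_gt _)).
  have /andP[h1 h2] := hx i; have ha := norm_coord_le a i.
  rewrite ler_norml; apply/andP; split.
    by have := ler_norm (- a 0 i); rewrite normrN; have := normr_ge0 h; lra.
  by have := ler_norm (a 0 i); have := ler_norm h; lra.
Qed.

Lemma bump_ge0 a h x : 0 <= cbump a h x.
Proof. by apply: prodr_ge0 => j _; rewrite mulr_ge0// flatexp1_ge0. Qed.

Lemma bump_le1 a h x : cbump a h x <= 1.
Proof.
suff /andP[_ ->] : 0 <= cbump a h x <= 1 by [].
apply: (big_ind (fun y => 0 <= y <= 1)) => [|y z|j _]; first by rewrite ler01 lexx.
  by move=> /andP[y0 y1] /andP[z0 z1]; rewrite mulr_ge0//= mulr_ile1.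
by rewrite mulr_ge0 ?flatexp1_ge0//= mulr_ile1 ?flatexp1_ge0 ?flatexp1_le1.
Qed.

Lemma bump_out a h x : 0 < h -> ~ cube a h x -> cbump a h x = 0.
Proof.
move=> h0 nx; apply/eqP/prodf_eq0; apply: contra_notP nx => nx i.
have : flatexp 1 (h^-1 * x 0 i + (- a 0 i / h)) *
       flatexp 1 (- h^-1 * x 0 i + (a 0 i + h) / h) != 0.
  by apply/negP => H; apply: nx; exists i.
rewrite mulf_eq0 negb_or /flatexp => /andP[].
case: ifPn => [|_]; rewrite ?eqxx// => H1 _.
case: ifPn => [|_]; rewrite ?eqxx// => H2 _.
move: H1 H2; rewrite [_ * x 0 i]mulrC -mulrDl mulNr [_ * x 0 i]mulrC -mulNr -mulrDl.
by rewrite !pmulr_lgt0 ?invr_gt0// subr_gt0 addrC subr_gt0 => /ltW -> ->.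
Qed.

Lemma bump_test (D : set V) a h : 0 < h -> ccube a h `<=` D -> test_fun D (cbump a h).
Proof.
move=> h0 sD; split.
  apply: bumpalg_smooth; apply: bumpalg_prod => j.
  by apply: bumpalg_mul; exact: bumpalg_gen.
exists (ccube a h); split => //; first exact: compact_ccube.
by move=> x nx; apply: bump_out => // /cube_sub_ccube.
Qed.

(** On the concentric cube of side [h/2] all [2n] arguments of the bump are at least [1/4], so each
    factor is at least [exp(-4)]; the power of [1/2] is the ratio of volumes. The constant is
    independent of the scale [h]. *)
Definition bump_const : R := expR (- 4) ^+ (n + n) * (2^-1) ^+ n.

Lemma bump_const_gt0 : 0 < bump_const.
Proof. by rewrite mulr_gt0// exprn_gt0// ?expR_gt0. Qed.

Lemma integral_bump_ge a h : 0 < h ->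
  ((bump_const * h ^+ n)%:E <= \int[@leb R n]_x (cbump a h x)%:E)%E.
Proof.
move=> h0; pose b : V := \row_i (a 0 i + h / 4).
have mb : measurable (cube b (h / 2) : set (Rn R n)) by exact: measurable_cube.
apply: (@le_trans _ _ (\int[@leb R n]_x
    (expR (- 4) ^+ (n + n) * \1_(cube b (h / 2) : set (Rn R n)) x)%:E)%E).
  under eq_integral do rewrite EFinM.
  rewrite ge0_integralZl//; last by apply/measurable_EFinP; exact: measurable_indic.
  have -> : (\int[@leb R n]_x (\1_(cube b (h / 2) : set (Rn R n)) x)%:E = ((h / 2) ^+ n)%:E)%E.
    by rewrite integral_indic// setIT; apply: leb_cube; rewrite divr_ge0// ltW.
  by rewrite -EFinM lee_fin /bump_const exprMn -mulrA [X in _ * X <= _]mulrC.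
apply: ge0_le_integral => //.
- apply/measurable_EFinP; apply: measurable_funM => //; exact: measurable_indic.
- apply/measurable_EFinP; apply: continuous_measurable_Rn => //.
  by apply: bumpalg_continuous; apply: bumpalg_prod => j; apply: bumpalg_mul; exact: bumpalg_gen.
- move=> x _; rewrite lee_fin indicE; case: (pselect (cube b (h / 2) x)) => hx; last first.
    by rewrite memNset// mulr0 bump_ge0.
  rewrite mem_set// mulr1 exprD -exprMn /cbump -[X in _ ^+ X]card_ord -prodr_const.
  apply: ler_prod => j _; rewrite mulr_ge0 ?expR_ge0//=.
  have := hx j; rewrite mxE => /andP[hx1 hx2].
  have h4 : (4 : R) = (4^-1)^-1 by rewrite invrK.
  by apply: ler_pM; rewrite ?expR_ge0// h4; apply: flatexp1_ge;
    rewrite ?invr_gt0// [_ * x 0 j]mulrC ?mulrN -?mulNr -mulrDl ler_pdivlMr//; lra.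
Qed.

End cbump.

(** * Determinant and distortion of rank-one perturbations of the identity *)

Section rank_one_perturbation.
Context {R : realType} {n : nat}.
Local Notation V := 'rV[R]_n.
Implicit Types (u v xi : V) (b : R).

(** Sylvester's identity: the block matrix [M] is factored with either Schur complement and the two
    determinants are compared. *)
Lemma det_1_sub_rank1 b u : \det (1%:M - b *: (u^T *m u)) = 1 - b * (u *m u^T) 0 0.
Proof.
set M := block_mx (1%:M : 'M[R]_1) u (b *: u^T) (1%:M : 'M[R]_n).
have M1 : M = block_mx 1%:M 0 (b *: u^T) 1%:M *m
              block_mx 1%:M u 0 (1%:M - b *: (u^T *m u)).
  rewrite mulmx_block !mul1mx ?mulmx1 ?mulmx0 ?mul0mx ?addr0 -scalemxAl.
  by rewrite addrC subrK.
have M2 : M = block_mx (1%:M - b *: (u *m u^T)) u 0 1%:M *m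
              block_mx 1%:M 0 (b *: u^T) 1%:M.
  rewrite mulmx_block ?mulmx1 ?mulmx0 ?mul0mx ?add0r ?mul1mx -scalemxAr.
  by rewrite subrK.
have := erefl (\det M); rewrite {1}M1 {1}M2 !det_mulmx !det_ublock !det_lblock !det1.
by rewrite !mul1r !mulr1 => ->; rewrite det_mx11 !mxE.
Qed.

Lemma sqr_enorm u : enorm u ^+ 2 = \sum_i u 0 i ^+ 2.
Proof. by rewrite sqr_sqrtr// sumr_ge0// => i _; exact: sqr_ge0. Qed.

Lemma enorm_ge0 u : 0 <= enorm u. Proof. exact: sqrtr_ge0. Qed.

(** For a unit vector [u] the matrix acts as [k] on the hyperplane orthogonal to [u] and as [-k al]
    along [u], so lengths are stretched by factors between [k al] and [k], whose ratio is
    [1/al = K]. *)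
Lemma distortion_rank1 (K al k : R) u : 0 <= k -> 0 < al -> al <= 1 -> K * al = 1 ->
  \sum_i u 0 i ^+ 2 = 1 ->
  distortion_le K (k *: (1%:M - (1 + al) *: (u^T *m u))).
Proof.
move=> k0 al0 al1 Kal u1.
set A := _ *: _.
have AE xi i : (xi *m A^T) 0 i = k * (xi 0 i - (1 + al) * (\sum_j xi 0 j * u 0 j) * u 0 i).
  have -> : A^T = A.
    by rewrite /A linearZ/= linearB/= linearZ/= trmx_mul trmxK tr_scalar_mx.
  rewrite /A -scalemxAr mxE mulmxBr mulmx1 -scalemxAr mulmxA !mxE; congr (_ * (_ - _)).
  rewrite big_ord1 mulrA; congr (_ * _ * _).
  by rewrite mxE; apply: eq_bigr => j _; rewrite mxE.
have key xi : \sum_i xi 0 i ^+ 2 = 1 ->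
    enorm (xi *m A^T) ^+ 2 = k ^+ 2 * (1 - (1 - al ^+ 2) * (\sum_j xi 0 j * u 0 j) ^+ 2)
    /\ (\sum_j xi 0 j * u 0 j) ^+ 2 <= 1.
  move=> xi1; set t := \sum_j _.
  (* Here [t] is the inner product of [xi] and [u]. The choice [c = (1 + al) t] computes the squared
     length of the image; the choice [c = t] gives the Cauchy-Schwarz bound [t^2 <= 1]. *)
  have expand (b c : R) : \sum_i (b * (xi 0 i - c * u 0 i)) ^+ 2 =
      b ^+ 2 * (1 - c * t *+ 2 + c ^+ 2).
    transitivity (\sum_i (b ^+ 2 * xi 0 i ^+ 2 - b ^+ 2 * c *+ 2 * (xi 0 i * u 0 i)
        + b ^+ 2 * c ^+ 2 * u 0 i ^+ 2)).
      by apply: eq_bigr => i _; ring.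
    rewrite big_split/= sumrB -!mulr_sumr xi1 u1 -/t; ring.
  split; last first.
    have := expand 1 t; rewrite expr1n mul1r => h.
    have : 0 <= 1 - t * t *+ 2 + t ^+ 2 by rewrite -h sumr_ge0// => i _; exact: sqr_ge0.
    by rewrite -expr2; lra.
  rewrite sqr_enorm; under eq_bigr do rewrite AE -/t.
  rewrite expand; congr (_ * _); ring.
move=> xi bubble nxi neta.
have sxi : \sum_i xi 0 i ^+ 2 = 1 by rewrite -sqr_enorm nxi expr1n.
have seta : \sum_i bubble 0 i ^+ 2 = 1 by rewrite -sqr_enorm neta expr1n.
have [exi txi] := key _ sxi; have [eeta teta] := key _ seta.
have K0 : 0 < K by rewrite -(pmulr_lgt0 _ al0) Kal.
have al2 : al ^+ 2 <= 1 by rewrite expr_le1// ltW.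
have upper : enorm (xi *m A^T) <= k.
  rewrite -(ler_pXn2r (ltn0Sn 1)) ?nnegrE ?enorm_ge0// exi ler_piMr ?sqr_ge0//.
  by rewrite gerBl mulr_ge0 ?sqr_ge0// subr_ge0.
have lower : k * al <= enorm (bubble *m A^T).
  rewrite -(ler_pXn2r (ltn0Sn 1)) ?nnegrE ?enorm_ge0// ?mulr_ge0 ?(ltW al0)//.
  rewrite eeta exprMn ler_wpM2l ?sqr_ge0//.
  have : (1 - al ^+ 2) * (\sum_j bubble 0 j * u 0 j) ^+ 2 <= (1 - al ^+ 2) * 1.
    by rewrite ler_wpM2l// subr_ge0.
  lra.
rewrite (le_trans upper)// (le_trans _ (ler_wpM2l (ltW K0) lower))//.
by rewrite mulrCA Kal mulr1.
Qed.

End rank_one_perturbation.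

(** * The radial model map on a ball *)

Section profile.
Context {R : realType} {n : nat}.
Local Notation V := 'rV[R]_n.
Variables (lam beta : R).
Hypotheses (lam0 : 0 < lam) (lam1 : lam < 1) (beta1 : 1 < beta).
Implicit Types (a x : V) (r : R).

(** Truncating the relative radius to [[lam, 1]] puts the exterior, the annulus and the core under
    one formula, so continuity and Lipschitz bounds are proved once for the three regions. *)
Definition clip (t : R) : R := Num.max lam (Num.min t 1).

Lemma clip_bounds t : lam <= clip t <= 1.
Proof. by rewrite /clip le_max lexx/= ge_max (ltW lam1) ge_min lexx orbT. Qed.

Lemma clip_gt0 t : 0 < clip t.
Proof. by case/andP: (clip_bounds t) => /(lt_le_trans lam0). Qed.

Lemma clip_lip s t : `|clip s - clip t| <= `|s - t|.
Proof.
have M u : clip u = if u <= lam then lam else if u <= 1 then u else 1.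
  rewrite /clip; have [u1|u1] := leP u 1.
    by have [ul|ul] := leP u lam.
  rewrite (max_idPr (ltW lam1)); have [ul|//] := leP u lam.
  by have := lt_trans lam1 (lt_le_trans u1 ul); rewrite ltxx.
wlog st : s t / s <= t.
  by move=> h; have [/h//|/ltW/h] := leP s t; rewrite distrC (distrC t).
rewrite distrC (distrC s) (ger0_norm (_ : 0 <= t - s)) ?subr_ge0// !M.
have l1 := lam1.
case: (leP t lam) => ?; case: (leP s lam) => ?; case: (leP t 1) => ?;
  case: (leP s 1) => ?; rewrite ger0_norm; lra.
Qed.

Let beta_ge0 : 0 <= beta. Proof. by rewrite (le_trans ler01)// ltW. Qed.

Lemma powR_homo (s t : R) : 0 <= s -> s <= t -> s `^ beta <= t `^ beta.
Proof.
move=> s0 st; apply: ge0_ler_powR => //; rewrite nnegrE//.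
exact: le_trans st.
Qed.

Lemma powRN_lip s t : lam <= s -> lam <= t ->
  `|s `^ (- beta) - t `^ (- beta)| <= beta * lam `^ (- beta - 1) * `|s - t|.
Proof.
wlog st : s t / s <= t.
  move=> h hs ht; have [st|/ltW ts] := leP s t; first exact: h.
  by rewrite distrC (distrC s); exact: h.
move=> hs ht.
have pos (u : R) : s <= u -> 0 < u by move=> h; rewrite (lt_le_trans lam0)// (le_trans hs).
have [| |c /itvP cst] := @MVT_segment R (fun u : R => u `^ (- beta))
    (fun u : R => - beta * u `^ (- beta - 1)) s t st.
- move=> x /itvP xst; apply: is_derive1_powR; apply: pos; by rewrite ltW// xst.
- apply: derivable_within_continuous => x /itvP xst.
  have := @is_derive1_powR R (- beta) x (pos _ _); case=> //; by rewrite xst.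
have b0 : 0 <= beta by rewrite (le_trans ler01)// ltW.
move=> E; rewrite distrC E (distrC s) !normrM normrN (ger0_norm b0).
rewrite ler_wpM2r// ler_wpM2l//.
rewrite ger0_norm ?powR_ge0// -opprD !powRN lef_pV2 ?posrE ?powR_gt0 ?(pos c) ?cst//.
by rewrite ge0_ler_powR ?nnegrE ?(ltW lam0)//; [lra|rewrite ltW// (pos c)// cst|rewrite (le_trans hs)// cst].
Qed.

Definition cfac : R := lam `^ (- beta).

Definition mfac a r x : R := clip (Num.sqrt (sqd a x) / r) `^ (- beta).

(** The difference between the model map [a + mfac (x - a)] and the identity. It vanishes off the
    ball, so on a similarity of slope [s] the replacement amounts to adding [s] times it. *)
Definition bubble a r x : V := (mfac a r x - 1) *: (x - a).

Lemma bubbleE a r x i : bubble a r x 0 i = (mfac a r x - 1) * (x 0 i - a 0 i).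
Proof. by rewrite !mxE. Qed.

Lemma sqd_ge0 a x : 0 <= sqd a x.
Proof. by apply: sumr_ge0 => i _; exact: sqr_ge0. Qed.

Lemma mfac_bounds a r x : 1 <= mfac a r x <= cfac.
Proof.
have /andP[h1 h2] := clip_bounds (Num.sqrt (sqd a x) / r).
have c0 := clip_gt0 (Num.sqrt (sqd a x) / r).
rewrite /mfac /cfac !powRN; apply/andP; split.
  rewrite -invr1 lef_pV2 ?posrE ?powR_gt0// -[leRHS](_ : 1 `^ beta = 1); last by rewrite powR1.
  exact: powR_homo (ltW c0) h2.
by rewrite lef_pV2 ?posrE ?powR_gt0//; exact: powR_homo (ltW lam0) h1.
Qed.

Lemma mfac_out a r x : 0 < r -> r ^+ 2 <= sqd a x -> mfac a r x = 1.
Proof.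
move=> r0 h; rewrite /mfac /clip (_ : Num.min _ _ = 1).
  by rewrite (max_idPr (ltW lam1)) powR1.
apply/min_idPr; rewrite ler_pdivlMr// mul1r -(ler_pXn2r (ltn0Sn 1)) ?nnegrE ?(ltW r0) ?sqrtr_ge0//.
by rewrite sqr_sqrtr ?sqd_ge0.
Qed.

Lemma mfac_in a r x : 0 < r -> sqd a x <= (lam * r) ^+ 2 -> mfac a r x = cfac.
Proof.
move=> r0 h; rewrite /mfac /clip (_ : Num.max _ _ = lam)//.
apply/max_idPl; rewrite ge_min ler_pdivrMr//; apply/orP; left.
by rewrite -(ler_pXn2r (ltn0Sn 1)) ?nnegrE ?sqrtr_ge0 ?mulr_ge0 ?(ltW r0) ?(ltW lam0)// sqr_sqrtr ?sqd_ge0.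
Qed.

Lemma mfac_mid a r x : 0 < r -> (lam * r) ^+ 2 <= sqd a x <= r ^+ 2 ->
  mfac a r x = (Num.sqrt (sqd a x) / r) `^ (- beta).
Proof.
move=> r0 /andP[h1 h2]; rewrite /mfac /clip; congr (_ `^ _).
have lr0 : 0 <= lam * r by rewrite mulr_ge0 ?(ltW r0) ?(ltW lam0).
have N2 : Num.sqrt (sqd a x) ^+ 2 = sqd a x by rewrite sqr_sqrtr ?sqd_ge0.
have Nr : Num.sqrt (sqd a x) <= r.
  by rewrite -(ler_pXn2r (ltn0Sn 1)) ?nnegrE ?sqrtr_ge0 ?(ltW r0)// N2.
have Nl : lam * r <= Num.sqrt (sqd a x).
  by rewrite -(ler_pXn2r (ltn0Sn 1)) ?nnegrE ?sqrtr_ge0// N2.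
rewrite (min_idPl _); last by rewrite ler_pdivrMr// mul1r.
by apply/max_idPr; rewrite ler_pdivlMr.
Qed.

Lemma bubble_out a r x : 0 < r -> r ^+ 2 <= sqd a x -> bubble a r x = 0.
Proof. by move=> r0 h; rewrite /bubble mfac_out// subrr scale0r. Qed.

Lemma coord_sqd a x i : `|x 0 i - a 0 i| <= Num.sqrt (sqd a x).
Proof.
rewrite -(ler_pXn2r (ltn0Sn 1)) ?nnegrE ?sqrtr_ge0// sqr_sqrtr ?sqd_ge0// real_normK ?num_real//.
by rewrite /sqd (bigD1 i)//= lerDl sumr_ge0// => k _; exact: sqr_ge0.
Qed.

Lemma coord_sqd_le a r x i : 0 <= r -> sqd a x <= r ^+ 2 -> `|x 0 i - a 0 i| <= r.
Proof.
move=> r0 h; rewrite (le_trans (coord_sqd _ _ _))//.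
by rewrite -(ler_pXn2r (ltn0Sn 1)) ?nnegrE ?sqrtr_ge0// sqr_sqrtr ?sqd_ge0.
Qed.

Lemma bubble_bound a r x i : 0 < r -> `|bubble a r x 0 i| <= cfac * r.
Proof.
move=> r0; have [h|/ltW h] := leP (r ^+ 2) (sqd a x).
  rewrite bubble_out// mxE normr0 mulr_ge0 ?(ltW r0)//; exact: powR_ge0.
have /andP[m1 mc] := mfac_bounds a r x.
rewrite !mxE normrM ler_pM//; last exact: coord_sqd_le (ltW r0) h.
by rewrite ger0_norm; lra.
Qed.

Lemma sqd_shift a x (t : R) j :
  sqd a (x + t *: ej R j) = sqd a x + t *+ 2 * (x 0 j - a 0 j) + t ^+ 2.
Proof.
rewrite /sqd (bigD1 j)//= [in RHS](bigD1 j)//= !mxE !eqxx/= mulr1.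
rewrite (eq_bigr (fun i => (x 0 i - a 0 i) ^+ 2)); first by ring.
by move=> i ij; rewrite !mxE eqxx/= (negbTE ij) mulr0 addr0.
Qed.

Lemma dist_shift a x (t : R) j :
  Num.sqrt (sqd a (x + t *: ej R j)) <= Num.sqrt (sqd a x) + `|t|.
Proof.
rewrite -(ler_pXn2r (ltn0Sn 1)) ?nnegrE ?addr_ge0 ?sqrtr_ge0//.
rewrite sqr_sqrtr ?sqd_ge0// sqd_shift sqrrD sqr_sqrtr ?sqd_ge0// real_normK ?num_real//.
rewrite lerD2r lerD2l mulrnAl lerMn2r/=.
rewrite (le_trans (ler_norm _))// normrM mulrC ler_wpM2r//; exact: coord_sqd.
Qed.

Lemma dist_lip a x (t : R) j :
  `|Num.sqrt (sqd a (x + t *: ej R j)) - Num.sqrt (sqd a x)| <= `|t|.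
Proof.
have h1 := dist_shift a x t j.
have := dist_shift a (x + t *: ej R j) (- t) j.
rewrite scaleNr addrK normrN => h2.
by rewrite ler_norml; apply/andP; split; lra.
Qed.

Lemma bubble_lip a r j : 0 < r -> exists L, forall x (t : R) i,
  `|bubble a r (x + t *: ej R j) 0 i - bubble a r x 0 i| <= L * `|t|.
Proof.
move=> r0; pose L1 := beta * lam `^ (- beta - 1) / r.
have L10 : 0 <= L1.
  by apply: mulr_ge0; [apply: mulr_ge0; [exact: beta_ge0|exact: powR_ge0]|rewrite invr_ge0 ltW].
have mL x (t : R) : `|mfac a r (x + t *: ej R j) - mfac a r x| <= L1 * `|t|.
  have [/andP[b1 _] /andP[b2 _]] := (clip_bounds (Num.sqrt (sqd a (x + t *: ej R j)) / r),
    clip_bounds (Num.sqrt (sqd a x) / r)).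
  rewrite (le_trans (powRN_lip b1 b2))// /L1 -!mulrA ler_wpM2l//.
  rewrite ler_wpM2l ?powR_ge0// (le_trans (clip_lip _ _))// -mulrBl normrM mulrC.
  by rewrite (ger0_norm (_ : 0 <= r^-1)) ?invr_ge0 ?(ltW r0)// ler_wpM2l ?invr_ge0 ?(ltW r0)// dist_lip.
exists (cfac + L1 * r) => x t i; set y := x + _.
have yx : (y 0 i - a 0 i) - (x 0 i - a 0 i) = t * (i == j)%:R.
  by rewrite /y !mxE eqxx/=; ring.
have ty : `|t * (i == j)%:R| <= `|t|.
  by rewrite normrM ler_piMr//; case: (i == j); rewrite ?normr1 ?normr0.
have c0 : 0 <= cfac by exact: powR_ge0.
have /andP[m1 m2] := mfac_bounds a r y.
have L1r : 0 <= L1 * r * `|t| by apply: mulr_ge0 => //; apply: mulr_ge0 => //; exact: ltW.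
have ct : 0 <= cfac * `|t| by rewrite mulr_ge0.
(* The increment of [mfac] must multiply a vector with coordinates at most [r], so a product rule
   based at [x] works for [x] in the ball. If only the shifted point is in the ball, the constant 1
   is read as the factor at [x] and the vector is taken at the shifted point. *)
rewrite !bubbleE [leRHS]mulrDl; have [hx|/ltW hx] := leP (sqd a x) (r ^+ 2).
  have -> : (mfac a r y - 1) * (y 0 i - a 0 i) - (mfac a r x - 1) * (x 0 i - a 0 i) =
    (mfac a r y - 1) * ((y 0 i - a 0 i) - (x 0 i - a 0 i)) + (mfac a r y - mfac a r x) * (x 0 i - a 0 i).
    ring.
  rewrite (le_trans (ler_normD _ _))// lerD//.
    by rewrite yx normrM ler_pM// ger0_norm; lra.
  by rewrite normrM mulrAC ler_pM//; [exact: mL|exact: coord_sqd_le (ltW r0) hx].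
rewrite (mfac_out r0 hx) subrr mul0r subr0.
have [hy|/ltW hy] := leP (sqd a y) (r ^+ 2); last first.
  by rewrite (mfac_out r0 hy) subrr mul0r normr0 addr_ge0.
rewrite -(mfac_out r0 hx) (le_trans _ (_ : L1 * r * `|t| <= _))//; last by rewrite lerDr.
by rewrite normrM mulrAC ler_pM//; [exact: mL|exact: coord_sqd_le (ltW r0) hy].
Qed.

Lemma continuous_clip : continuous clip.
Proof.
move=> t; apply/cvgrPdist_le => e e0.
have h : \forall y \near t, `|t - y| <= e.
  exact: (@cvgr_dist_le _ _ _ _ _ id t (@cvg_id _ (nbhs t))).
by apply: filterS h => y; apply: le_trans; exact: clip_lip.
Qed.

Lemma continuous_mfac a r : continuous (mfac a r).
Proof.
move=> x; apply: (@continuous_comp _ _ _ (fun x => clip (Num.sqrt (sqd a x) / r))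
  (fun u : R => u `^ (- beta))); last first.
  apply: differentiable_continuous; apply/derivable1_diffP.
  by have [] := @is_derive1_powR R (- beta) _ (clip_gt0 (Num.sqrt (sqd a x) / r)).
apply: (@continuous_comp _ _ _ (fun x => Num.sqrt (sqd a x) / r) clip); last exact: continuous_clip.
apply: mul_continuous_fun; last exact: cst_continuous.
move=> y; apply: (@continuous_comp _ _ _ (sqd a) Num.sqrt); first exact: continuous_sqd.
exact: sqrt_continuous.
Qed.

Lemma continuous_bubble a r i : continuous (fun x => bubble a r x 0 i).
Proof.
rewrite (_ : (fun x => _) = fun x => (mfac a r x - 1) * (x 0 i - a 0 i)).
  apply: mul_continuous_fun; apply: sub_continuous_fun.
  - exact: continuous_mfac.
  - exact: cst_continuous.
  - exact: coord_continuous.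
  - exact: cst_continuous.
by apply/funext => x; rewrite !mxE.
Qed.

Lemma near_sqd_lt a x c : sqd a x < c -> \forall y \near x, sqd a y < c.
Proof. by move=> h; apply: (cvgr_lt _ (@continuous_sqd R n a x)). Qed.

Lemma near_sqd_gt a x c : c < sqd a x -> \forall y \near x, c < sqd a y.
Proof. by move=> h; apply: (cvgr_gt _ (@continuous_sqd R n a x)). Qed.

Lemma bubble_derive_out a r x i j : 0 < r -> r ^+ 2 < sqd a x ->
  is_derive x (ej R j) (fun y => bubble a r y 0 i) 0.
Proof.
move=> r0 h; have d0 := is_derive_cst (0 : R) x (ej R j).
apply: (near_eq_is_derive _ d0).
by apply: filterS (near_sqd_gt h) => y hy; rewrite bubble_out ?mxE// ltW.
Qed.

Lemma is_derive_coord a x i j (c : R) :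
  is_derive x (ej R j) (fun y : V => c * (y 0 i - a 0 i)) (c * (i == j)%:R).
Proof.
apply: line_is_derive.
pose l : R -> R := (c * (i == j)%:R) *: (id : R -> R) + cst (c * (x 0 i - a 0 i)).
have dl : is_derive (0 : R) 1 l (c * (i == j)%:R).
  apply: (is_derive_eq (is_deriveD (is_deriveZ _ (is_derive_id (0 : R) (1 : R)))
    (is_derive_cst (c * (x 0 i - a 0 i)) (0 : R) (1 : R)))).
  by rewrite addr0 [_ *: _]mulr1.
rewrite (_ : (fun w => _) = l)//; apply/funext => w.
transitivity (c * (i == j)%:R * w + c * (x 0 i - a 0 i)); last by [].
by rewrite !mxE eqxx/=; ring.
Qed.

Lemma bubble_derive_in a r x i j : 0 < r -> sqd a x < (lam * r) ^+ 2 ->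
  is_derive x (ej R j) (fun y => bubble a r y 0 i) ((cfac - 1) * (i == j)%:R).
Proof.
move=> r0 h; apply: (near_eq_is_derive _ (is_derive_coord a x i j (cfac - 1))).
by apply: filterS (near_sqd_lt h) => y hy; rewrite !mxE mfac_in// ltW.
Qed.

(** On the annulus this is the Jacobian matrix of [a + (|x - a|/r)^(-beta) (x - a)]. Its radial
    eigenvalue is [mfac (1 - beta) < 0] and all others equal [mfac]: the map reverses
    orientation. *)
Definition Dpsi a r x : 'M[R]_n :=
  mfac a r x *: (1%:M - beta *: (((Num.sqrt (sqd a x))^-1 *: (x - a))^T *m
                                 ((Num.sqrt (sqd a x))^-1 *: (x - a)))).

Lemma DpsiE a r x i j : Dpsi a r x i j =
  mfac a r x * ((i == j)%:R - beta * ((x 0 i - a 0 i) * (x 0 j - a 0 j) / sqd a x)).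
Proof.
rewrite !mxE big_ord1 !mxE; congr (_ * (_ - _ * _)).
rewrite -[in RHS](sqr_sqrtr (sqd_ge0 a x)) expr2 invfM; ring.
Qed.

(** Along [x + w e_j] the squared distance to [a] is the quadratic polynomial [q], so the
    computation is a one-variable chain rule through the square root and the power. *)
Lemma bubble_derive_mid a r x i j : 0 < r -> (lam * r) ^+ 2 < sqd a x < r ^+ 2 ->
  is_derive x (ej R j) (fun y => bubble a r y 0 i) (Dpsi a r x i j - (i == j)%:R).
Proof.
move=> r0 /andP[h1 h2].
pose Q := sqd a x; pose N := Num.sqrt Q; pose di := x 0 i - a 0 i; pose dj := x 0 j - a 0 j.
have Q0 : 0 < Q by rewrite (le_lt_trans _ h1)// sqr_ge0.
have N0 : 0 < N by rewrite sqrtr_gt0.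
have N2 : N ^+ 2 = Q by rewrite sqr_sqrtr// ltW.
pose q : R -> R := cst Q + (dj *+ 2) *: (id : R -> R) + (id : R -> R) * (id : R -> R).
have qE w : q w = sqd a (x + w *: ej R j).
  transitivity (Q + dj *+ 2 * w + w * w); first by [].
  by rewrite sqd_shift -/Q -/dj; ring.
have q0 : q 0 = Q by rewrite qE scale0r addr0.
have dq : is_derive (0 : R) 1 q (dj *+ 2).
  have d1 := is_derive_id (0 : R) (1 : R).
  apply: (is_derive_eq (is_deriveD (is_deriveD (is_derive_cst Q (0 : R) (1 : R))
    (is_deriveZ (dj *+ 2) d1)) (is_deriveM d1 d1))).
  by rewrite add0r !scale0r !addr0 [_ *: _]mulr1.
have ds : is_derive (0 : R) 1 (Num.sqrt \o q) ((2 * N)^-1 * (dj *+ 2)).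
  have dsq : is_derive (q 0) 1 (@Num.sqrt R) (2 * N)^-1 by rewrite q0; exact: is_derive1_sqrt.
  exact: (is_derive1_comp dsq dq).
have dsr := is_deriveZ r^-1 ds.
have sr0 : (r^-1 *: (Num.sqrt \o q)) 0 = r^-1 * N.
  by transitivity (r^-1 * Num.sqrt (q 0)) => //; rewrite q0.
have dp : is_derive ((r^-1 *: (Num.sqrt \o q)) 0) 1 (fun u : R => u `^ (- beta))
    (- beta * (r^-1 * N) `^ (- beta - 1)).
  by rewrite sr0; apply: is_derive1_powR; rewrite mulr_gt0// invr_gt0.
have dm := is_derive1_comp dp dsr.
have d1 := is_derive_cst (1 : R) (0 : R) (1 : R).
have dl : is_derive (0 : R) 1 (cst di + (i == j)%:R *: (id : R -> R)) ((i == j)%:R : R).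
  apply: (is_derive_eq (is_deriveD (is_derive_cst di (0 : R) (1 : R))
    (is_deriveZ ((i == j)%:R) (is_derive_id (0 : R) (1 : R))))).
  by rewrite add0r [_ *: _]mulr1.
have dh := is_deriveM (is_deriveB dm d1) dl.
pose h y := ((r^-1 * Num.sqrt (sqd a y)) `^ (- beta) - 1) * (y 0 i - a 0 i).
have dh' : is_derive x (ej R j) h (Dpsi a r x i j - (i == j)%:R).
  apply: line_is_derive.
  rewrite (_ : (fun w => _) = ((fun u : R => u `^ (- beta)) \o (r^-1 *: (Num.sqrt \o q)) - cst 1) *
     (cst di + (i == j)%:R *: (id : R -> R))); last first.
    apply/funext => w.
    transitivity (((r^-1 * Num.sqrt (q w)) `^ (- beta) - 1) * (di + (i == j)%:R * w)); last by [].
    rewrite /h qE; congr (_ * _).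
    by rewrite !mxE eqxx/= /di; ring.
  apply: (is_derive_eq dh).
  rewrite DpsiE mfac_mid ?(ltW h1) ?(ltW h2)// -/Q -/N -/di -/dj.
  have -> : (((fun u : R => u `^ (- beta)) \o (r^-1 *: (Num.sqrt \o q))) - cst 1) 0 =
    (r^-1 * N) `^ (- beta) - 1.
    by transitivity ((r^-1 * Num.sqrt (q 0)) `^ (- beta) - 1) => //; rewrite q0.
  have -> : (cst di + (i == j)%:R *: (id : R -> R)) 0 = di.
    by transitivity (di + (i == j)%:R * 0) => //; rewrite mulr0 addr0.
  rewrite subr0 powRD; last by apply/implyP => _; rewrite gt_eqF// mulr_gt0// invr_gt0.
  rewrite powR_inv1; last by rewrite mulr_ge0 ?invr_ge0 ?ltW.
  rewrite [N / r]mulrC -N2 /GRing.scale/= invfM invrK.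
  have rn : r != 0 by rewrite gt_eqF.
  have Nn : N != 0 by rewrite gt_eqF.
  by field; rewrite rn Nn.
apply: (near_eq_is_derive _ dh').
apply: filterS2 (near_sqd_lt h2) (near_sqd_gt h1) => y hy1 hy2.
by rewrite !mxE mfac_mid ?(ltW hy1) ?(ltW hy2)// [_ / r]mulrC.
Qed.

Lemma Dpsi_bound a r x i j : 0 < sqd a x -> `|Dpsi a r x i j| <= cfac * (1 + beta).
Proof.
move=> Q0; have /andP[m1 mc] := mfac_bounds a r x.
rewrite DpsiE normrM ler_pM//; first by rewrite ger0_norm//; lra.
rewrite (le_trans (ler_normB _ _))// lerD//; first by case: (i == j); rewrite ?normr1 ?normr0.
rewrite normrM (ger0_norm beta_ge0) ler_piMr// normrM (gtr0_norm (_ : 0 < (sqd a x)^-1)) ?invr_gt0//.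
rewrite ler_pdivrMr// mul1r normrM -[leRHS]sqr_sqrtr ?sqd_ge0// expr2.
by rewrite ler_pM// coord_sqd.
Qed.

Lemma Dpsi_good (K al s : R) a r x : 0 <= s -> 0 < al -> al <= 1 -> K * al = 1 -> beta = 1 + al ->
  0 < sqd a x -> \det (s *: Dpsi a r x) <= 0 /\ distortion_le K (s *: Dpsi a r x).
Proof.
move=> s0 al0 al1 Kal bal Q0.
have /andP[m1 mc] := mfac_bounds a r x.
pose u := (Num.sqrt (sqd a x))^-1 *: (x - a).
have u1 : \sum_i u 0 i ^+ 2 = 1.
  rewrite (eq_bigr (fun i => (sqd a x)^-1 * (x 0 i - a 0 i) ^+ 2)).
    by rewrite -mulr_sumr -/(sqd a x) mulVf// gt_eqF.
  by move=> i _; rewrite !mxE exprMn exprVn sqr_sqrtr// ltW.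
rewrite /Dpsi scalerA -/u; set k := s * _.
have k0 : 0 <= k by rewrite mulr_ge0//; lra.
split; last by rewrite bal; exact: distortion_rank1.
rewrite detZ det_1_sub_rank1 mulr_ge0_le0 ?exprn_ge0//.
have -> : (u *m u^T) 0 0 = 1.
  by rewrite mxE -[RHS]u1; apply: eq_bigr => i _; rewrite [u^T _ _]mxE expr2.
lra.
Qed.

End profile.

Lemma integral_step d (T : measurableType d) (R : realType)
    (mu : {measure set T -> \bar R}) (I : finType) (c : I -> R) (S : I -> set T) :
  (forall z, 0 <= c z) -> (forall z, measurable (S z)) ->
  (\int[mu]_x (\sum_z c z * \1_(S z) x)%:E = \sum_z (c z)%:E * mu (S z))%E.
Proof.
move=> c0 mS.
transitivity (\int[mu]_x \sum_z (c z * \1_(S z) x)%:E)%E.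
  by apply: eq_integral => x _; rewrite sumEFin.
have mcS z : measurable_fun setT (fun x => (c z * \1_(S z) x)%:E).
  by apply/measurable_EFinP; apply: measurable_funM => //; exact: measurable_indic.
have cS0 z x : setT x -> (0 <= (c z * \1_(S z) x)%:E)%E by rewrite lee_fin mulr_ge0.
rewrite (ge0_integral_sum _ measurableT mcS cS0).
apply: eq_bigr => z _.
under eq_integral do rewrite EFinM.
have mi : measurable_fun setT (fun x => (\1_(S z) x : R)%:E).
  by apply/measurable_EFinP; exact: measurable_indic.
rewrite ge0_integralZl ?lee_fin//.
by rewrite integral_indic// setIT.
Qed.

(** A stage of the construction: the map, its gradient, the unfinished set, and the slope of the
    similarity there. The slope is a total function; off [sU] its value has no geometric meaning. *)
Record state (R : realType) (n : nat) := State {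
  sf : 'rV[R]_n -> 'rV[R]_n;
  sG : 'rV[R]_n -> 'M[R]_n;
  sU : set 'rV[R]_n;
  ss : 'rV[R]_n -> R }.

(** * Grids of admissible cubes and the energy of the unfinished set *)

Section grid.
Context {R : realType} {n : nat}.
Local Notation V := 'rV[R]_n.
Local Notation mu := (@leb R n).
Variables (Omega C : set V) (kb : nat).
Hypothesis Okb : Omega `<=` @cubek R n kb.

(* Near every point of the unfinished set the map is a similarity and the
   membership in C does not change. *)
Definition locally_similar (st : state R n) : Prop :=
  forall x, sU st x -> exists2 e : R, 0 < e & forall y, ball x e y ->
    [/\ sU st y, ss st y = ss st x, sf st y = sf st x + ss st x *: (y - x) & (C y <-> C x)].

Definition width (k : nat) : R := k.+1%:R^-1.
(** Along an axis [[-kb, kb]] consists of [2 kb (k+1)] intervals of length [1/(k+1)]; the extra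
    index covers the face [x_i = kb], which half-open cubes would miss. *)
Definition gridix (k : nat) := {ffun 'I_n -> 'I_((kb + kb) * k.+1).+1}.
Definition corner k (z : gridix k) : V := \row_i (width k * (z i)%:R - kb%:R).
Definition gridctr k (z : gridix k) : V := \row_i (corner z 0 i + width k / 2).

Lemma width_gt0 k : 0 < width k. Proof. by rewrite invr_gt0. Qed.

Lemma cube_corner_inj k (z w : gridix k) x :
  cube (corner z) (width k) x -> cube (corner w) (width k) x -> z = w.
Proof.
move=> hz hw; apply/ffunP => i; apply/val_inj => /=.
have := hz i; have := hw i; rewrite !mxE => /andP[a1 a2] /andP[b1 b2].
have w0 := width_gt0 k.
have cmp (p q : nat) (y : R) : width k * p%:R <= y -> y < width k * q%:R + width k -> (p <= q)%N.
  move=> h1 h2; have : width k * p%:R < width k * q.+1%:R.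
    by rewrite (le_lt_trans h1)// (lt_le_trans h2)// -natr1 mulrDr mulr1.
  by rewrite ltr_pM2l// ltr_nat ltnS.
apply/eqP; rewrite eqn_leq; apply/andP; split; apply: (cmp _ _ (x 0 i + kb%:R)); lra.
Qed.

Lemma cube_corner_ex k x : cubek kb x -> exists z : gridix k, cube (corner z) (width k) x.
Proof.
move=> hx; have w0 := width_gt0 k.
have xi i : 0 <= (x 0 i + kb%:R) * k.+1%:R.
  by rewrite mulr_ge0//; have := hx i; rewrite ler_norml => /andP[? _]; lra.
have lt i : (Num.truncn ((x 0 i + kb%:R) * k.+1%:R)%R < ((kb + kb) * k.+1).+1)%N.
  have h : (Num.truncn ((x 0 i + kb%:R) * k.+1%:R))%:R <= (x 0 i + kb%:R) * k.+1%:R by rewrite truncn_le.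
  rewrite ltnS -(ler_nat R) (le_trans h)//.
  rewrite natrM ler_wpM2r// natrD lerD2r.
  by have := hx i; rewrite ler_norml => /andP[].
exists [ffun i => Ordinal (lt i)] => i; rewrite !mxE ffunE/=.
have /andP[t1 t2] := truncn_itv (xi i).
have k0 : 0 < k.+1%:R :> R by [].
move: t1 t2; rewrite -[(Num.truncn _).+1%:R]natr1 -ltr_pdivlMr// -ler_pdivrMr//.
set t := (Num.truncn _)%:R => t1 t2.
have E : (t + 1) / k.+1%:R = width k * t + width k by rewrite /width; ring.
by move: t1 t2; rewrite E mulrC -/(width k) => t1 t2; apply/andP; split; lra.
Qed.

Section fill.
Variable st : state R n.
Hypothesis U_sub : sU st `<=` Omega.
Hypothesis loc : locally_similar st.
Hypothesis s_ge1 : forall x, 1 <= ss st x.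
Hypothesis s_le : exists B, forall x, ss st x <= B.
Hypothesis s_meas : measurable_fun setT (ss st : Rn R n -> R).

(** All data on the cube are tied to its centre, so an admissible cube contributes a single number
    to each energy. The closed cube is used so that a bump on it is a test function in [Omega]; the
    last clause keeps the cube from straddling the boundary of [C]. *)
Definition adm k (z : gridix k) : Prop := forall y, ccube (corner z) (width k) y ->
  [/\ sU st y, ss st y = ss st (gridctr z),
      sf st y = sf st (gridctr z) + ss st (gridctr z) *: (y - gridctr z) & (C y <-> C (gridctr z))].

(** The value 0 on non-admissible cubes lets every sum run over the whole finite grid. *)
Definition slope k (z : gridix k) : R := if `[< adm z >] then ss st (gridctr z) else 0.

Lemma slope_adm k (z : gridix k) : adm z -> slope z = ss st (gridctr z).
Proof. by move=> h; rewrite /slope asboolT. Qed.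

Lemma slope_nadm k (z : gridix k) : ~ adm z -> slope z = 0.
Proof. by move=> h; rewrite /slope asboolF. Qed.

Lemma slope_ge0 k (z : gridix k) : 0 <= slope z.
Proof. by rewrite /slope; case: asboolP => // _; rewrite (le_trans ler01). Qed.

Lemma gridctr_ccube k (z : gridix k) : ccube (corner z) (width k) (gridctr z).
Proof.
move=> i; rewrite [gridctr z 0 i]mxE; have w0 := width_gt0 k.
by apply/andP; split; lra.
Qed.

Lemma open_sU : open (sU st).
Proof.
rewrite openE => x Ux; have [e e0 he] := loc Ux.
apply/nbhs_ballP; exists e => //= y /he[]//.
Qed.

Lemma adm_small x : sU st x -> exists k0, forall k, (k0 <= k)%N ->
  exists2 z : gridix k, adm z & cube (corner z) (width k) x.
Proof.
move=> Ux; have [e e0 he] := loc Ux.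
exists (Num.truncn e^-1) => k hk.
have we : width k < e.
  rewrite /width -[ltRHS]invrK ltf_pV2 ?posrE ?invr_gt0//.
  by rewrite (lt_le_trans (truncnS_gt _))// ler_nat ltnS.
have w0 := width_gt0 k.
have [z xz] := cube_corner_ex k (Okb (U_sub Ux)); exists z => //.
have inb y : ccube (corner z) (width k) y -> ball x e y.
  move=> hy; apply/ball_rVP => // i; have /andP[y1 y2] := hy i; have /andP[x1 x2] := xz i.
  by rewrite ltr_norml; apply/andP; split; lra.
move=> y /inb/he[Uy sy fy Cy].
have [_ sc fc Cc] := he _ (inb _ (gridctr_ccube z)).
split => //; [by rewrite sy sc|rewrite fy fc sc|by split=> [/Cy/Cc|/Cc/Cy]].
by rewrite -addrA -scalerDr; congr (_ + _ *: _); rewrite [RHS]addrC addrA subrK.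
Qed.

(** Energy density of the unfinished set, where the gradient is [ss] times the identity. Its
    integral has to decay for [q = p], while that of the localised [cweight] has to grow for
    [q = n]. *)
Definition weight (q : R) (x : V) : R := \1_(sU st) x * ss st x `^ q.
Definition cweight (q : R) (x : V) : R := \1_(sU st `&` C) x * ss st x `^ q.

Hypothesis mC : measurable (C : set (Rn R n)).

Lemma weight_ge0 q x : 0 <= weight q x.
Proof. by rewrite mulr_ge0// powR_ge0. Qed.

Lemma cweight_ge0 q x : 0 <= cweight q x.
Proof. by rewrite mulr_ge0// powR_ge0. Qed.

Lemma measurable_weight q : measurable_fun setT (weight q : Rn R n -> R).
Proof.
apply: measurable_funM.
  by apply: measurable_indic; exact: open_measurable_Rn open_sU.
exact: (measurableT_comp (measurable_powR _)).
Qed.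

Lemma measurable_cweight q : measurable_fun setT (cweight q : Rn R n -> R).
Proof.
apply: measurable_funM; last exact: (measurableT_comp (measurable_powR _)).
by apply: measurable_indic; apply: measurableI => //; exact: open_measurable_Rn open_sU.
Qed.

Lemma integrable_weight_like (w : V -> R) q : 0 <= q -> measurable_fun setT (w : Rn R n -> R) ->
  (forall x, 0 <= w x <= weight q x) -> mu.-integrable setT (EFin \o (w : Rn R n -> R)).
Proof.
move=> q0 mw hw; have [B hB] := s_le.
apply: (@integrable_bounded_cubek _ _ _ kb (B `^ q)) => // x.
  have /andP[w0 w1] := hw x; rewrite ger0_norm// (le_trans w1)// /weight.
  have sB : ss st x `^ q <= B `^ q.
    have s0 : 0 <= ss st x by rewrite (le_trans ler01).
    by rewrite ge0_ler_powR// ?nnegrE// (le_trans s0).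
  by rewrite indicE; case: (_ \in _); rewrite ?mul1r ?mul0r// powR_ge0.
move=> nx; have /andP[w0 w1] := hw x; apply/eqP; rewrite eq_le w0 andbT (le_trans w1)//.
by rewrite /weight indicE memNset ?mul0r// => /U_sub/Okb.
Qed.

Lemma cweight_le_weight q x : 0 <= cweight q x <= weight q x.
Proof.
rewrite cweight_ge0/= /cweight /weight ler_wpM2r ?powR_ge0//.
rewrite !indicE; case: (pselect ((sU st `&` C) x)) => h.
  by rewrite !mem_set//; case: h.
by rewrite (memNset h).
Qed.

Definition filled k : set V := [set x | exists2 z : gridix k, adm z & cube (corner z) (width k) x].

Lemma step_filled k (g : V -> R) (c : gridix k -> R) :
  (forall z x, adm z -> cube (corner z) (width k) x -> g x = c z) ->
  (forall z, ~ adm z -> c z = 0) ->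
  forall x, \1_(filled k) x * g x = \sum_z c z * \1_(cube (corner z) (width k)) x.
Proof.
move=> gc c0 x; rewrite indicE; case: (pselect (filled k x)) => [[z az xz]|nx].
  rewrite mem_set; last by exists z.
  rewrite mul1r (bigD1 z)//= big1 ?addr0; last first.
    move=> w wz; rewrite indicE memNset ?mulr0// => xw.
    by move/eqP: wz; apply; exact: cube_corner_inj xw xz.
  by rewrite indicE mem_set// mulr1; exact: gc.
rewrite memNset// mul0r big1// => w _; rewrite indicE.
case: (pselect (cube (corner w) (width k) x)) => xw; last by rewrite memNset// mulr0.
by rewrite c0 ?mul0r// => aw; apply: nx; exists w.
Qed.

Lemma measurable_filled k : measurable (filled k : set (Rn R n)).
Proof.
rewrite (_ : filled k = \bigcup_(z in [set z : gridix k | adm z]) cube (corner z) (width k)).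
  apply: fin_bigcup_measurable => [|z _]; last exact: measurable_cube.
  exact: finite_finset.
by apply/seteqP; split => [x [z az xz]|x [z az xz]]; exists z.
Qed.

(** Each point of [sU] lies in an admissible cube of every fine enough grid, so dominated
    convergence recovers the integral in the limit. The bound holds for all large [k], so that one
    grid can serve several requirements at once. *)
Lemma filled_half (w : V -> R) q : 0 <= q -> measurable_fun setT (w : Rn R n -> R) ->
  (forall x, 0 <= w x <= weight q x) ->
  exists k0, forall k, (k0 <= k)%N ->
    (\int[mu]_x (w x)%:E <= 2%:E * \int[mu]_x (\1_(filled k) x * w x)%:E)%E.
Proof.
move=> q0 mw hw; have iw := integrable_weight_like q0 mw hw.
have w0 x : 0 <= w x by case/andP: (hw x).
pose F k (x : Rn R n) := (\1_(filled k) x * w x)%:E.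
have mF k : measurable_fun setT (F k).
  apply/measurable_EFinP; apply: measurable_funM => //.
  by apply: measurable_indic; exact: measurable_filled.
have mw' : measurable_fun setT (fun x : Rn R n => (w x)%:E) by exact/measurable_EFinP.
have cF : {ae mu, forall x, setT x -> F ^~ x @ \oo --> (w x)%:E}.
  apply: aeW => x _; case: (pselect (sU st x)) => Ux.
    have [k0 hk0] := adm_small Ux; apply: cvg_near_cst; exists k0 => // k /= hk.
    have [z az xz] := hk0 _ hk.
    by rewrite /F indicE mem_set ?mul1r//; exists z.
  have wx : w x = 0.
    apply/eqP; rewrite eq_le w0 andbT; case/andP: (hw x) => _ /le_trans; apply.
    by rewrite /weight indicE memNset// mul0r.
  by rewrite /F wx; under eq_fun do rewrite mulr0; exact: cvg_cst.
have dF : {ae mu, forall x k, setT x -> `|F k x| <= (w x)%:E}%E.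
  apply: aeW => x k _; rewrite lee_fin normrM (ger0_norm (w0 x)) ler_piMl//.
  by rewrite indicE; case: (_ \in _); rewrite ?normr1 ?normr0.
have [_ _ cvgF] := dominated_convergence measurableT mF mw' cF iw dF.
have fin : (\int[mu]_x (w x)%:E \is a fin_num)%E by exact: integrable_fin_num.
have ge0 : (0 <= \int[mu]_x (w x)%:E)%E by apply: integral_ge0 => x _; rewrite lee_fin.
move: cvgF; rewrite -(fineK fin) => /fine_cvgP[finF cvgF].
set J := fine _ in cvgF *.
have J0 : 0 <= J by exact: fine_ge0.
(* The limit argument rests on [J / 2 < J], which fails for a zero integral. *)
have [J0'|Jp] := eqVneq J 0.
  exists 0%N => k _; rewrite J0' mule_ge0//.
  by apply: integral_ge0 => x _; rewrite lee_fin mulr_ge0.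
have Jgt : 0 < J by rewrite lt_neqAle eq_sym Jp.
have J2 : J / 2 < J by lra.
have [k1 _ h1] := finF; have [k2 _ h2] := cvgr_gt _ cvgF _ J2.
exists (maxn k1 k2) => k; rewrite geq_max => /andP[hk1 hk2].
pose I := (\int[mu]_x F k x)%E.
have Ifin : I \is a fin_num := h1 _ hk1.
have Igt : J / 2 < fine I := h2 _ hk2.
change (J%:E <= 2%:E * I)%E; rewrite -(fineK Ifin) -EFinM lee_fin; lra.
Qed.

End fill.
End grid.

Lemma is_derive_bigsum (R : realType) (V : normedModType R) (I : Type) (r : seq I)
    (f : V -> R) (df : R) (F : I -> V -> R) (dF : I -> R) (x v : V) :
  is_derive x v f df -> (forall z, is_derive x v (F z) (dF z)) ->
  is_derive x v (fun y => f y + \sum_(z <- r) F z y) (df + \sum_(z <- r) dF z).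
Proof.
move=> hf hF; elim: r f df hf => [|z r IH] f df hf.
  by rewrite big_nil addr0; under eq_fun do rewrite big_nil addr0.
rewrite big_cons addrA; under eq_fun do rewrite big_cons addrA.
by apply: (IH (fun y => f y + F z y)); exact: (is_deriveD hf (hF z)).
Qed.

(** * Gradient of the inserted map, and volumes of balls *)

Section Dbubble.
Context {R : realType} {n : nat}.
Local Notation V := 'rV[R]_n.
Variables (lam beta : R).
Hypotheses (lam0 : 0 < lam) (lam1 : lam < 1) (beta1 : 1 < beta).
Implicit Types (a x : V) (r : R).

(** On the two bounding spheres, a null set, the value is a convention: both count as annulus, in
    accordance with the closed [gball] and the open [gcore] below. Hence every point that a step
    finishes carries the annulus matrix. *)
Definition Dbubble a r x : 'M[R]_n :=
  if sqd a x < (lam * r) ^+ 2 then (cfac lam beta - 1)%:M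
  else if sqd a x <= r ^+ 2 then Dpsi lam beta a r x - 1%:M else 0.

Lemma Dbubble_out a r x : 0 < r -> r ^+ 2 < sqd a x -> Dbubble a r x = 0.
Proof.
move=> r0 h; rewrite /Dbubble leNgt h /= ltNge (le_trans _ (ltW h))//.
by rewrite ler_pXn2r ?nnegrE ?mulr_ge0 ?(ltW r0) ?(ltW lam0)// ler_piMl ?(ltW r0) ?(ltW lam1).
Qed.

Lemma bubble_derive a r x i j : 0 < r ->
  sqd a x <> (lam * r) ^+ 2 -> sqd a x <> r ^+ 2 ->
  is_derive x (ej R j) (fun y => bubble lam beta a r y 0 i) (Dbubble a r x i j).
Proof.
move=> r0 /eqP h1 /eqP h2; have [hin|hin] := ltP (sqd a x) ((lam * r) ^+ 2).
  rewrite /Dbubble hin [X in is_derive _ _ _ X]mxE -mulr_natr.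
  exact: bubble_derive_in.
have [hm|hm] := leP (sqd a x) (r ^+ 2).
  rewrite /Dbubble ltNge hin hm/= [X in is_derive _ _ _ X]mxE.
  have -> : (- (1%:M : 'M[R]_n)) i j = - (i == j)%:R by rewrite !mxE.
  by apply: bubble_derive_mid => //; rewrite !lt_neqAle hin hm h2 eq_sym h1.
by rewrite Dbubble_out// [X in is_derive _ _ _ X]mxE; exact: bubble_derive_out.
Qed.

Lemma measurable_Dbubble a r i j :
  measurable_fun setT ((fun x => Dbubble a r x i j) : Rn R n -> R).
Proof.
have mct (h : V -> R) : continuous h -> measurable_fun setT (h : Rn R n -> R).
  by move=> ch; exact: continuous_measurable_Rn.
have msqd : measurable_fun setT (sqd a : Rn R n -> R) by apply: mct; exact: continuous_sqd.
have mcoord k : measurable_fun setT ((fun x => x 0 k - a 0 k) : Rn R n -> R).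
  by apply: mct; apply: sub_continuous_fun; [exact: coord_continuous|exact: cst_continuous].
rewrite (_ : (fun x => _) = fun x => if sqd a x < (lam * r) ^+ 2 then (cfac lam beta - 1) *+ (i == j)
  else if sqd a x <= r ^+ 2 then mfac lam beta a r x *
    ((i == j)%:R - beta * ((x 0 i - a 0 i) * (x 0 j - a 0 j) * sqd a x `^ (-1))) - (i == j)%:R
  else 0); last first.
  apply/funext => x; rewrite /Dbubble; case: ifP => _; first by rewrite mxE.
  case: ifP => _; last by rewrite mxE.
  by rewrite [LHS]mxE DpsiE !mxE powR_inv1 ?sqd_ge0.
apply: measurable_fun_ifT.
- exact: measurable_fun_ltr.
- exact: measurable_cst.
- apply: measurable_fun_ifT.
  + exact: measurable_fun_ler.
  + apply: measurable_funB; last exact: measurable_cst.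
    apply: measurable_funM; first by apply: mct; exact: continuous_mfac.
    apply: measurable_funB; first exact: measurable_cst.
    apply: measurable_funM; first exact: measurable_cst.
    apply: measurable_funM; first exact: measurable_funM.
    exact: (measurableT_comp (measurable_powR _)).
  + exact: measurable_cst.
Qed.

(** The cube has its corner, not its centre, at [a]: [n] squares of size at most [(r/n)^2] add up to
    [r^2/n], which is below [r^2] once [n > 1]. *)
Lemma ball_cube_lower a r : (0 < n)%N -> 0 < r ->
  cube a (r / n%:R) `<=` [set x | sqd a x < r ^+ 2] \/ n = 1%N.
Proof.
move=> n0 r0; case: (ltnP 1 n) => [n1|n1]; last first.
  by right; apply/eqP; rewrite eqn_leq n1.
left=> x hx; have nR : 0 < n%:R :> R by rewrite ltr0n.
have le1 : sqd a x <= \sum_(i < n) (r / n%:R) ^+ 2.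
  apply: ler_sum => i _; have /andP[h1 h2] := hx i.
  by rewrite ler_pXn2r ?nnegrE ?subr_ge0 ?divr_ge0 ?(ltW r0)// lerBlDl ltW.
change (sqd a x < r ^+ 2); rewrite (le_lt_trans le1)// sumr_const card_ord -[_ *+ n]mulr_natr exprMn exprVn -mulrA.
rewrite gtr_pMr ?exprn_gt0// expr2 invfM -mulrA mulVf ?gt_eqF// mulr1 invf_lt1// ltr1n//.
Qed.

Lemma ball_cube_upper a r : 0 < r ->
  [set x | sqd a x < r ^+ 2] `<=` cube (\row_i (a 0 i - r)) (r *+ 2).
Proof.
move=> r0 x hx i; rewrite mxE.
have N : Num.sqrt (sqd a x) < r.
  by rewrite -(ltr_pXn2r (ltn0Sn 1)) ?nnegrE ?sqrtr_ge0 ?(ltW r0)// sqr_sqrtr ?sqd_ge0.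
have := le_lt_trans (coord_sqd a x i) N; rewrite ltr_norml => /andP[h1 h2].
by apply/andP; split; lra.
Qed.

Lemma measurable_sqd_lt a (c : R) : measurable ([set x | sqd a x < c] : set (Rn R n)).
Proof.
apply: open_measurable_Rn; rewrite openE => x hx; exact: near_sqd_lt.
Qed.

Lemma measurable_sqd_le a (c : R) : measurable ([set x | sqd a x <= c] : set (Rn R n)).
Proof.
rewrite (_ : [set x | _] = ~` [set x | c < sqd a x]).
  apply: measurableC; apply: open_measurable_Rn; rewrite openE => x hx; exact: near_sqd_gt.
by apply/seteqP; split => x /=; rewrite leNgt => /negP.
Qed.

Lemma leb_ball_lower a r : (1 < n)%N -> 0 < r ->
  (((r / n%:R) ^+ n)%:E <= leb ([set x | (sqd a x < r ^+ 2)%R] : set (Rn R n)))%E.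
Proof.
move=> n1 r0; have [h|nE] := @ball_cube_lower a r (ltnW n1) r0; last by rewrite nE in n1.
rewrite -(leb_cube a); last by rewrite divr_ge0 ?(ltW r0).
apply: le_measure => //; rewrite inE; [exact: measurable_cube|exact: measurable_sqd_lt].
Qed.

Lemma leb_cball_lower a r : (1 < n)%N -> 0 < r ->
  (((r / n%:R) ^+ n)%:E <= leb ([set x | (sqd a x <= r ^+ 2)%R] : set (Rn R n)))%E.
Proof.
move=> n1 r0; apply: (le_trans (leb_ball_lower a n1 r0)).
apply: le_measure; rewrite ?inE; [exact: measurable_sqd_lt|exact: measurable_sqd_le|].
by move=> x /ltW.
Qed.

Lemma leb_ball_upper a r : 0 < r ->
  (leb ([set x | (sqd a x < r ^+ 2)%R] : set (Rn R n)) <= ((r *+ 2) ^+ n)%:E)%E.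
Proof.
move=> r0; rewrite -(leb_cube (\row_i (a 0 i - r))); last by rewrite mulrn_wge0// ltW.
apply: le_measure; rewrite ?inE; [exact: measurable_sqd_lt|exact: measurable_cube|].
exact: ball_cube_upper.
Qed.

End Dbubble.

(** The Lipschitz constant and the bound on slopes may depend on the stage: they serve integration
    by parts, integrability and the choice of the next grid, one stage at a time. [inv_good]
    concerns finished points only, since on [sU] the gradient is a positive multiple of the identity
    and has the opposite orientation. *)
Record stinv (R : realType) (n : nat) (Omega C : set 'rV[R]_n) (K : R) (st : state R n) : Prop := Inv {
  inv_cont : forall i, continuous (fun x => sf st x 0 i);
  inv_lip : exists L, forall i j x (t : R),
    `|sf st (x + t *: ej R j) 0 i - sf st x 0 i| <= L * `|t|;
  inv_mG : forall i j, measurable_fun setT ((fun x => sG st x i j) : Rn R n -> R);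
  inv_der : ae_in setT (fun x => forall i j,
    is_derive x (ej R j) (fun y => sf st y 0 i) (sG st x i j));
  inv_ms : measurable_fun setT (ss st : Rn R n -> R);
  inv_ge1 : forall x, 1 <= ss st x;
  inv_le : exists B, forall x, ss st x <= B;
  inv_sub : sU st `<=` Omega;
  inv_loc : locally_similar C st;
  inv_GU : forall x, sU st x -> sG st x = (ss st x)%:M;
  inv_good : ae_in (Omega `\` sU st)
    (fun x => \det (sG st x) <= 0 /\ distortion_le K (sG st x)) }.

(** * One step of the construction and its effect on the energies *)

Section nextst.
Context {R : realType} {n : nat}.
Local Notation V := 'rV[R]_n.
Local Notation mu := (@leb R n).
Variables (Omega C : set V) (kb : nat) (lam beta K al : R) (st : state R n) (k : nat).
Hypotheses (Okb : Omega `<=` @cubek R n kb) (n1 : (1 < n)%N).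
Hypotheses (lam0 : 0 < lam) (lam1 : lam < 1) (beta1 : 1 < beta).
Hypotheses (al0 : 0 < al) (al1 : al <= 1) (Kal : K * al = 1) (bal : beta = 1 + al).
Hypothesis ist : stinv Omega C K st.
Local Notation ix := (@gridix n kb k).
Local Notation ctr := (@gridctr R n kb k).
Local Notation w := (@width R k).
Local Notation r := (@width R k / 4).
Local Notation sl := (@slope R n C kb st k).
Local Notation c := (cfac lam beta).

Definition gball (z : ix) : set V := [set x | sqd (ctr z) x <= r ^+ 2].
Definition gcore (z : ix) : set V := [set x | sqd (ctr z) x < (lam * r) ^+ 2].

(** Balls of radius [w/4] lie inside disjoint half-open cubes, so at each point at most one term of
    a sum is nonzero. Removing closed balls and adding open cores keeps the unfinished set open. *)
Definition nextst : state R n := State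
  (fun x => sf st x + \sum_z sl z *: bubble lam beta (ctr z) r x)
  (fun x => sG st x + \sum_z sl z *: Dbubble lam beta (ctr z) r x)
  ((sU st `\` \bigcup_(z in [set z | adm C st z]) gball z) `|`
    \bigcup_(z in [set z | adm C st z]) gcore z)
  (fun x => ss st x + \sum_z sl z * (c - 1) * \1_(gcore z) x).

Lemma r_gt0 : 0 < r. Proof. by rewrite divr_gt0// width_gt0. Qed.

Lemma c_ge1 : 1 <= c.
Proof.
by have /andP[h1 h2] := mfac_bounds lam0 lam1 beta1 (0 : V) r 0; exact: le_trans h2.
Qed.

Lemma gcore_gball z : gcore z `<=` gball z.
Proof.
move=> x /ltW h; apply: (le_trans h); have r0 := r_gt0.
have lr0 : 0 <= lam * r := mulr_ge0 (ltW lam0) (ltW r0).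
have lr : lam * r <= r by apply: ler_piMl; exact: ltW.
by rewrite ler_pXn2r ?nnegrE// ltW.
Qed.

Lemma gball_cube z : gball z `<=` cube (corner z) w.
Proof.
move=> x hx i; have w0 := @width_gt0 R k.
have := coord_sqd_le i (ltW r_gt0) hx; rewrite [ctr z 0 i]mxE ler_norml => /andP[h1 h2].
by apply/andP; split; lra.
Qed.

Lemma gball_adm z x : adm C st z -> gball z x ->
  [/\ sU st x, ss st x = ss st (ctr z),
      sf st x = sf st (ctr z) + ss st (ctr z) *: (x - ctr z) & (C x <-> C (ctr z))].
Proof. by move=> az /gball_cube/cube_sub_ccube; exact: az. Qed.

Lemma gball_inj z z' x : gball z x -> gball z' x -> z = z'.
Proof. by move=> /gball_cube h1 /gball_cube h2; exact: cube_corner_inj h1 h2. Qed.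

Lemma sum_gball (T : zmodType) (F : ix -> T) z x : gball z x ->
  (forall y, ~ gball y x -> F y = 0) -> \sum_y F y = F z.
Proof.
move=> zx F0; rewrite (bigD1 z)//= big1 ?addr0// => y yz; apply: F0 => yx.
by move/eqP: yz; apply; exact: gball_inj yx zx.
Qed.

Lemma bubble_ngball z x : ~ gball z x -> bubble lam beta (ctr z) r x = 0.
Proof. by move=> /negP; rewrite -ltNge => h; apply: bubble_out => //; [exact: r_gt0|exact: ltW]. Qed.

Lemma Dbubble_ngball z x : ~ gball z x -> Dbubble lam beta (ctr z) r x = 0.
Proof. by move=> /negP; rewrite -ltNge => h; apply: Dbubble_out => //; exact: r_gt0. Qed.

Lemma gcore_ngball z x : ~ gball z x -> \1_(gcore z) x = 0 :> R.
Proof. by move=> h; rewrite indicE memNset// => /gcore_gball. Qed.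

Lemma next_ss_gball z x : adm C st z -> gball z x ->
  ss nextst x = ss st (ctr z) + ss st (ctr z) * (c - 1) * \1_(gcore z) x.
Proof.
move=> az zx; have [_ sx _ _] := gball_adm az zx.
rewrite /= sx (sum_gball zx) ?slope_adm// => y yx.
by rewrite gcore_ngball// mulr0.
Qed.

Lemma next_sf_gball z x : adm C st z -> gball z x ->
  sf nextst x = sf st x + ss st (ctr z) *: bubble lam beta (ctr z) r x.
Proof.
move=> az zx; rewrite /= (sum_gball zx) ?slope_adm// => y yx.
by rewrite bubble_ngball// scaler0.
Qed.

Lemma next_sG_gball z x : adm C st z -> gball z x ->
  sG nextst x = sG st x + ss st (ctr z) *: Dbubble lam beta (ctr z) r x.
Proof.
move=> az zx; rewrite /= (sum_gball zx) ?slope_adm// => y yx.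
by rewrite Dbubble_ngball// scaler0.
Qed.

Lemma next_out x : (forall z, adm C st z -> ~ gball z x) ->
  [/\ sf nextst x = sf st x, sG nextst x = sG st x & ss nextst x = ss st x].
Proof.
move=> h; rewrite /=; split; rewrite big1 ?addr0// => z _; case: (pselect (adm C st z)) => az.
- by rewrite bubble_ngball ?scaler0//; exact: h.
- by rewrite slope_nadm// scale0r.
- by rewrite Dbubble_ngball ?scaler0//; exact: h.
- by rewrite slope_nadm// scale0r.
- by rewrite gcore_ngball ?mulr0//; exact: h.
- by rewrite slope_nadm// !mul0r.
Qed.

Lemma next_cases x : (exists2 z, adm C st z & gball z x) \/ (forall z, adm C st z -> ~ gball z x).
Proof.
case: (pselect (exists2 z, adm C st z & gball z x)) => h; first by left.
by right => z az zx; apply: h; exists z.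
Qed.

Lemma next_sub : sU nextst `<=` sU st.
Proof.
move=> x [[//]|[z az /gcore_gball zx]]; by have [] := gball_adm az zx.
Qed.

Lemma next_U_gball z x : adm C st z -> gball z x -> sU nextst x <-> gcore z x.
Proof.
move=> az zx; split=> [[[_ h]|[y ay yx]]|h].
- by exfalso; apply: h; exists z.
- by rewrite (gball_inj zx (gcore_gball yx)).
- by right; exists z.
Qed.

Lemma next_U_out x : (forall z, adm C st z -> ~ gball z x) -> sU nextst x <-> sU st x.
Proof.
move=> h; split; first exact: next_sub.
by move=> Ux; left; split => // -[z az zx]; exact: (h z).
Qed.

Lemma next_notU x : ~ sU st x -> sG nextst x = sG st x.
Proof.
move=> nU; have [|//] := @next_out x.
by move=> z az zx; apply: nU; have [] := gball_adm az zx.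
Qed.

(** A point leaves the unfinished set only inside a ball and outside its core. There the old
    gradient, [ss] times the identity, cancels the subtracted identity in [Dbubble], and a multiple
    of [Dpsi] is left. *)
Lemma next_annulus x : sU st x -> ~ sU nextst x -> exists z,
  [/\ adm C st z, sG nextst x = ss st x *: Dpsi lam beta (ctr z) r x & 0 < sqd (ctr z) x].
Proof.
move=> Ux nU; have [[z az zx]|h] := next_cases x; last by exfalso; apply: nU; exact/next_U_out.
exists z; have [_ sx _ _] := gball_adm az zx.
have nc : ~ gcore z x by move=> /(next_U_gball az zx).
have hge : (lam * r) ^+ 2 <= sqd (ctr z) x by rewrite leNgt; apply/negP.
split=> //; last by rewrite (lt_le_trans _ hge)// exprn_gt0// mulr_gt0// r_gt0.
rewrite (next_sG_gball az zx) (inv_GU ist Ux) -sx /Dbubble ltNge hge/= (zx : _ <= _).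
by rewrite scalerBr scalemx1 addrC subrK.
Qed.

Lemma next_sfE x i : sf nextst x 0 i =
  sf st x 0 i + \sum_z sl z * bubble lam beta (ctr z) r x 0 i.
Proof. by rewrite /nextst [LHS]mxE summxE; congr (_ + _); apply: eq_bigr => z _; rewrite mxE. Qed.

Lemma next_sGE x i j : sG nextst x i j =
  sG st x i j + \sum_z sl z * Dbubble lam beta (ctr z) r x i j.
Proof. by rewrite /nextst [LHS]mxE summxE; congr (_ + _); apply: eq_bigr => z _; rewrite mxE. Qed.

Lemma next_cont i : continuous (fun x => sf nextst x 0 i).
Proof.
under eq_fun do rewrite next_sfE.
apply: add_continuous_fun; first exact: (inv_cont ist).
apply: sum_continuous_fun => z; apply: mul_continuous_fun; first exact: cst_continuous.
exact: continuous_bubble.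
Qed.

Lemma sl_ge0 z : 0 <= sl z.
Proof. by apply: slope_ge0; exact: (inv_ge1 ist). Qed.

Lemma next_lip : exists L, forall i j x (t : R),
  `|sf nextst (x + t *: ej R j) 0 i - sf nextst x 0 i| <= L * `|t|.
Proof.
have [L hL] := inv_lip ist.
have /choice[B hB] : forall zj : ix * 'I_n, exists B, forall x (t : R) i,
    `|bubble lam beta (ctr zj.1) r (x + t *: ej R zj.2) 0 i - bubble lam beta (ctr zj.1) r x 0 i|
      <= B * `|t|.
  by move=> zj; apply: bubble_lip => //; exact: r_gt0.
exists (L + \sum_z \sum_j sl z * `|B (z, j)|) => i j x t.
have -> : sf nextst (x + t *: ej R j) 0 i - sf nextst x 0 i =
    (sf st (x + t *: ej R j) 0 i - sf st x 0 i) + \sum_z sl z *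
    (bubble lam beta (ctr z) r (x + t *: ej R j) 0 i - bubble lam beta (ctr z) r x 0 i).
  rewrite !next_sfE; under [in RHS]eq_bigr do rewrite mulrBr.
  by rewrite sumrB; ring.
rewrite (le_trans (ler_normD _ _))// mulrDl lerD//.
rewrite (le_trans (ler_norm_sum _ _ _))//.
rewrite (@le_trans _ _ ((\sum_z sl z * `|B (z, j)|) * `|t|))//.
  rewrite mulr_suml; apply: ler_sum => z _.
  rewrite normrM (ger0_norm (sl_ge0 z)) -mulrA ler_wpM2l ?sl_ge0//.
  by rewrite (le_trans (hB (z, j) x t i))// ler_wpM2r// ler_norm.
rewrite ler_wpM2r//.
apply: ler_sum => z _; rewrite (bigD1 j)//= lerDl sumr_ge0// => q _.
by rewrite mulr_ge0 ?sl_ge0.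
Qed.

Lemma next_mG i j : measurable_fun setT ((fun x => sG nextst x i j) : Rn R n -> R).
Proof.
under eq_fun do rewrite next_sGE.
apply: measurable_funD; first exact: (inv_mG ist).
apply: measurable_sum => z; apply: measurable_funM; first exact: measurable_cst.
exact: measurable_Dbubble.
Qed.

Lemma negligible_seqU (I : eqType) (s : seq I) (N : I -> set (Rn R n)) :
  (forall z, mu.-negligible (N z)) -> mu.-negligible [set x | exists2 z, z \in s & N z x].
Proof.
move=> h; elim: s => [|z s IH].
  by apply: negligibleS (negligible_set0 _) => x [].
apply: negligibleS (negligibleU (h z) IH) => x [y].
by rewrite inE => /orP[/eqP ->|ys]; [left|right; exists y].
Qed.

Lemma negligible_sqd_eq (a : V) (rho : R) :
  mu.-negligible ([set x | sqd a x = rho] : set (Rn R n)).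
Proof.
exists [set x | sqd a x = rho]; split => //.
  by apply: closed_measurable_Rn; exact: closed_sqd_eq.
by apply: leb_sphere; exact: ltnW.
Qed.

(** New exceptional points lie on the boundary spheres of finitely many balls and cores, which are
    null. *)
Lemma next_der : ae_in setT (fun x => forall i j,
  is_derive x (ej R j) (fun y => sf nextst y 0 i) (sG nextst x i j)).
Proof.
have h (z : ix) := negligibleU (@negligible_sqd_eq (ctr z) ((lam * r) ^+ 2))
  (@negligible_sqd_eq (ctr z) (r ^+ 2)).
apply: negligibleS (negligibleU (inv_der ist) (negligible_seqU (enum ix) h)) => x /= [_ nx].
case: (pselect (forall i j, is_derive x (ej R j) (fun y => sf st y 0 i) (sG st x i j))) => dx;
  last by left.
right; apply: contra_notP nx => nx i j.
under eq_fun do rewrite next_sfE; rewrite next_sGE.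
apply: is_derive_bigsum => // z.
have db : is_derive x (ej R j) (fun y => bubble lam beta (ctr z) r y 0 i)
    (Dbubble lam beta (ctr z) r x i j).
  by apply: bubble_derive => //; [exact: r_gt0| |] => E; apply: nx; exists z;
    rewrite ?mem_enum//; [left|right].
exact: (is_deriveZ (sl z) db).
Qed.

Lemma next_ms : measurable_fun setT (ss nextst : Rn R n -> R).
Proof.
apply: measurable_funD; first exact: (inv_ms ist).
apply: measurable_sum => z; apply: measurable_funM; first exact: measurable_cst.
by apply: measurable_indic; exact: measurable_sqd_lt.
Qed.

Lemma next_term_ge0 z x : 0 <= sl z * (c - 1) * \1_(gcore z) x.
Proof. by apply: mulr_ge0 => //; apply: mulr_ge0; [exact: sl_ge0|rewrite subr_ge0 c_ge1]. Qed.

Lemma next_ge1 x : 1 <= ss nextst x.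
Proof.
rewrite (le_trans (inv_ge1 ist x))// lerDl sumr_ge0// => z _; exact: next_term_ge0.
Qed.

Lemma next_le : exists B, forall x, ss nextst x <= B.
Proof.
have [B hB] := inv_le ist; exists (B + \sum_z sl z * (c - 1)) => x.
rewrite lerD//; apply: ler_sum => z _; apply: ler_piMr.
  by rewrite mulr_ge0 ?sl_ge0// subr_ge0 c_ge1.
by rewrite indicE; case: (_ \in _).
Qed.

Lemma next_core z x : adm C st z -> gcore z x ->
  [/\ ss nextst x = ss st (ctr z) * c,
      sf nextst x = sf st (ctr z) + (ss st (ctr z) * c) *: (x - ctr z),
      sG nextst x = (ss st (ctr z) * c)%:M & (C x <-> C (ctr z))].
Proof.
move=> az zx; have bx := gcore_gball zx; have [Ux sx fx Cx] := gball_adm az bx.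
split => //.
- by rewrite (next_ss_gball az bx) indicE (mem_set zx) mulr1; ring.
- rewrite (next_sf_gball az bx) fx /bubble mfac_in//; [|exact: r_gt0|exact: ltW].
  by rewrite -addrA scalerA -scalerDl; congr (_ + _ *: _); ring.
- rewrite (next_sG_gball az bx) (inv_GU ist Ux) sx /Dbubble (zx : _ < _).
  apply/matrixP => i j; rewrite !mxE; case: (i == j); rewrite ?mulr1n ?mulr0n; ring.
Qed.

(** In a core the map is a similarity of the larger slope about the centre of the cube. Off the
    balls the old neighbourhood is shrunk to avoid the finitely many closed balls. *)
Lemma next_loc : locally_similar C nextst.
Proof.
move=> x Ux; have [[z az zx]|h] := next_cases x.
  have cx := (next_U_gball az zx).1 Ux.
  have /nbhs_ballP[e e0 he] := near_sqd_lt cx.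
  exists e => // y /he cy.
  have [s1 f1 _ C1] := next_core az cx; have [s2 f2 _ C2] := next_core az cy.
  split; [by right; exists z|by rewrite s1 s2| |by split=> [/C2/C1|/C1/C2]].
  rewrite f2 f1 s1 -addrA -scalerDr; congr (_ + _ *: _).
  by rewrite [RHS]addrC addrA subrK.
have Ux' := (next_U_out h).1 Ux; have [e e0 he] := inv_loc ist Ux'.
have near1 : \forall y \near x, forall z, adm C st z -> ~ gball z y.
  apply: (@filter_forall V ix (fun z y => adm C st z -> ~ gball z y) (nbhs x)) => z.
  case: (pselect (adm C st z)) => az; last by apply: nearW.
  have : r ^+ 2 < sqd (ctr z) x by rewrite ltNge; apply/negP; exact: h.
  by move=> /near_sqd_gt; apply: filterS => y hy _ /=; apply/negP; rewrite -ltNge.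
have /nbhs_ballP[e1 e10 he1] := near1.
exists (Num.min e e1); first by rewrite lt_min e0; exact: e10.
move=> y hy.
have /he[Uy sy fy Cy] : ball x e y by apply: le_ball hy; rewrite ge_min lexx.
have /he1 ny : ball x e1 y by apply: le_ball hy; rewrite ge_min lexx orbT.
have [f1 _ s1] := next_out h; have [f2 _ s2] := next_out ny.
by split=> //; [exact/next_U_out|rewrite s1 s2|rewrite f1 f2 s1].
Qed.

Lemma next_GU x : sU nextst x -> sG nextst x = (ss nextst x)%:M.
Proof.
move=> Ux; have [[z az zx]|h] := next_cases x.
  by have cx := (next_U_gball az zx).1 Ux; have [-> _ -> _] := next_core az cx.
have [_ -> ->] := next_out h; exact: (inv_GU ist ((next_U_out h).1 Ux)).
Qed.

Lemma next_good : ae_in (Omega `\` sU nextst)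
  (fun x => \det (sG nextst x) <= 0 /\ distortion_le K (sG nextst x)).
Proof.
apply: negligibleS (inv_good ist) => x [[Ox nU] bad].
case: (pselect (sU st x)) => Ux; last by split=> //; rewrite -next_notU.
exfalso; apply: bad; have [z [az -> q0]] := next_annulus Ux nU.
apply: (Dpsi_good lam0 lam1 beta1 _ _ al0 al1 Kal bal) => //.
by rewrite (le_trans ler01)//; exact: (inv_ge1 ist).
Qed.

Lemma next_inv : stinv Omega C K nextst.
Proof.
split; [exact: next_cont|exact: next_lip|exact: next_mG|exact: next_der|exact: next_ms|
  exact: next_ge1|exact: next_le| |exact: next_loc|exact: next_GU|exact: next_good].
by move=> x /next_sub; exact: (inv_sub ist).
Qed.

Lemma next_close_sup B x i : (forall x, ss st x <= B) ->
  `|sf nextst x 0 i - sf st x 0 i| <= B * (c * r).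
Proof.
move=> hB; have c0 := le_trans ler01 c_ge1; have r0 := ltW r_gt0.
have B0 : 0 <= B by rewrite (le_trans _ (hB 0))// (le_trans ler01)// (inv_ge1 ist).
have [[z az zx]|h] := next_cases x; last first.
  have [-> _ _] := next_out h; rewrite subrr normr0.
  by apply: mulr_ge0 => //; apply: mulr_ge0.
rewrite (next_sf_gball az zx) mxE addrAC subrr add0r mxE normrM ler_pM//.
  by rewrite ger0_norm// (le_trans ler01)//; exact: (inv_ge1 ist).
by apply: bubble_bound => //; exact: r_gt0.
Qed.

Lemma next_bound x i j : sU st x -> ~ sU nextst x ->
  `|sG nextst x i j| <= c * (1 + beta) * ss st x.
Proof.
move=> Ux nU; have [z [az -> q0]] := next_annulus Ux nU.
have s0 : 0 <= ss st x by rewrite (le_trans ler01)//; exact: (inv_ge1 ist).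
rewrite mxE normrM (ger0_norm s0) mulrC ler_wpM2r//.
exact: Dpsi_bound.
Qed.

(** Pointwise energy balance: a ball loses [s^q], and its core returns [(c s)^q]. The loss is added
    on the left instead of being subtracted on the right, so that integration involves nonnegative
    functions only. *)
Lemma next_weight q x : 0 < q ->
  weight nextst q x + \sum_z sl z `^ q * \1_(gball z) x <=
  weight st q x + \sum_z (c `^ q * sl z `^ q) * \1_(gcore z) x.
Proof.
move=> q0; have [[z az zx]|h] := next_cases x; last first.
  have [_ _ s1] := next_out h.
  have -> : weight nextst q x = weight st q x.
    rewrite /weight s1; congr (_ * _); rewrite !indicE; congr (_%:R); congr nat_of_bool.
    by apply/idP/idP => /set_mem H; apply/mem_set; apply/(next_U_out h).
  rewrite lerD2l !big1// => z _; case: (pselect (adm C st z)) => az.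
  - by rewrite gcore_ngball ?mulr0//; exact: h.
  - by rewrite slope_nadm// powR0 ?gt_eqF// mulr0 mul0r.
  - by rewrite indicE memNset ?mulr0//; exact: h.
  - by rewrite slope_nadm// powR0 ?gt_eqF// mul0r.
have [Ux sx _ _] := gball_adm az zx.
rewrite (sum_gball (F := fun z => sl z `^ q * \1_(gball z) x) zx); last first.
  by move=> y yx; rewrite indicE memNset// mulr0.
rewrite (sum_gball (F := fun z => (c `^ q * sl z `^ q) * \1_(gcore z) x) zx); last first.
  by move=> y yx; rewrite gcore_ngball// mulr0.
rewrite slope_adm// /weight [\1_(gball z) x]indicE (mem_set zx) [\1_(sU st) x]indicE (mem_set Ux) sx.
rewrite !mulr1 mul1r addrC lerD2l.
case: (pselect (gcore z x)) => cx.
  have [-> _ _ _] := next_core az cx.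
  have s0 : 0 <= ss st (ctr z) by rewrite (le_trans ler01)//; exact: (inv_ge1 ist).
  rewrite !indicE (mem_set cx) mem_set; last exact/(next_U_gball az zx).
  by rewrite mulr1 mul1r mulrC powRM// (le_trans ler01)// c_ge1.
by rewrite !indicE (memNset cx) memNset ?mul0r ?mulr0// => /(next_U_gball az zx).
Qed.

(** Outside the cores the new energy is bounded below by 0; all the growth is drawn from the
    cores. *)
Lemma next_cweight q x : 0 < q ->
  \sum_z (c `^ q * (\1_C (ctr z) * sl z `^ q)) * \1_(gcore z) x <= cweight C nextst q x.
Proof.
move=> q0; have [[z az zx]|h] := next_cases x; last first.
  rewrite big1 ?cweight_ge0// => z _; case: (pselect (adm C st z)) => az.
  - by rewrite gcore_ngball ?mulr0//; exact: h.
  - by rewrite slope_nadm// powR0 ?gt_eqF// !mulr0 mul0r.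
rewrite (sum_gball (F := fun z => (c `^ q * (\1_C (ctr z) * sl z `^ q)) * \1_(gcore z) x) zx); last first.
  by move=> y yx; rewrite gcore_ngball// mulr0.
case: (pselect (gcore z x)) => cx; last first.
  by rewrite [\1_(gcore z) x]indicE (memNset cx) mulr0 cweight_ge0.
have [sx _ _ Cx] := next_core az cx.
have s0 : 0 <= ss st (ctr z) by rewrite (le_trans ler01)//; exact: (inv_ge1 ist).
rewrite /cweight sx slope_adm// [\1_(gcore z) x]indicE (mem_set cx) mulr1.
have -> : \1_(sU nextst `&` C) x = \1_C (ctr z) :> R.
  rewrite !indicE; congr (_%:R); congr nat_of_bool; apply/idP/idP => /set_mem H; apply/mem_set.
    by apply/Cx; case: H.
  by split; [exact/(next_U_gball az zx)|exact/Cx].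
by rewrite mulrCA powRM ?(le_trans ler01 c_ge1)// [c `^ q * _]mulrC.
Qed.

Lemma inv_weight_integrable st' q : stinv Omega C K st' -> 0 <= q ->
  mu.-integrable setT (fun x : Rn R n => (weight st' q x)%:E).
Proof.
move=> i' q0; apply: (integrable_weight_like Okb (inv_sub i') (inv_ge1 i') (inv_le i') q0).
  exact: (measurable_weight (inv_loc i') (inv_ms i')).
by move=> x; rewrite weight_ge0 lexx.
Qed.

(** Fraction of a grid cube that its ball is sure to fill: a ball of radius [w/4] contains a cube of
    side [w/(4n)]. *)
Definition theta : R := ((4 * n%:R)^-1) ^+ n.

Lemma theta_gt0 : 0 < theta.
Proof. by rewrite exprn_gt0// invr_gt0 mulr_gt0// ltr0n ltnW. Qed.

Lemma theta_width : (r / n%:R) ^+ n = theta * w ^+ n.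
Proof.
rewrite /theta -exprMn; congr (_ ^+ _).
by rewrite -mulrA mulrC invfM.
Qed.

Lemma filled_integral (g : V -> R) (d : ix -> R) :
  (forall z x, adm C st z -> cube (corner z) w x -> g x = d z) ->
  (forall z, ~ adm C st z -> d z = 0) -> (forall z, 0 <= d z) ->
  (\int[mu]_x (\1_(filled C kb st k) x * g x)%:E = (\sum_z d z * w ^+ n)%:E)%E.
Proof.
move=> gd d0 dge.
transitivity (\int[mu]_x (\sum_z d z * \1_(cube (corner z) w : set (Rn R n)) x)%:E)%E.
  by apply: eq_integral => x _; rewrite (step_filled gd d0).
rewrite integral_step//; last by move=> z; exact: measurable_cube.
rewrite -sumEFin; apply: eq_bigr => z _; rewrite EFinM; congr (_ * _)%E.
by apply: leb_cube; exact: ltW (@width_gt0 R k).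
Qed.

(** With [S] the energy in the admissible cubes, the balls remove at least [theta S] and the cores
    return at most [theta S / 2]. Since [S] is at least half of the total, the net loss is at least
    [theta / 4] of it. *)
Lemma next_decay p : 0 < p -> c `^ p * (lam * r *+ 2) ^+ n <= theta / 2 * w ^+ n ->
  (\int[mu]_x (weight st p x)%:E <=
     2%:E * \int[mu]_x (\1_(filled C kb st k) x * weight st p x)%:E)%E ->
  (\int[mu]_x (weight nextst p x)%:E <= (1 - theta / 4)%:E * \int[mu]_x (weight st p x)%:E)%E.
Proof.
move=> p0 hc half.
have inx := next_inv.
have i1 := inv_weight_integrable ist (ltW p0).
have i2 := inv_weight_integrable inx (ltW p0).
have [m1 _] := integrableP _ _ _ i1; have [m2 _] := integrableP _ _ _ i2.
have f1 := integrable_fin_num measurableT i1; have f2 := integrable_fin_num measurableT i2.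
have spos z : 0 <= sl z `^ p by exact: powR_ge0.
have cpos z : 0 <= c `^ p * sl z `^ p by rewrite mulr_ge0 ?powR_ge0.
have mB z : measurable (gball z : set (Rn R n)) by exact: measurable_sqd_le.
have mI z : measurable (gcore z : set (Rn R n)) by exact: measurable_sqd_lt.
have w0 := @width_gt0 R k.
pose S := \sum_z sl z `^ p * w ^+ n.
have fE : (\int[mu]_x (\1_(filled C kb st k) x * weight st p x)%:E = S%:E)%E.
  apply: filled_integral => // [z x az /cube_sub_ccube hx|z nz].
    have [Ux sx _ _] := az _ hx.
    by rewrite /weight indicE (mem_set Ux) mul1r sx slope_adm.
  by rewrite slope_nadm// powR0// gt_eqF.
have mstep (d : ix -> R) (Q : ix -> set (Rn R n)) : (forall z, measurable (Q z)) ->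
    measurable_fun setT (fun x : Rn R n => (\sum_z d z * \1_(Q z) x)%:E).
  move=> mQ; apply/measurable_EFinP; apply: measurable_sum => z.
  by apply: measurable_funM; [exact: measurable_cst|exact: measurable_indic].
have stepge (d : ix -> R) (Q : ix -> set (Rn R n)) x : (forall z, 0 <= d z) ->
    (0 <= (\sum_z d z * \1_(Q z) x)%:E)%E.
  by move=> d0; rewrite lee_fin sumr_ge0// => z _; rewrite mulr_ge0.
have key : (\int[mu]_x (weight nextst p x)%:E + \sum_z (sl z `^ p)%:E * mu (gball z) <=
    \int[mu]_x (weight st p x)%:E + \sum_z (c `^ p * sl z `^ p)%:E * mu (gcore z))%E.
  rewrite -!integral_step//.
  have w1 (x : Rn R n) : setT x -> (0 <= (weight nextst p x)%:E)%E by rewrite lee_fin weight_ge0.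
  have w2 (x : Rn R n) : setT x -> (0 <= (weight st p x)%:E)%E by rewrite lee_fin weight_ge0.
  have s1 x : setT x -> (0 <= (\sum_z sl z `^ p * \1_(gball z : set (Rn R n)) x)%:E)%E.
    by move=> _; exact: stepge.
  have s2 x : setT x -> (0 <= (\sum_z (c `^ p * sl z `^ p) * \1_(gcore z : set (Rn R n)) x)%:E)%E.
    by move=> _; exact: stepge.
  have ms1 := mstep (fun z => sl z `^ p) _ mB.
  have ms2 := mstep (fun z => c `^ p * sl z `^ p) _ mI.
  rewrite -(ge0_integralD _ measurableT w1 m2 s1 ms1).
  rewrite -(ge0_integralD _ measurableT w2 m1 s2 ms2).
  apply: ge0_le_integral => //.
  - by move=> x _; rewrite adde_ge0// ?w1// s1.
  - exact: emeasurable_funD.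
  - exact: emeasurable_funD.
  - by move=> x _; rewrite -!EFinD lee_fin; exact: next_weight.
have lowB : ((theta * S)%:E <= \sum_z (sl z `^ p)%:E * mu (gball z))%E.
  rewrite /S mulr_sumr -sumEFin; apply: lee_sum => z _.
  rewrite mulrCA -theta_width EFinM; apply: lee_wpmul2l; first by rewrite lee_fin.
  by apply: leb_cball_lower => //; exact: r_gt0.
have upI : (\sum_z (c `^ p * sl z `^ p)%:E * mu (gcore z) <= (theta / 2 * S)%:E)%E.
  rewrite /S mulr_sumr -sumEFin; apply: lee_sum => z _.
  apply: (@le_trans _ _ ((c `^ p * sl z `^ p)%:E * ((lam * r *+ 2) ^+ n)%:E)%E).
    apply: lee_wpmul2l; first by rewrite lee_fin.
    by apply: leb_ball_upper; rewrite mulr_gt0// r_gt0.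
  rewrite -EFinM lee_fin mulrAC mulrC [leRHS]mulrCA; apply: ler_wpM2l => //.
have := le_trans (leeD2l _ lowB) (le_trans key (leeD2l _ upI)).
move: half; rewrite fE -(fineK f1) -(fineK f2) -!EFinM -!EFinD !lee_fin.
have t0 := theta_gt0; set I := fine _; set J := fine _ => h1 h2.
have : theta / 4 * I <= theta / 4 * (2 * S) by rewrite ler_wpM2l// divr_ge0// ltW.
lra.
Qed.

(** The constant 6 is twice 3: the grid may hold only half of the energy, and its cores must still
    return three times the whole. *)
Lemma next_growth q : 0 < q -> measurable (C : set (Rn R n)) ->
  6 * w ^+ n <= c `^ q * (lam * r / n%:R) ^+ n ->
  (\int[mu]_x (cweight C st q x)%:E <=
     2%:E * \int[mu]_x (\1_(filled C kb st k) x * cweight C st q x)%:E)%E ->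
  (3%:E * \int[mu]_x (cweight C st q x)%:E <= \int[mu]_x (cweight C nextst q x)%:E)%E.
Proof.
move=> q0 mC hc half.
have inx := next_inv.
have mI z : measurable (gcore z : set (Rn R n)) by exact: measurable_sqd_lt.
pose d z := \1_C (ctr z) * sl z `^ q.
have dpos z : 0 <= d z by rewrite mulr_ge0 ?powR_ge0.
have cpos z : 0 <= c `^ q * d z by rewrite mulr_ge0 ?powR_ge0.
pose S := \sum_z d z * w ^+ n.
have fE : (\int[mu]_x (\1_(filled C kb st k) x * cweight C st q x)%:E = S%:E)%E.
  apply: filled_integral => // [z x az /cube_sub_ccube hx|z nz].
    have [Ux sx _ Cx] := az _ hx; rewrite /cweight /d sx slope_adm//; congr (_ * _).
    rewrite !indicE; congr (_%:R); congr nat_of_bool; apply/idP/idP => /set_mem H; apply/mem_set.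
      by apply/Cx; case: H.
    by split=> //; exact/Cx.
  by rewrite /d slope_nadm// powR0 ?mulr0// gt_eqF.
rewrite fE in half.
apply: (@le_trans _ _ (6 * S)%:E).
  have := lee_wpmul2l (_ : 0 <= 3%:E)%E half; rewrite muleA -!EFinM => h.
  by apply: (le_trans (h _)) => //; rewrite lee_fin; lra.
apply: (@le_trans _ _ (\int[mu]_x (\sum_z (c `^ q * d z) * \1_(gcore z : set (Rn R n)) x)%:E)%E).
  rewrite integral_step// /S mulr_sumr -sumEFin; apply: lee_sum => z _.
  apply: (@le_trans _ _ ((c `^ q * d z)%:E * ((lam * r / n%:R) ^+ n)%:E)%E).
    rewrite -EFinM lee_fin mulrCA [leRHS]mulrAC mulrC [leRHS]mulrC.
    by rewrite [X in X <= _]mulrC; apply: ler_wpM2l.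
  apply: lee_wpmul2l; first by rewrite lee_fin.
  by apply: leb_ball_lower => //; rewrite mulr_gt0// r_gt0.
have ge0S (x : Rn R n) : setT x ->
    (0 <= (\sum_z (c `^ q * d z) * \1_(gcore z : set (Rn R n)) x)%:E)%E.
  by move=> _; rewrite lee_fin sumr_ge0// => z _; rewrite mulr_ge0.
apply: ge0_le_integral => //.
- apply/measurable_EFinP; apply: measurable_sum => z.
  by apply: measurable_funM; [exact: measurable_cst|exact: measurable_indic].
- by apply/measurable_EFinP; exact: (measurable_cweight (inv_loc inx) (inv_ms inx)).
- by move=> x _; rewrite lee_fin; exact: next_cweight.
Qed.

End nextst.

(** * Lower semicontinuity of the n-energy under uniform convergence *)

Section lower_semicontinuity.
Context {R : realType} {n : nat}.
Local Notation V := 'rV[R]_n.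
Local Notation mu := (@leb R n).
Variables (Omega C : set V) (kb : nat) (K : R) (st : state R n) (j0 : 'I_n).
Hypotheses (Okb : Omega `<=` @cubek R n kb) (n0 : (0 < n)%N) (oO : open Omega).
Hypotheses (CO : C `<=` Omega) (mC : measurable (C : set (Rn R n))).
Hypothesis ist : stinv Omega C K st.

Lemma partial_bump_out (a : V) (h : R) x : 0 < h -> ~ ccube a h x -> partial j0 (cbump a h) x = 0.
Proof.
move=> h0 nx; rewrite /partial.
have oC : open (~` ccube a h) by rewrite openC; exact: closed_ccube.
have near0 : \forall y \near x, cbump a h y = (cst 0 : V -> R) y.
  have : nbhs x (~` ccube a h) by rewrite openE in oC; exact: oC.
  by apply: filterS => y ny; apply: bump_out => // /cube_sub_ccube.
by rewrite (near_eq_derive _ near0) derive_cst.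
Qed.

Lemma restrict_mul (g phi : V -> R) x : (forall x, ~ Omega x -> phi x = 0) ->
  ((fun x : Rn R n => (g x * phi x)%:E) \_ (Omega : set (Rn R n))) x =
  ((g \_ Omega) x * phi x)%:E.
Proof.
move=> h; rewrite /patch; case: ifPn => // /negP; rewrite inE => /h ->.
by rewrite mulr0.
Qed.

(** Multiplied by a uniform distance, this bounds the error made in the weak derivative identity
    when one map is replaced by another. *)
Definition bD (a : V) (h : R) : R := fine (\int[mu]_x (`|partial j0 (cbump a h) x|)%:E).

Lemma bump_partial_integrable (a : V) (h : R) : 0 < h ->
  mu.-integrable setT (EFin \o (partial j0 (cbump a h) : Rn R n -> R)).
Proof.
move=> h0; have t := @bump_test _ _ setT a h h0 (@subsetT _ _).
have [k [M [hk hM]]] := test_fun_bounds j0 t.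
apply: (@integrable_bounded_cubek _ _ _ k M).
- have [s _] := t; have [c _] := s [:: j0].
  by apply: continuous_measurable_Rn.
- by move=> x; exact: (hM x).2.
- by move=> x /hk[].
Qed.

Lemma bump_integrable (a : V) (h : R) : 0 < h ->
  mu.-integrable setT (EFin \o (cbump a h : Rn R n -> R)).
Proof.
move=> h0; have t := @bump_test _ _ setT a h h0 (@subsetT _ _).
have [k [M [hk hM]]] := test_fun_bounds j0 t.
apply: (@integrable_bounded_cubek _ _ _ k M).
- have [s _] := t; have [c _] := s [::].
  by apply: continuous_measurable_Rn.
- by move=> x; exact: (hM x).1.
- by move=> x /hk[].
Qed.

Section one_cube.
Variables (a : V) (w s del : R) (h : V -> V) (G' : V -> 'M[R]_n).
Hypotheses (w0 : 0 < w) (s1 : 1 <= s) (del0 : 0 <= del).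
Hypothesis aff : forall y, ccube a w y -> Omega y /\ sG st y j0 j0 = s.
Hypothesis wg : weak_gradient Omega h G'.
Hypothesis close : forall x, `|h x 0 j0 - sf st x 0 j0| <= del.
Hypothesis small : del * bD a w <= bump_const (R := R) (n := n) * w ^+ n / 2.

Let phi := cbump a w.
(** Extension by zero: measurability of [h] and [G'] is known on [Omega] only, while the integrals
    below run over the whole space. *)
Let g0 : V -> R := (fun x => G' x j0 j0) \_ Omega.
Let h0 : V -> R := (fun x => h x 0 j0) \_ Omega.
Let u : V -> R := fun x => sf st x 0 j0.
Let dphi := partial j0 phi.

Let tphi : test_fun Omega phi.
Proof. by apply: bump_test => // y /aff[]. Qed.

Let mO : measurable (Omega : set (Rn R n)). Proof. exact: open_measurable_Rn. Qed.

Let mg0 : measurable_fun setT (g0 : Rn R n -> R).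
Proof. by apply/(measurable_restrictT _ mO); have [_ /(_ j0 j0)[]] := wg. Qed.

Let mh0 : measurable_fun setT (h0 : Rn R n -> R).
Proof. by apply/(measurable_restrictT _ mO); have [/(_ j0)[]] := wg. Qed.

Let phi_out x : ~ Omega x -> phi x = 0.
Proof. by move=> nx; apply: bump_out => // /cube_sub_ccube/aff[]. Qed.

Let dphi_out x : ~ Omega x -> dphi x = 0.
Proof. by move=> nx; apply: partial_bump_out => // /aff[]. Qed.

Let cu : continuous u.
Proof. exact: (inv_cont ist). Qed.

Let mdphi : measurable_fun setT (dphi : Rn R n -> R).
Proof. by have [sm _] := tphi; have [cd _] := sm [:: j0]; exact: continuous_measurable_Rn. Qed.

Let weak_eq : (\int[mu]_x (h0 x * dphi x)%:E = - \int[mu]_x (g0 x * phi x)%:E)%E.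
Proof.
have [_ _ /(_ phi tphi j0 j0)] := wg.
rewrite integral_mkcond [X in _ = (- X)%E]integral_mkcond.
under eq_integral do rewrite (restrict_mul _ _ dphi_out).
by under [X in _ = (- X)%E]eq_integral do rewrite (restrict_mul _ _ phi_out).
Qed.

Let u_eq : mu.-integrable setT (fun x : Rn R n => (u x * dphi x)%:E) /\
  (\int[mu]_x (u x * dphi x)%:E = - (s%:E * \int[mu]_x (phi x)%:E))%E.
Proof.
have [L hL] := inv_lip ist.
have ad : ae_in setT (fun x => is_derive x (ej R j0) u (sG st x j0 j0)).
  apply: negligibleS (inv_der ist) => x [_ nx]; split=> // H; apply: nx; exact: H.
have [_ E] := ibp_lipschitz cu (inv_mG ist j0 j0) (hL j0 j0) ad tphi.
split.
  have [kk [M [hk hM]]] := test_fun_bounds j0 tphi.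
  have [Mu hMu] := continuous_bounded_compact cu (@compact_cubek R n kk).
  have M0 : 0 <= M by rewrite (le_trans (normr_ge0 (phi 0)))//; exact: (hM 0).1.
  apply: (@integrable_bounded_cubek _ _ (fun x => u x * dphi x) kk (`|Mu| * M)).
  - apply: measurable_funM; last exact: mdphi.
    exact: (continuous_measurable_Rn cu measurableT).
  - move=> x; case: (pselect (cubek kk x)) => hx.
      rewrite normrM ler_pM//; last exact: (hM x).2.
      by rewrite (le_trans (hMu _ hx))// ler_norm.
    by have [_ dx] := hk _ hx; rewrite /dphi dx mulr0 normr0 mulr_ge0.
  - by move=> x /hk[_ dx]; rewrite /dphi dx mulr0.
rewrite [LHS]E; congr (- _)%E.
rewrite -integralZl//; last exact: bump_integrable.
apply: eq_integral => x _; rewrite -EFinM; congr EFin.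
case: (pselect (ccube a w x)) => hx; first by rewrite (aff hx).2.
have -> : phi x = 0 by apply: bump_out => // /cube_sub_ccube.
by rewrite !mulr0.
Qed.

Let diff_le x : `|(h0 x - u x) * dphi x| <= del * `|dphi x|.
Proof.
case: (pselect (Omega x)) => Ox; last by rewrite dphi_out// mulr0 normr0 mulr0.
rewrite normrM ler_wpM2r// /h0 /patch mem_set//; exact: close.
Qed.

Let idel : mu.-integrable setT (fun x : Rn R n => (del * `|dphi x|)%:E).
Proof.
under eq_fun do rewrite EFinM.
apply: integrableZl => //.
have := integrable_abse (bump_partial_integrable a w0); apply: eq_integrable => //.
Qed.

Let idiff : mu.-integrable setT (fun x : Rn R n => ((h0 x - u x) * dphi x)%:E).
Proof.
have mdiff : measurable_fun setT (fun x : Rn R n => ((h0 x - u x) * dphi x)%:E).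
  apply/measurable_EFinP; apply: measurable_funM; last exact: mdphi.
  apply: measurable_funB; first exact: mh0.
  exact: (continuous_measurable_Rn cu measurableT).
apply: (le_integrable measurableT mdiff _ idel) => x _.
by rewrite /= lee_fin (le_trans (diff_le x))// ler_norm.
Qed.

(** Tested against the bump, the stage map yields [s] times the integral of the bump; passing to [h]
    costs at most [del] times [bD]. By [small] and [s >= 1] this is at most half of the main
    term. *)
Lemma cube_gradient_L1 : ((s * (bump_const (R := R) (n := n) * w ^+ n) / 2)%:E <=
  \int[mu]_x (`|g0 x| * \1_(cube a w : set (Rn R n)) x)%:E)%E.
Proof.
have [iu Eu] := u_eq.
have iphi := bump_integrable a w0.
have fphi := integrable_fin_num measurableT iphi.
have fu := integrable_fin_num measurableT iu.
have fdiff := integrable_fin_num measurableT idiff.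
have Eh : (\int[mu]_x (h0 x * dphi x)%:E =
    \int[mu]_x (u x * dphi x)%:E + \int[mu]_x ((h0 x - u x) * dphi x)%:E)%E.
  rewrite -(integralD measurableT iu idiff); apply: eq_integral => x _.
  by rewrite -EFinD; congr EFin; ring.
have h1 : (\int[mu]_x (g0 x * phi x)%:E <=
    \int[mu]_x (`|g0 x| * \1_(cube a w : set (Rn R n)) x)%:E)%E.
  have mgp : measurable_fun setT (fun x : Rn R n => (g0 x * phi x)%:E).
    apply/measurable_EFinP; apply: measurable_funM => //.
    by have [sm _] := tphi; have [c _] := sm [::]; apply: continuous_measurable_Rn.
  apply: (le_trans (lee_abs _)); apply: (le_trans (le_abse_integral _ measurableT mgp)).
  apply: ge0_le_integral => //.
  - exact: measurableT_comp.
  - apply/measurable_EFinP; apply: measurable_funM; first exact: measurableT_comp.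
    by apply: measurable_indic; exact: measurable_cube.
  - move=> x _; rewrite /= lee_fin normrM ler_wpM2l// (ger0_norm (bump_ge0 _ _ _)) indicE.
    case: (pselect (cube a w x)) => hx; first by rewrite mem_set// bump_le1.
    by rewrite memNset// /phi bump_out.
have h2 : (\int[mu]_x ((h0 x - u x) * dphi x)%:E <= (del * bD a w)%:E)%E.
  have fD := integrable_fin_num measurableT (integrable_abse (bump_partial_integrable a w0)).
  have -> : ((del * bD a w)%:E = \int[mu]_x (del * `|dphi x|)%:E)%E.
    under eq_integral do rewrite EFinM.
    rewrite integralZl//; last by have := integrable_abse (bump_partial_integrable a w0); apply: eq_integrable.
    by rewrite EFinM /bD fineK.
  apply: le_integral => // x _; rewrite lee_fin (le_trans (ler_norm _))//; exact: diff_le.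
have h3 := integral_bump_ge a w0.
have E1 : (\int[mu]_x (g0 x * phi x)%:E = - \int[mu]_x (h0 x * dphi x)%:E)%E.
  by rewrite weak_eq oppeK.
apply: le_trans h1; rewrite E1 Eh Eu.
pose P := fine (\int[mu]_x (phi x)%:E); pose D := fine (\int[mu]_x ((h0 x - u x) * dphi x)%:E).
have EP : (\int[mu]_x (phi x)%:E = P%:E)%E by rewrite /P fineK.
have ED : (\int[mu]_x ((h0 x - u x) * dphi x)%:E = D%:E)%E by rewrite /D fineK.
rewrite -/phi EP lee_fin in h3; rewrite ED lee_fin in h2; rewrite EP ED.
have -> : (- (- (s%:E * P%:E) + D%:E) = (s * P - D)%:E)%E.
  change ((- (- (s * P) + D))%:E = (s * P - D)%:E); congr EFin; ring.
rewrite lee_fin.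
have : s * (bump_const (R := R) (n := n) * w ^+ n) <= s * P.
  by rewrite ler_wpM2l// (le_trans ler01).
have : 1 * (bump_const (R := R) (n := n) * w ^+ n) <= s * (bump_const (R := R) (n := n) * w ^+ n).
  by rewrite ler_wpM2r// mulr_ge0 ?exprn_ge0 ?(ltW w0)//; exact/ltW/bump_const_gt0.
have := small; lra.
Qed.

(** A form of Jensen's inequality on the cube, obtained from the pointwise bound
    [|g| <= t + t^(1-n) |g|^n], valid on either side of the level [t]. *)
Lemma cube_gradient_Ln : (((bump_const (R := R) (n := n) / 4) ^+ n * s ^+ n * w ^+ n)%:E <=
  \int[mu]_x (`|g0 x| `^ n%:R * \1_(cube a w : set (Rn R n)) x)%:E)%E.
Proof.
have h1 := cube_gradient_L1.
pose b : R := bump_const (R := R) (n := n).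
have b0 : 0 < b by exact: bump_const_gt0.
have s0 : 0 < s by rewrite (lt_le_trans ltr01).
(* Half of the mean value [s b / 2] guaranteed on the cube: once [t w^n] is spent on the truncated
   part, another [t w^n] remains. *)
pose t := s * b / 4.
have t0 : 0 < t by rewrite divr_gt0// mulr_gt0.
have mcube : measurable (cube a w : set (Rn R n)) by exact: measurable_cube.
have mn : measurable_fun setT (fun x : Rn R n => (`|g0 x| `^ n%:R * \1_(cube a w : set (Rn R n)) x)%:E).
  apply/measurable_EFinP; apply: measurable_funM; last exact: measurable_indic.
  by apply: (measurableT_comp (measurable_powR _)); exact: measurableT_comp.
have pt x : `|g0 x| * \1_(cube a w) x <=
    t * \1_(cube a w) x + (t ^+ n.-1)^-1 * (`|g0 x| `^ n%:R * \1_(cube a w) x).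
  have i0 : 0 <= \1_(cube a w) x :> R by [].
  rewrite mulrA -mulrDl ler_wpM2r// powR_mulrn//.
  have [gt|gt] := leP `|g0 x| t.
    by rewrite (le_trans gt)// lerDl mulr_ge0 ?invr_ge0 ?exprn_ge0// ltW.
  rewrite (@le_trans _ _ ((t ^+ n.-1)^-1 * `|g0 x| ^+ n))//; last by rewrite lerDr ltW.
  rewrite mulrC ler_pdivlMr ?exprn_gt0//.
  rewrite -{2}(prednK n0) exprS ler_wpM2l//.
  by rewrite lerXn2r ?nnegrE ?(ltW t0)// ltW.
set Y := (\int[mu]_x (`|g0 x| `^ n%:R * _)%:E)%E.
have Y0 : (0 <= Y)%E by apply: integral_ge0 => x _; rewrite lee_fin mulr_ge0// powR_ge0.
have i1 : (\int[mu]_x (t * \1_(cube a w : set (Rn R n)) x)%:E = (t * w ^+ n)%:E)%E.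
  under eq_integral do rewrite EFinM.
  have mi : measurable_fun setT (fun x : Rn R n => (\1_(cube a w : set (Rn R n)) x : R)%:E).
    by apply/measurable_EFinP; exact: measurable_indic.
  have E : mu (cube a w) = (w ^+ n)%:E by apply: leb_cube; exact: ltW.
  transitivity (t%:E * (w ^+ n)%:E)%E; last by rewrite EFinM.
  rewrite ge0_integralZl ?lee_fin ?(ltW t0)//; congr (_ * _)%E.
  by rewrite integral_indic// setIT.
have i2 : (\int[mu]_x ((t ^+ n.-1)^-1 * (`|g0 x| `^ n%:R * \1_(cube a w : set (Rn R n)) x))%:E
    = ((t ^+ n.-1)^-1)%:E * Y)%E.
  under eq_integral do rewrite EFinM.
  have nn (x : Rn R n) : setT x ->
      (0 <= (`|g0 x| `^ n%:R * \1_(cube a w : set (Rn R n)) x)%:E)%E.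
    by move=> _; rewrite lee_fin mulr_ge0// powR_ge0.
  have t1 : (0 <= ((t ^+ n.-1)^-1)%:E)%E by rewrite lee_fin invr_ge0 exprn_ge0 ?(ltW t0).
  by rewrite ge0_integralZl.
have h2 : (\int[mu]_x (`|g0 x| * \1_(cube a w : set (Rn R n)) x)%:E <=
    (t * w ^+ n)%:E + ((t ^+ n.-1)^-1)%:E * Y)%E.
  rewrite -i1 -i2 -ge0_integralD//; first 1 last.
  - by move=> x _; rewrite lee_fin mulr_ge0// ltW.
  - by apply/measurable_EFinP; apply: measurable_funM => //; exact: measurable_indic.
  - by move=> x _; rewrite lee_fin !mulr_ge0 ?powR_ge0 ?invr_ge0 ?exprn_ge0// ltW.
  - under eq_fun do rewrite EFinM; apply: emeasurable_funM => //.
  apply: ge0_le_integral => //.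
  - apply/measurable_EFinP; apply: measurable_funM; first exact: measurableT_comp.
    exact: measurable_indic.
  - apply: emeasurable_funD.
      by apply/measurable_EFinP; apply: measurable_funM => //; exact: measurable_indic.
    by under eq_fun do rewrite EFinM; apply: emeasurable_funM.
  - by move=> x _; rewrite -EFinD lee_fin; exact: pt.
have h3 := le_trans h1 h2.
case: (eqVneq Y +oo%E) => [->|Yn]; first by rewrite leey.
have Yf : Y \is a fin_num by rewrite ge0_fin_numE// lt_neqAle Yn leey.
move: h3; rewrite -(fineK Yf) -EFinM -EFinD !lee_fin -/b; set y := fine Y => h3.
have h4 : t * w ^+ n <= (t ^+ n.-1)^-1 * y.
  have -> : t * w ^+ n = s * (b * w ^+ n) / 2 - t * w ^+ n by rewrite /t; field.
  lra.
have : t ^+ n.-1 * (t * w ^+ n) <= y.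
  by move: h4; rewrite [leRHS]mulrC ler_pdivlMr ?exprn_gt0// mulrC.
rewrite mulrA -exprSr prednK// => h5.
have -> : (b / 4) ^+ n * s ^+ n = t ^+ n; last exact: h5.
by rewrite /t -exprMn; congr (_ ^+ _); ring.
Qed.

End one_cube.

Lemma bD_ge0 a h : 0 <= bD a h.
Proof. by apply: fine_ge0; apply: integral_ge0 => x _; rewrite lee_fin. Qed.

Definition lsc_const : R := (bump_const (R := R) (n := n) / 4) ^+ n / 2.

Lemma lsc_const_gt0 : 0 < lsc_const.
Proof. by rewrite divr_gt0// exprn_gt0// divr_gt0// bump_const_gt0. Qed.

(** Finitely many admissible cubes hold half of the energy, which is the factor 2 in [lsc_const],
    and on each of them every close enough map keeps a fixed share. As [G'] is arbitrary, the bound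
    will apply to whichever gradient a supposed W^{1,n}_loc membership provides. *)
Lemma energy_lsc : exists2 del, 0 < del & forall h G', weak_gradient Omega h G' ->
  (forall x, `|h x 0 j0 - sf st x 0 j0| <= del) ->
  (lsc_const%:E * \int[mu]_x (cweight C st n%:R x)%:E <=
   \int[mu]_(x in (C : set (Rn R n))) (`|G' x j0 j0| `^ n%:R)%:E)%E.
Proof.
have q0 : 0 < n%:R :> R by rewrite ltr0n.
have mcw := measurable_cweight (inv_loc ist) (inv_ms ist) mC n%:R.
have [k /(_ k (leqnn k)) half] := filled_half Okb (inv_sub ist) (inv_loc ist) (inv_ge1 ist)
  (inv_le ist) (ltW q0) mcw (cweight_le_weight C st n%:R).
pose w := @width R k; have w0 : 0 < w by exact: width_gt0.
pose b : R := bump_const (R := R) (n := n).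
have b0 : 0 < b by exact: bump_const_gt0.
(* One distance must serve all cubes, and each [bD] is at most this sum; the added 1 below keeps the
   denominator positive. *)
pose DD := \sum_(z : @gridix n kb k) bD (corner z) w.
have DD0 : 0 <= DD by apply: sumr_ge0 => z _; exact: bD_ge0.
have bw0 : 0 < b * w ^+ n by rewrite mulr_gt0// exprn_gt0.
have D1 : 0 < 2 * (DD + 1) by rewrite mulr_gt0// ltr_wpDl.
exists (b * w ^+ n / (2 * (DD + 1))); first by rewrite divr_gt0.
move=> h G' wg close.
pose sl := @slope R n C kb st k.
pose ctr := @gridctr R n kb k.
pose d z := \1_C (ctr z) * sl z `^ n%:R.
have sl0 z : 0 <= sl z by apply: slope_ge0; exact: (inv_ge1 ist).
have d0 z : 0 <= d z by rewrite mulr_ge0 ?powR_ge0.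
pose S := \sum_z d z * w ^+ n.
have fE : (\int[mu]_x (\1_(filled C kb st k) x * cweight C st n%:R x)%:E = S%:E)%E.
  apply: filled_integral => // [z x az /cube_sub_ccube hx|z nz].
    have [Ux sx _ Cx] := az _ hx; rewrite /cweight /d sx /sl slope_adm//; congr (_ * _).
    rewrite !indicE; congr (_%:R); congr nat_of_bool; apply/idP/idP => /set_mem H; apply/mem_set.
      by apply/Cx; case: H.
    by split=> //; exact/Cx.
  by rewrite /d /sl slope_nadm// powR0 ?mulr0// gt_eqF.
rewrite fE in half.
pose g0 : V -> R := (fun x => G' x j0 j0) \_ Omega.
pose P z := `[< adm C st z /\ C (ctr z) >].
have Pn z : ~~ P z -> d z = 0.
  move=> /asboolPn nP; rewrite /d /sl; case: (pselect (adm C st z)) => az.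
    by rewrite indicE memNset ?mul0r// => Cz; apply: nP.
  by rewrite slope_nadm// powR0 ?mulr0// gt_eqF.
pose Y z := (\int[mu]_x ((P z)%:R * (`|g0 x| `^ n%:R * \1_(cube (corner z) w : set (Rn R n)) x))%:E)%E.
have Yz z : (((b / 4) ^+ n * (d z * w ^+ n))%:E <= Y z)%E.
  have [Pz|nP] := boolP (P z); last first.
    rewrite Pn// mul0r mulr0; apply: integral_ge0 => x _.
    by rewrite lee_fin !mulr_ge0// powR_ge0.
  have [az Cz] : adm C st z /\ C (ctr z) by apply/asboolP.
  rewrite /Y Pz; under eq_integral do rewrite mul1r.
  have sc := inv_ge1 ist (ctr z).
  have -> : d z = ss st (ctr z) ^+ n.
    by rewrite /d indicE mem_set// mul1r /sl slope_adm// powR_mulrn// (le_trans ler01).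
  rewrite mulrA.
  apply: (@cube_gradient_Ln (corner z) w (ss st (ctr z)) (b * w ^+ n / (2 * (DD + 1))) h G') => //.
  - move=> y /az[Uy sy _ _]; split; first exact: (inv_sub ist).
    by rewrite (inv_GU ist Uy) mxE eqxx mulr1n.
  - have : bD (corner z) w <= DD + 1.
      rewrite /DD (bigD1 z)//= -addrA lerDl addr_ge0// sumr_ge0// => y _; exact: bD_ge0.
    rewrite mulrAC ler_pdivrMr// => h1; rewrite -/b.
    have -> : b * w ^+ n / 2 * (2 * (DD + 1)) = b * w ^+ n * (DD + 1) by field.
    by rewrite ler_wpM2l// ltW.
have mO : measurable (Omega : set (Rn R n)) by exact: open_measurable_Rn.
have mG : measurable_fun (Omega : set (Rn R n)) (fun x : Rn R n => G' x j0 j0).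
  by have [_ /(_ j0 j0)[]] := wg.
have mg0 : measurable_fun setT (g0 : Rn R n -> R) by apply/(measurable_restrictT _ mO).
have mterm z : measurable_fun setT (fun x : Rn R n =>
    ((P z)%:R * (`|g0 x| `^ n%:R * \1_(cube (corner z) w : set (Rn R n)) x))%:E).
  apply/measurable_EFinP; apply: measurable_funM; first exact: measurable_cst.
  apply: measurable_funM; last by apply: measurable_indic; exact: measurable_cube.
  by apply: (measurableT_comp (measurable_powR _)); exact: measurableT_comp.
have term0 z (x : Rn R n) : setT x ->
    (0 <= ((P z)%:R * (`|g0 x| `^ n%:R * \1_(cube (corner z) w : set (Rn R n)) x))%:E)%E.
  by move=> _; rewrite lee_fin !mulr_ge0// powR_ge0.
apply: (@le_trans _ _ (\sum_z Y z)%E).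
  apply: (@le_trans _ _ ((b / 4) ^+ n * S)%:E).
    rewrite /lsc_const -/b.
    have c0 : (0 <= ((b / 4) ^+ n / 2)%:E)%E by rewrite lee_fin divr_ge0// exprn_ge0// divr_ge0// ltW.
    apply: (le_trans (lee_wpmul2l c0 half)).
    by rewrite -!EFinM lee_fin; have -> : (b / 4) ^+ n / 2 * (2 * S) = (b / 4) ^+ n * S by field.
  by rewrite /S mulr_sumr -sumEFin; apply: lee_sum => z _.
rewrite /Y -(ge0_integral_sum _ measurableT mterm term0) [leRHS]integral_mkcond.
have mGC : measurable_fun setT ((fun x : Rn R n => (`|G' x j0 j0| `^ n%:R)%:E) \_ (C : set (Rn R n))).
  apply/(measurable_restrictT _ mC); apply: (measurable_funS mO CO).
  apply/measurable_EFinP; apply: (measurableT_comp (measurable_powR _)).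
  exact: measurableT_comp.
apply: ge0_le_integral => //.
- by move=> x _; apply: sume_ge0 => z _; exact: term0.
- exact: emeasurable_sum.
- move=> x _; rewrite sumEFin.
  case: (pselect (exists2 z, P z & cube (corner z) w x)) => [[z Pz xz]|nx].
    have [az Cz] : adm C st z /\ C (ctr z) by apply/asboolP.
    have [_ _ _ Cx] := az _ (cube_sub_ccube xz).
    have {}Cx : C x by apply/Cx.
    rewrite /patch mem_set// lee_fin (bigD1 z)//= big1 ?addr0; last first.
      move=> y yz; rewrite indicE memNset ?mulr0// => xy.
      by move/eqP: yz; apply; exact: cube_corner_inj xy xz.
    by rewrite Pz mul1r indicE (mem_set xz) mulr1 /g0 /patch mem_set//; exact: CO.
  rewrite big1; first by rewrite /patch; case: ifP => // _; rewrite lee_fin powR_ge0.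
  move=> z _; rewrite /P; case: asboolP => [H|_]; last by rewrite mul0r.
  by rewrite indicE memNset ?mulr0// => xz; apply: nx; exists z => //; exact/asboolP.
Qed.

End lower_semicontinuity.

(** * The limit map, its weak gradient and its energy *)

Section limit.
Context {R : realType} {n : nat}.
Local Notation V := 'rV[R]_n.
Local Notation mu := (@leb R n).
Variables (Omega C : set V) (kb : nat) (K p kap B0 : R) (X : nat -> state R n) (D : nat -> R).
Hypotheses (Okb : Omega `<=` @cubek R n kb) (n1 : (1 < n)%N) (oO : open Omega).
Hypotheses (p1 : 1 < p) (kap1 : kap < 1) (B01 : 1 <= B0).
Hypothesis hinv : forall k, stinv Omega C K (X k).
Hypothesis hD0 : forall k, 0 < D k.
Hypothesis hDS : forall k, D k.+1 <= D k / 2.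
Hypothesis hclose : forall k x i, `|sf (X k.+1) x 0 i - sf (X k) x 0 i| <= D k / 2.
Hypothesis hU : forall k, sU (X k.+1) `<=` sU (X k).
Hypothesis hG : forall k x, ~ sU (X k) x -> sG (X k.+1) x = sG (X k) x.
Hypothesis hB : forall k x i j, sU (X k) x -> ~ sU (X k.+1) x ->
  `|sG (X k.+1) x i j| <= B0 * ss (X k) x.
Hypothesis hdec : forall k, (\int[mu]_x (weight (X k.+1) p x)%:E <=
  kap%:E * \int[mu]_x (weight (X k) p x)%:E)%E.
Hypothesis hG0 : forall x, ~ sU (X 0%N) x -> sG (X 0%N) x = 1%:M.

Let mO : measurable (Omega : set (Rn R n)). Proof. exact: open_measurable_Rn. Qed.
Let p0 : 0 < p. Proof. exact: lt_trans p1. Qed.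
Let Ofin : (mu Omega < +oo)%E.
Proof.
apply: le_lt_trans (@leb_cubek_lty R n kb); apply: le_measure => //; rewrite inE//.
exact: measurable_cubek.
Qed.

Let lo k (x : V) i := sf (X k) x 0 i - D k.
Let hi k (x : V) i := sf (X k) x 0 i + D k.

Lemma lo_nd x i k m : lo k x i <= lo (k + m)%N x i.
Proof.
elim: m => [|m IH]; first by rewrite addn0.
rewrite (le_trans IH)// addnS /lo; have := hclose (k + m)%N x i; have := hDS (k + m)%N.
by rewrite ler_norml => h /andP[h1 h2]; lra.
Qed.

Lemma hi_ni x i k m : hi (k + m)%N x i <= hi k x i.
Proof.
elim: m => [|m IH]; first by rewrite addn0.
apply: le_trans IH; rewrite addnS /hi; have := hclose (k + m)%N x i; have := hDS (k + m)%N.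
by rewrite ler_norml => h /andP[h1 h2]; lra.
Qed.

Lemma lo_hi x i k m : lo k x i <= hi m x i.
Proof.
apply: (le_trans (lo_nd x i k m)); apply: (@le_trans _ _ (hi (k + m)%N x i)).
  by rewrite /lo /hi; have := hD0 (k + m)%N; lra.
by rewrite addnC; exact: hi_ni.
Qed.

Definition flim (x : V) : V := \row_i sup (range (fun k => lo k x i)).

Lemma flim_close k x i : `|flim x 0 i - sf (X k) x 0 i| <= D k.
Proof.
have ub m : ubound (range (fun k => lo k x i)) (hi m x i) by move=> _ [j _ <-]; exact: lo_hi.
have h1 : flim x 0 i <= hi k x i by rewrite mxE; apply: ge_sup => //; exists (lo 0 x i); exists 0%N.
have h2 : lo k x i <= flim x 0 i.
  by rewrite mxE; apply: ub_le_sup; [exists (hi 0 x i); exact: ub|exists k].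
by move: h1 h2; rewrite /lo /hi ler_norml => h1 h2; apply/andP; split; lra.
Qed.

Lemma D_small (e : R) : 0 < e -> exists k, D k < e.
Proof.
move=> e0; have hk k : D k <= D 0%N / k.+1%:R.
  elim: k => [|k IH]; first by rewrite divr1.
  apply: (le_trans (hDS k)); apply: (@le_trans _ _ (D 0%N / k.+1%:R / 2)).
    by rewrite ler_pM2r.
  rewrite -mulrA -invfM ler_pM2l// lef_pV2 ?posrE ?mulr_gt0// -natrM ler_nat.
  by rewrite muln2 -addnn addSn addnS !ltnS leq_addr.
exists (Num.truncn (D 0%N / e)); apply: (le_lt_trans (hk _)).
by rewrite ltr_pdivrMr// mulrC -ltr_pdivrMr// truncnS_gt.
Qed.

Lemma flim_cont i : continuous (fun x => flim x 0 i).
Proof.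
move=> x; apply/(@cvgrPdist_le _ _ _ _ (nbhs_filter x)) => e e0.
have e3 : 0 < e / 3 by rewrite divr_gt0.
have [k hk] := D_small e3.
have cu : continuous (fun x => sf (X k) x 0 i) by exact: (inv_cont (hinv k)).
have h : \forall y \near x, `|sf (X k) x 0 i - sf (X k) y 0 i| <= e / 3.
  by have /(@cvgrPdist_le _ _ _ _ (nbhs_filter x)) := cu x; exact.
apply: filterS h => y hy.
have := flim_close k x i; have := flim_close k y i.
move: hy; rewrite !ler_norml => /andP[? ?] /andP[? ?] /andP[? ?].
by apply/andP; split; lra.
Qed.

Lemma flim_continuous : continuous flim.
Proof.
move=> x; apply/(@cvg_ballP _ _ _ _ (nbhs_filter x)) => e e0.
have h : \forall y \near x, forall i, `|flim x 0 i - flim y 0 i| < e.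
  apply: (@filter_forall V 'I_n (fun i y => `|flim x 0 i - flim y 0 i| < e) (nbhs x)) => i.
  by have /(@cvgrPdist_lt _ _ _ _ (nbhs_filter x)) := @flim_cont i x; exact.
by apply: filterS h => y hy; exact/ball_rVP.
Qed.

Lemma sU_nonincr k m x : sU (X (k + m)%N) x -> sU (X k) x.
Proof. by elim: m => [|m IH]; rewrite ?addn0// addnS => /hU/IH. Qed.

Lemma sG_stab k m x : ~ sU (X k) x -> sG (X (k + m)%N) x = sG (X k) x.
Proof.
move=> nU; elim: m => [|m IH]; first by rewrite addn0.
by rewrite addnS hG// => /sU_nonincr.
Qed.

(** The gradient at a finished point never changes again, so any finished stage gives the same
    value. Points that are never finished form a null set and receive 0. *)
Definition Glim (x : V) : 'M[R]_n :=
  match pselect (exists k, ~ sU (X k) x) with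
  | left e => sG (X (projT1 (cid e))) x
  | right _ => 0
  end.

Lemma GlimE k x : ~ sU (X k) x -> Glim x = sG (X k) x.
Proof.
move=> nU; rewrite /Glim; case: pselect => [e|H]; last by exfalso; apply: H; exists k.
case: (cid e) => m /= nm.
by rewrite -(sG_stab m nU) -(sG_stab k nm) addnC.
Qed.

Lemma Glim0 x : (forall k, sU (X k) x) -> Glim x = 0.
Proof. by move=> h; rewrite /Glim; case: pselect => // -[k]; have := h k. Qed.

(** The choice inside [Glim] hides measurability; it is recovered from the pointwise limit of the
    stage gradients cut off to the finished sets. *)
Lemma mGlim i j : measurable_fun setT ((fun x => Glim x i j) : Rn R n -> R).
Proof.
pose H k (x : Rn R n) : R := sG (X k) x i j * \1_(~` sU (X k) : set (Rn R n)) x.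
apply: (measurable_fun_cvg (h := H)) => [k|x _].
  apply: measurable_funM; first exact: (inv_mG (hinv k)).
  apply: measurable_indic; apply: measurableC; apply: open_measurable_Rn.
  exact: open_sU (inv_loc (hinv k)).
case: (pselect (exists k, ~ sU (X k) x)) => [[k nk]|H0].
  rewrite (GlimE nk); apply: cvg_near_cst; exists k => // m /= km.
  have nm : ~ sU (X m) x by rewrite -(subnKC km) => /sU_nonincr.
  by rewrite /H indicE mem_set// mulr1 -(subnKC km) sG_stab.
have allU k : sU (X k) x by apply: contrapT => nk; apply: H0; exists k.
rewrite Glim0// mxE; apply: cvg_near_cst; exists 0%N => // m _.
by rewrite /H indicE memNset ?mulr0// => /(_ (allU m)).
Qed.

(** Source of one integrable majorant for all stages and the limit: a point finished at step [k] has
    gradient at most [B0] times its slope at stage [k], and geometric decay makes the sum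
    integrable. *)
Definition Ssum (x : Rn R n) : \bar R := (\sum_(k <oo) (weight (X k) p x)%:E)%E.

Let w_ge0 k x : (0 <= (weight (X k) p x)%:E)%E. Proof. by rewrite lee_fin weight_ge0. Qed.

Let mw k : measurable_fun setT (fun x : Rn R n => (weight (X k) p x)%:E).
Proof.
apply/measurable_EFinP; exact: (measurable_weight (inv_loc (hinv k)) (inv_ms (hinv k))).
Qed.

Lemma Ssum_ge k x : ((weight (X k) p x)%:E <= Ssum x)%E.
Proof.
apply: (@le_trans _ _ (\sum_(0 <= i < k.+1) (weight (X i) p x)%:E)%E).
  by rewrite big_nat_recr//= leeDr// sume_ge0.
by apply: nneseries_lim_ge => i _ _; exact: w_ge0.
Qed.

Lemma Ssum_ge0 x : (0 <= Ssum x)%E. Proof. exact: le_trans (w_ge0 0 x) (Ssum_ge 0 x). Qed.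

Let a k : R := fine (\int[mu]_x (weight (X k) p x)%:E).
Let aE k : (\int[mu]_x (weight (X k) p x)%:E = (a k)%:E)%E.
Proof.
rewrite /a fineK//; apply: integrable_fin_num => //.
exact: (inv_weight_integrable Okb (hinv k) (ltW p0)).
Qed.
Let a_ge0 k : 0 <= a k.
Proof. by apply: fine_ge0; apply: integral_ge0 => x _; exact: w_ge0. Qed.

(** The decay in the form [(1 - kap) a_k <= a_k - a_(k+1)], which telescopes. *)
Lemma sum_a m : (1 - kap) * (\sum_(0 <= k < m) a k) <= a 0%N - a m.
Proof.
elim: m => [|m IH]; first by rewrite big_geq// mulr0 subrr.
rewrite big_nat_recr//= mulrDr; have := hdec m; rewrite !aE -EFinM lee_fin; lra.
Qed.

Let M := a 0%N / (1 - kap).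
Lemma sum_a_le m : \sum_(0 <= k < m) a k <= M.
Proof.
rewrite /M ler_pdivlMr ?subr_gt0// mulrC (le_trans (sum_a m))//.
by rewrite gerBl.
Qed.

Lemma integral_Ssum : (\int[mu]_x Ssum x <= M%:E)%E.
Proof.
rewrite /Ssum integral_nneseries//; apply: lime_le.
  by apply: is_cvg_nneseries => k _ _; apply: integral_ge0 => x _; exact: w_ge0.
apply: nearW => m; under eq_bigr do rewrite aE.
by rewrite sumEFin lee_fin sum_a_le.
Qed.

Lemma mSsum : measurable_fun setT Ssum.
Proof.
apply: ge0_emeasurable_sum => // k x _ _; exact: w_ge0.
Qed.

(** Slopes are at least 1, so the measure of this set is at most [a k] for every [k]. If it were
    positive, the partial sums of the [a k] would exceed [M]. *)
Lemma null_cap : mu.-negligible ([set x | forall k, sU (X k) x] : set (Rn R n)).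
Proof.
have mU k : measurable (sU (X k) : set (Rn R n)).
  by apply: open_measurable_Rn; exact: open_sU (inv_loc (hinv k)).
have E : [set x | forall k, sU (X k) x] = \bigcap_k sU (X k).
  by apply/seteqP; split => x h k //; exact: h.
have mN : measurable ([set x | forall k, sU (X k) x] : set (Rn R n)).
  by rewrite E; apply: bigcapT_measurable.
apply/(negligibleP mu mN).
pose v := mu ([set x | forall k, sU (X k) x] : set (Rn R n)).
suff v00 : v = 0%E by exact: v00.
have va k : (v <= (a k)%:E)%E.
  rewrite -aE.
  have -> : v = (\int[mu]_x (\1_([set x | forall k, sU (X k) x] : set (Rn R n)) x)%:E)%E.
    by rewrite integral_indic// setIT.
  apply: ge0_le_integral => //.
  - by apply/measurable_EFinP; exact: measurable_indic.
  - move=> x _; rewrite lee_fin indicE; case: (pselect (forall k, sU (X k) x)) => h; last first.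
      by rewrite memNset// weight_ge0.
    rewrite mem_set// /weight indicE (mem_set (h k)) mul1r.
    have s1 := inv_ge1 (hinv k) x.
    by rewrite -[leLHS](powRr0 (ss (X k) x)) ler_powR// ltW.
have vf : v \is a fin_num.
  by rewrite ge0_fin_numE ?measure_ge0// (le_lt_trans (va 0%N))// ltry.
have v0 : 0 <= fine v by apply: fine_ge0; exact: measure_ge0.
have key m : fine v * m%:R <= M.
  apply: le_trans (sum_a_le m); rewrite mulr_natr -[m in _ *+ m]subn0 -sumr_const_nat.
  by apply: ler_sum => k _; rewrite -lee_fin fineK.
rewrite -(fineK vf); congr EFin; apply/eqP; rewrite eq_le v0 andbT leNgt; apply/negP => vp.
have := key (Num.truncn (M / fine v)).+1; rewrite leNgt mulrC -ltr_pdivrMr// truncnS_gt//.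
Qed.

(** Descent to the last stage at which the point was still unfinished: the bound comes from the step
    that finished it. Points outside the initial unfinished set keep the identity matrix. *)
Lemma Glim_cases x : Omega x ->
  [\/ forall i j, `|Glim x i j| <= 1,
      exists k, sU (X k) x /\ forall i j, `|Glim x i j| <= B0 * ss (X k) x |
      forall k, sU (X k) x].
Proof.
move=> Ox; case: (pselect (exists k, ~ sU (X k) x)) => [[k nk]|H0]; last first.
  by constructor 3 => k; apply: contrapT => nk; apply: H0; exists k.
elim: k nk => [|k IH] nk.
  constructor 1 => i j; rewrite (GlimE nk) hG0// mxE.
  by case: (i == j); rewrite ?normr1 ?normr0.
case: (pselect (sU (X k) x)) => Uk; last exact: IH.
by constructor 2; exists k; split=> // i j; rewrite (GlimE nk); exact: hB.
Qed.

Lemma weightU k x : sU (X k) x -> weight (X k) p x = ss (X k) x `^ p.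
Proof. by move=> h; rewrite /weight indicE mem_set// mul1r. Qed.

Lemma ss_le_weight k x : sU (X k) x -> ss (X k) x <= weight (X k) p x.
Proof.
move=> h; rewrite weightU//; have s1 := inv_ge1 (hinv k) x.
by rewrite -[leLHS]powRr1 ?(le_trans ler01)// ler_powR// ltW.
Qed.

Lemma Glim_le x i j : Omega x -> (`|Glim x i j|%:E <= 1 + B0%:E * Ssum x)%E.
Proof.
move=> Ox; have B00 := le_trans ler01 B01; have S0 := Ssum_ge0 x.
have BS : (0 <= B0%:E * Ssum x)%E by rewrite mule_ge0// lee_fin.
have [h|[k [Uk h]]|h] := Glim_cases Ox.
- by apply: (@le_trans _ _ 1%E); [rewrite lee_fin|rewrite leeDl].
- apply: (@le_trans _ _ (B0%:E * (weight (X k) p x)%:E)%E).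
    by rewrite -EFinM lee_fin (le_trans (h i j))// ler_wpM2l// ss_le_weight.
  apply: (@le_trans _ _ (B0%:E * Ssum x)%E); last by rewrite leeDr.
  by apply: lee_wpmul2l; [rewrite lee_fin|exact: Ssum_ge].
- by rewrite Glim0// mxE normr0 adde_ge0.
Qed.

Lemma Glim_powR_le x i j : Omega x ->
  ((`|Glim x i j| `^ p)%:E <= 1 + (B0 `^ p)%:E * Ssum x)%E.
Proof.
move=> Ox; have B00 := le_trans ler01 B01; have S0 := Ssum_ge0 x.
have BS : (0 <= (B0 `^ p)%:E * Ssum x)%E by rewrite mule_ge0// lee_fin powR_ge0.
have [h|[k [Uk h]]|h] := Glim_cases Ox.
- apply: (@le_trans _ _ 1%E); last by rewrite leeDl.
  rewrite lee_fin; apply: (@le_trans _ _ (1 `^ p)); last by rewrite powR1.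
  by apply: ge0_ler_powR; rewrite ?nnegrE//; exact: ltW.
- have s0 : 0 <= ss (X k) x by rewrite (le_trans ler01)//; exact: (inv_ge1 (hinv k)).
  apply: (@le_trans _ _ ((B0 `^ p)%:E * (weight (X k) p x)%:E)%E).
    rewrite -EFinM lee_fin weightU// -powRM//.
    by apply: ge0_ler_powR; rewrite ?nnegrE ?mulr_ge0// ltW.
  apply: (@le_trans _ _ ((B0 `^ p)%:E * Ssum x)%E); last by rewrite leeDr.
  by apply: lee_wpmul2l; [rewrite lee_fin powR_ge0|exact: Ssum_ge].
- by rewrite Glim0// mxE normr0 powR0 ?gt_eqF// adde_ge0.
Qed.

Lemma integrable_Ssum (c : R) : 0 <= c -> mu.-integrable Omega (fun x => 1 + c%:E * Ssum x)%E.
Proof.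
move=> c0; apply: integrableD => //.
  apply/integrableP; split; first exact: measurable_cst.
  by under eq_integral do rewrite /= normr1; rewrite integral_cst// mul1e.
apply: integrableZl => //; apply: (integrableS measurableT) => //.
apply/integrableP; split; first exact: mSsum.
under eq_integral do rewrite gee0_abs ?Ssum_ge0//.
by rewrite (le_lt_trans integral_Ssum)// ltry.
Qed.

Lemma Glim_Lp i j : Lp Omega p (fun x => Glim x i j).
Proof.
split; first by apply: measurable_funS (mGlim i j).
have /integrableP[mS fS] := integrable_Ssum (powR_ge0 B0 p).
apply: le_lt_trans fS; apply: ge0_le_integral => //.
- apply/measurable_EFinP; apply: (measurableT_comp (measurable_powR _)).
  by apply: measurableT_comp => //; apply: measurable_funS (mGlim i j).
- exact: measurableT_comp.
- by move=> x Ox; rewrite (le_trans (Glim_powR_le _ _ Ox))// lee_abs.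
Qed.

Lemma Glim_L1loc i j : Lp_loc Omega 1 (fun x => Glim x i j).
Proof.
split; first by apply: measurable_funS (mGlim i j).
move=> A cA AO.
have mA : measurable (A : set (Rn R n)).
  by apply: closed_measurable_Rn; apply: compact_closed => //; exact: norm_hausdorff.
have /integrableP[mS fS] := integrable_Ssum (le_trans ler01 B01).
have mG1 (Q : set (Rn R n)) : measurable Q ->
    measurable_fun Q (fun x : Rn R n => (`|Glim x i j| `^ 1)%:E).
  move=> mQ; apply/measurable_EFinP; apply: (measurableT_comp (measurable_powR _)).
  by apply: measurableT_comp => //; apply: measurable_funS (mGlim i j).
apply: le_lt_trans fS; apply: (@le_trans _ _ (\int[mu]_(x in Omega) (`|Glim x i j| `^ 1)%:E)%E).
  apply: ge0_subset_integral => //; first exact: mG1.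
apply: ge0_le_integral => //.
- exact: mG1.
- exact: measurableT_comp.
- move=> x Ox; rewrite powRr1//.
  by rewrite (le_trans (Glim_le _ _ Ox))// lee_abs.
Qed.


Lemma test_partial_out (phi : V -> R) (j : 'I_n) x : test_fun Omega phi -> ~ Omega x ->
  phi x = 0 /\ partial j phi x = 0.
Proof.
move=> [_ [A [cA AO phi0]]] nx.
have nA : ~ A x by move=> /AO.
split; first exact: phi0.
have oA : open (~` A) by rewrite openC; apply: compact_closed => //; exact: norm_hausdorff.
have near0 : \forall y \near x, phi y = (cst 0 : V -> R) y.
  have : nbhs x (~` A) by rewrite openE in oA; exact: oA.
  by apply: filterS => y; exact: phi0.
by rewrite /partial (near_eq_derive _ near0) derive_cst.
Qed.

Lemma integral_Omega (F : Rn R n -> \bar R) : (forall x, ~ Omega x -> F x = 0%E) ->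
  (\int[mu]_(x in (Omega : set (Rn R n))) F x = \int[mu]_x F x)%E.
Proof.
move=> F0; rewrite integral_mkcond; apply: eq_integral => x _; rewrite /patch.
by case: ifPn => // /negP; rewrite inE => /F0.
Qed.

Lemma D_cvg0 : D @ \oo --> (0 : R).
Proof.
apply/cvgrPdist_le => e e0; have [k hk] := D_small e0; exists k => // m /= km.
rewrite sub0r normrN gtr0_norm// (le_trans _ (ltW hk))//.
rewrite -(subnKC km); elim: (m - k)%N => [|q IH]; first by rewrite addn0.
rewrite addnS (le_trans (hDS _))// (le_trans _ IH)//; have := hD0 (k + q)%N; lra.
Qed.

Lemma D_le0 k : D k <= D 0%N.
Proof.
elim: k => // k IH; rewrite (le_trans (hDS k))// (le_trans _ IH)//; have := hD0 k; lra.
Qed.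

Lemma continuous_Lp_loc (g : V -> R) q : continuous g -> 0 < q -> Lp_loc Omega q g.
Proof.
move=> cg q0; split; first exact: continuous_measurable_Rn.
move=> A cA AO; have [M1 hM1] := continuous_bounded_compact cg cA.
have mA : measurable (A : set (Rn R n)).
  by apply: closed_measurable_Rn; apply: compact_closed => //; exact: norm_hausdorff.
apply: (@le_lt_trans _ _ (\int[mu]_(x in (A : set (Rn R n))) cst (`|M1| `^ q)%:E x)%E).
  apply: ge0_le_integral => //.
  - apply/measurable_EFinP; apply: (measurableT_comp (measurable_powR _)).
    by apply: measurableT_comp => //; exact: continuous_measurable_Rn.
  - move=> x Ax; rewrite lee_fin; apply: ge0_ler_powR; rewrite ?nnegrE//; first exact: ltW.
    by rewrite (le_trans (hM1 _ Ax))// ler_norm.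
rewrite integral_cst// lte_mul_pinfty ?lee_fin ?powR_ge0//.
apply: le_lt_trans Ofin; apply: le_measure; rewrite ?inE//.
Qed.

(** Every stage is Lipschitz and satisfies the identity. The left sides converge because the maps
    converge uniformly, the right sides because the gradients stabilise off a null set under the
    majorant built from [Ssum]. *)
Lemma flim_ibp (phi : V -> R) i j : test_fun Omega phi ->
  (\int[mu]_(x in (Omega : set (Rn R n))) (flim x 0 i * partial j phi x)%:E =
   - \int[mu]_(x in (Omega : set (Rn R n))) (Glim x i j * phi x)%:E)%E.
Proof.
move=> tphi; have [k0 [M1 [_ hM1]]] := test_fun_bounds j tphi.
have M10 : 0 <= M1 by rewrite (le_trans (normr_ge0 (phi 0)))//; exact: (hM1 0).1.
have [sphi _] := tphi; have [cphi _] := sphi [::]; have [cdphi _] := sphi [:: j].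
have cf := @flim_cont i.
have [Mf hMf] := continuous_bounded_compact cf (@compact_cubek R n kb).
pose A k (x : Rn R n) := (sf (X k) x 0 i * partial j phi x)%:E.
pose B k (x : Rn R n) := (sG (X k) x i j * phi x)%:E.
have cu k : continuous (fun x => sf (X k) x 0 i) by exact: (inv_cont (hinv k)).
have mct (h : V -> R) : continuous h -> measurable_fun (Omega : set (Rn R n)) (h : Rn R n -> R).
  by move=> ch; exact: continuous_measurable_Rn.
have AB k : (\int[mu]_(x in (Omega : set (Rn R n))) A k x =
    - \int[mu]_(x in (Omega : set (Rn R n))) B k x)%E.
  have [L hL] := inv_lip (hinv k).
  have ad : ae_in setT (fun x => is_derive x (ej R j) (fun y => sf (X k) y 0 i) (sG (X k) x i j)).
    by apply: negligibleS (inv_der (hinv k)) => x [_ nx]; split=> // H; apply: nx; exact: H.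
  have [_ E] := ibp_lipschitz (cu k) (inv_mG (hinv k) i j) (hL i j) ad tphi.
  rewrite !integral_Omega//; first by move=> x nx; rewrite /B (test_partial_out j tphi nx).1 mulr0.
  by move=> x nx; rewrite /A (test_partial_out j tphi nx).2 mulr0.
have mA k : measurable_fun (Omega : set (Rn R n)) (A k).
  by apply/measurable_EFinP; apply: mct; exact: mul_continuous_fun.
have mA' : measurable_fun (Omega : set (Rn R n)) (fun x : Rn R n => (flim x 0 i * partial j phi x)%:E).
  by apply/measurable_EFinP; apply: mct; exact: mul_continuous_fun.
have mB k : measurable_fun (Omega : set (Rn R n)) (B k).
  apply/measurable_EFinP; apply: measurable_funM; last exact: mct.
  by apply: measurable_funS (inv_mG (hinv k) i j).
have mB' : measurable_fun (Omega : set (Rn R n)) (fun x : Rn R n => (Glim x i j * phi x)%:E).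
  apply/measurable_EFinP; apply: measurable_funM; last exact: mct.
  by apply: measurable_funS (mGlim i j).
have cvgA : {ae mu, forall x, (Omega : set (Rn R n)) x -> A ^~ x @ \oo --> (flim x 0 i * partial j phi x)%:E}.
  apply: aeW => x _; apply: cvg_EFin; first by apply: nearW.
  apply: cvgM; last exact: cvg_cst.
  apply/cvgrPdist_le => e e0; have /cvgrPdist_le/(_ e e0) := D_cvg0.
  apply: filterS => k; rewrite sub0r normrN gtr0_norm//; apply: le_trans.
  exact: flim_close.
have cvgB : {ae mu, forall x, (Omega : set (Rn R n)) x -> B ^~ x @ \oo --> (Glim x i j * phi x)%:E}.
  have [Z [mZ Z0 sZ]] := null_cap; exists Z; split=> // x /= nx; apply: sZ => k.
  apply: contrapT => nk; apply: nx => _; apply: cvg_near_cst; exists k => // m /= km.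
  by rewrite /B (GlimE nk) -(subnKC km) sG_stab.
have domA : {ae mu, forall x k, (Omega : set (Rn R n)) x -> `|A k x| <= cst ((`|Mf| + D 0%N) * M1)%:E x}%E.
  apply: aeW => x k Ox; rewrite lee_fin normrM ler_pM//; last exact: (hM1 x).2.
  have := flim_close k x i; have := hMf _ (Okb Ox); have := D_le0 k; have := ler_norm Mf.
  by rewrite !ler_norml => ? ? /andP[? ?] /andP[? ?]; apply/andP; split; lra.
have B00 := le_trans ler01 B01.
have domB : {ae mu, forall x k, (Omega : set (Rn R n)) x -> `|B k x| <= M1%:E * (1 + B0%:E * Ssum x)}%E.
  apply: aeW => x k Ox; rewrite /B [`|_|%E]/= mulrC normrM EFinM.
  have S0 := Ssum_ge0 x.
  have BS : (0 <= B0%:E * Ssum x)%E by rewrite mule_ge0// lee_fin.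
  apply: lee_pmul; rewrite ?lee_fin//; first exact: (hM1 x).1.
  (* A finished point already has its final gradient. At an unfinished one the entries are bounded
     by the slope, hence by its p-th power, as the slope is at least 1 and [p > 1]. *)
  case: (pselect (sU (X k) x)) => Uk; last by rewrite -(GlimE Uk); exact: Glim_le.
  have sk := inv_ge1 (hinv k) x.
  apply: (@le_trans _ _ (B0%:E * Ssum x)%E); last by rewrite leeDr.
  apply: (@le_trans _ _ (1%E * (weight (X k) p x)%:E)%E); last first.
    by apply: lee_pmul => //; exact: Ssum_ge.
  rewrite mul1e lee_fin (le_trans _ (ss_le_weight Uk))// (inv_GU (hinv k) Uk) mxE.
  by case: (i == j); rewrite ?mulr1n ?mulr0n ?normr0 ?(le_trans ler01)// ger0_norm// (le_trans ler01).
have ic : mu.-integrable (Omega : set (Rn R n)) (cst ((`|Mf| + D 0%N) * M1)%:E).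
  apply/integrableP; split; first exact: measurable_cst.
  under eq_integral do rewrite /=.
  rewrite integral_cst//= lte_mul_pinfty// lee_fin//.
have iS := integrableZl mO M1 (integrable_Ssum B00).
have [_ _ cA] := dominated_convergence mO mA mA' cvgA ic domA.
have [_ _ cB] := dominated_convergence mO mB mB' cvgB iS domB.
have cNB := cvgeN cB.
apply: (cvg_unique _ cA); first exact: ereal_hausdorff.
rewrite (_ : (fun k => _) = (fun k => - \int[mu]_(x in (Omega : set (Rn R n))) B k x)%E); first exact: cNB.
by apply/funext => k; exact: AB.
Qed.

Lemma flim_weak : weak_gradient Omega flim Glim.
Proof.
split; [|exact: Glim_L1loc|by move=> phi tphi i j; exact: flim_ibp].
by move=> i; apply: continuous_Lp_loc; [exact: flim_cont|exact: ltr01].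
Qed.

Lemma flim_bounded i : exists2 M1, 0 <= M1 & forall x, Omega x -> `|flim x 0 i| <= M1.
Proof.
have [Mf hMf] := continuous_bounded_compact (@flim_cont i) (@compact_cubek R n kb).
by exists `|Mf| => // x /Okb/hMf h; rewrite (le_trans h)// ler_norm.
Qed.

Lemma flim_W1p : W1p Omega p flim.
Proof.
exists Glim; split; [exact: flim_weak| |exact: Glim_Lp].
move=> i; split; first by apply: continuous_measurable_Rn => //; exact: flim_cont.
have [M1 M10 hM1] := flim_bounded i.
apply: (@le_lt_trans _ _ (\int[mu]_(x in (Omega : set (Rn R n))) cst (M1 `^ p)%:E x)%E).
  apply: ge0_le_integral => //.
  - apply/measurable_EFinP; apply: (measurableT_comp (measurable_powR _)).
    by apply: measurableT_comp => //; apply: continuous_measurable_Rn => //; exact: flim_cont.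
  - move=> x Ox; rewrite lee_fin; apply: ge0_ler_powR; rewrite ?nnegrE//; [exact: ltW|exact: hM1].
by rewrite integral_cst// lte_mul_pinfty ?lee_fin ?powR_ge0.
Qed.

Lemma flim_Linf : Linf_vec Omega flim.
Proof.
move=> i; split; first by apply: continuous_measurable_Rn => //; exact: flim_cont.
have [M1 M10 hM1] := flim_bounded i; exists M1.
by apply: negligibleS (negligible_set0 _) => x [Ox]; apply; exact: hM1.
Qed.

Lemma Glim_good : ae_in Omega (fun x => \det (Glim x) <= 0 /\ distortion_le K (Glim x)).
Proof.
apply: negligibleS (negligibleU null_cap (negligible_bigcup (fun k => inv_good (hinv k)))) => x [Ox bad].
case: (pselect (forall k, sU (X k) x)) => h; first by left.
right; have [k nk] : exists k, ~ sU (X k) x.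
  by apply: contrapT => H; apply: h => k; apply: contrapT => nk; apply: H; exists k.
by exists k => //; split; [split|rewrite -(GlimE nk)].
Qed.

Lemma flim_weakly_qr : weakly_K_quasiregular Omega K flim.
Proof.
exists Glim; split; first exact: flim_weak.
  by right; apply: negligibleS Glim_good => x [Ox h]; split=> // -[].
by apply: negligibleS Glim_good => x [Ox h]; split=> // -[].
Qed.

Variables (j0 : 'I_n) (c0 : R).
Hypotheses (c00 : 0 < c0) (cC : compact C) (CO : C `<=` Omega).
Hypothesis hgrow : forall k, (3%:E * \int[mu]_x (cweight C (X k) n%:R x)%:E <=
  \int[mu]_x (cweight C (X k.+1) n%:R x)%:E)%E.
Hypothesis hE0 : (0 < \int[mu]_x (cweight C (X 0%N) n%:R x)%:E)%E.
Hypothesis hlsc : forall k h G', weak_gradient Omega h G' ->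
  (forall x, `|h x 0 j0 - sf (X k) x 0 j0| <= D k) ->
  (c0%:E * \int[mu]_x (cweight C (X k) n%:R x)%:E <=
   \int[mu]_(x in (C : set (Rn R n))) (`|G' x j0 j0| `^ n%:R)%:E)%E.

(** The limit is within [D k] of every stage, so the n-energy on [C] of any weak gradient of it is
    at least [c0] times the energy of each stage. These energies are unbounded, whereas W^{1,n}_loc
    would make the integral over the compact set [C] finite. *)
Lemma flim_not_qr : ~ quasiregular Omega flim.
Proof.
move=> [K' [_ [_ [G' [wg _ LG]]]]].
have [_ /(_ C cC CO) fin] := LG j0 j0.
pose E k := (\int[mu]_x (cweight C (X k) n%:R x)%:E)%E.
(* The tripling is weakened to linear growth, the form in which it is compared with a finite
   integral by the Archimedean property. *)
have E_ge k : (k%:R%:E * E 0%N <= E k)%E.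
  elim: k => [|k IH]; first by rewrite mul0e; exact: ltW.
  case: k IH => [|k] IH.
    rewrite mul1e (le_trans _ (hgrow 0%N))// -[leLHS]mul1e lee_wpmul2r ?lee_fin ?ler1n//; exact: ltW.
  apply: (le_trans _ (hgrow k.+1)); apply: (le_trans _ (lee_wpmul2l _ IH)) => //.
  rewrite muleA -EFinM lee_wpmul2r ?lee_fin ?(ltW hE0)// -natrM ler_nat.
  rewrite (leq_trans _ (leq_mul (isT : (2 <= 3)%N) (leqnn k.+1)))//.
  by rewrite mul2n -addnn addSn addnS !ltnS leq_addr.
have up k : (c0%:E * (k%:R%:E * E 0%N) <=
    \int[mu]_(x in (C : set (Rn R n))) (`|G' x j0 j0| `^ n%:R)%:E)%E.
  apply: le_trans (hlsc wg (fun x => flim_close k x j0)).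
  by apply: lee_wpmul2l; [rewrite lee_fin ltW|exact: E_ge].
move: fin; set I := (\int[mu]_(x in _) _)%E => fin.
have I0 : (0 <= I)%E by apply: integral_ge0 => x _; rewrite lee_fin powR_ge0.
have If : I \is a fin_num by rewrite ge0_fin_numE.
have Ef : E 0%N \is a fin_num.
  rewrite ge0_fin_numE ?(ltW hE0)// ltey; apply/eqP => Eoo.
  have := le_lt_trans (up 1%N) fin.
  by rewrite Eoo mul1e gt0_muley ?lte_fin// ltxx.
have e0 : 0 < fine (E 0%N) by rewrite -lte_fin fineK//; exact: hE0.
have := up (Num.truncn (fine I / (c0 * fine (E 0%N)))).+1.
rewrite -/I -(fineK If) -(fineK Ef) -!EFinM lee_fin leNgt mulrCA mulrC.
by rewrite mulrC -ltr_pdivrMr ?mulr_gt0// truncnS_gt.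
Qed.

End limit.

(** * Choice of the core ratio [lam] *)

Section scale_choice.
Context {R : realType}.
Variables (n : nat) (beta p th : R).

(** Both conditions concern [c^q lam^n = lam^(n - beta q)]. The exponent is [e1 > 0] for [q = p] and
    [-e2 < 0] for [q = n], so both hold for small [lam]; [l1] and [l2] are the two thresholds, and
    [1/2] ensures [lam < 1]. *)
Lemma exists_lam : (0 < n)%N -> 1 < beta -> 0 < th -> beta * p < n%:R -> exists lam : R,
  [/\ 0 < lam, lam < 1, cfac lam beta `^ p * lam ^+ n <= th / 2 &
      6 <= cfac lam beta `^ n%:R * lam ^+ n * th].
Proof.
move=> n0 b1 th0 bp; have nR : 0 < n%:R :> R by rewrite ltr0n.
pose e1 := n%:R - beta * p; pose e2 := (beta - 1) * n%:R.
have e10 : 0 < e1 by rewrite subr_gt0.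
have e20 : 0 < e2 by rewrite mulr_gt0// subr_gt0.
pose l1 := (th / 2) `^ e1^-1; pose l2 := (th / 6) `^ e2^-1.
have l10 : 0 < l1 by rewrite powR_gt0// divr_gt0.
have l20 : 0 < l2 by rewrite powR_gt0// divr_gt0.
pose lam := Num.min 2^-1 (Num.min l1 l2).
have lam0 : 0 < lam by rewrite !lt_min invr_gt0 ltr0n l10 l20.
have lam_l1 : lam <= l1 by rewrite /lam !ge_min lexx orbT.
have lam_l2 : lam <= l2 by rewrite /lam !ge_min lexx !orbT.
have pw (q e l : R) : 0 < e -> 0 < q -> l = q `^ e^-1 -> lam <= l -> lam `^ e <= q.
  move=> e0 q0 -> h; apply: (@le_trans _ _ ((q `^ e^-1) `^ e)).
    by apply: ge0_ler_powR; rewrite ?nnegrE ?powR_ge0//; exact: ltW.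
  by rewrite -powRrM mulVf ?gt_eqF// powRr1// ltW.
have comb q : cfac lam beta `^ q * lam ^+ n = lam `^ (n%:R - beta * q).
  rewrite /cfac -powRrM -powR_mulrn ?(ltW lam0)// -powRD; first by congr (_ `^ _); ring.
  by apply/implyP => _; rewrite gt_eqF.
exists lam; split => //.
- rewrite (@le_lt_trans _ _ 2^-1)//; first by rewrite /lam ge_min lexx.
  by rewrite invf_lt1 ?ltr1n.
- by rewrite comb; apply: (pw _ _ l1) => //; rewrite divr_gt0.
- rewrite comb.
  have -> : n%:R - beta * n%:R = - e2 by rewrite /e2; ring.
  have h : lam `^ e2 <= th / 6 by apply: (pw _ _ l2) => //; rewrite divr_gt0.
  have pe : 0 < lam `^ e2 by exact: powR_gt0.
  rewrite powRN mulrC ler_pdivlMr//; move: h; rewrite ler_pdivlMr//; lra.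
Qed.

End scale_choice.

(** * Iteration of the step together with the semicontinuity radii *)

Section iteration.
Context {R : realType} {n : nat}.
Local Notation V := 'rV[R]_n.
Local Notation mu := (@leb R n).
Variables (Omega C : set V) (kb : nat) (lam beta K al p : R) (j0 : 'I_n).
Hypotheses (Okb : Omega `<=` @cubek R n kb) (n1 : (1 < n)%N) (oO : open Omega).
Hypotheses (CO : C `<=` Omega) (mC : measurable (C : set (Rn R n))).
Hypotheses (lam0 : 0 < lam) (lam1 : lam < 1) (beta1 : 1 < beta).
Hypotheses (al0 : 0 < al) (al1 : al <= 1) (Kal : K * al = 1) (bal : beta = 1 + al).
Hypotheses (p0 : 0 < p).
Hypothesis small_p : cfac lam beta `^ p * lam ^+ n <= @theta R n / 2.
Hypothesis large_n : 6 <= cfac lam beta `^ n%:R * lam ^+ n * @theta R n.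
Local Notation c := (cfac lam beta).

Definition lsc_radius (st : state R n) (d : R) : Prop :=
  forall h G', weak_gradient Omega h G' ->
  (forall x, `|h x 0 j0 - sf st x 0 j0| <= d) ->
  (lsc_const (R := R) (n := n)%:E * \int[mu]_x (cweight C st n%:R x)%:E <=
   \int[mu]_(x in (C : set (Rn R n))) (`|G' x j0 j0| `^ n%:R)%:E)%E.

Lemma lsc_radius_le st d d' : d' <= d -> lsc_radius st d -> lsc_radius st d'.
Proof. by move=> dd h g G' wg cl; apply: (h g) => // x; exact: le_trans dd. Qed.

Lemma exists_lsc_radius st d : stinv Omega C K st -> 0 < d ->
  exists d', [/\ 0 < d', d' <= d & lsc_radius st d'].
Proof.
move=> ist d0.
have [del del0 hdel] := @energy_lsc R n Omega C kb K st j0 Okb (ltnW n1) oO CO mC ist.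
exists (Num.min del d); split; first by rewrite lt_min del0.
  by rewrite ge_min lexx orbT.
by apply: (@lsc_radius_le _ del) => //; rewrite ge_min lexx.
Qed.

(** [grad] is the radius of lower semicontinuity, not a gradient. Bundling the invariants into a
    type turns [step_exists] into a total relation, from which a choice function can be iterated. *)
Record good_pair := GoodPair {
  gst : state R n; grad : R;
  ginv : stinv Omega C K gst; ggt0 : 0 < grad; glsc : lsc_radius gst grad }.

Definition step_rel (a b : good_pair) : Prop :=
  [/\ grad b <= grad a / 2,
      forall x i, `|sf (gst b) x 0 i - sf (gst a) x 0 i| <= grad a / 2,
      sU (gst b) `<=` sU (gst a),
      forall x, ~ sU (gst a) x -> sG (gst b) x = sG (gst a) x &
   [/\ forall x i j, sU (gst a) x -> ~ sU (gst b) x ->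
        `|sG (gst b) x i j| <= c * (1 + beta) * ss (gst a) x,
      (\int[mu]_x (weight (gst b) p x)%:E <=
        (1 - @theta R n / 4)%:E * \int[mu]_x (weight (gst a) p x)%:E)%E &
      (3%:E * \int[mu]_x (cweight C (gst a) n%:R x)%:E <=
        \int[mu]_x (cweight C (gst b) n%:R x)%:E)%E]].

(** All demands hold on fine grids: [k1] and [k2] secure half of the p-energy and of the n-energy,
    and the third threshold makes the displacement, at most [B c w / 4], smaller than half the old
    radius. The new radius depends on the new map, so it is chosen last. *)
Lemma step_exists (a : good_pair) : exists b, step_rel a b.
Proof.
have ia := ginv a; have d0 := ggt0 a; set st := gst a in ia *; set d := grad a in d0 *.
have nR : 0 < n%:R :> R by rewrite ltr0n ltnW.
have ww x : 0 <= weight st p x <= weight st p x by rewrite weight_ge0 lexx.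
have [k1 h1] := filled_half Okb (inv_sub ia) (inv_loc ia) (inv_ge1 ia) (inv_le ia) (ltW p0)
  (measurable_weight (inv_loc ia) (inv_ms ia) p) ww.
have [k2 h2] := filled_half Okb (inv_sub ia) (inv_loc ia) (inv_ge1 ia) (inv_le ia) (ltW nR)
  (measurable_cweight (inv_loc ia) (inv_ms ia) mC n%:R) (cweight_le_weight C st n%:R).
have [B hB] := inv_le ia.
have c0 : 0 < c by exact: powR_gt0.
have B0 : 0 < B by rewrite (lt_le_trans ltr01)// (le_trans _ (hB 0))//; exact: (inv_ge1 ia).
have d20 : 0 < d / 2 by rewrite divr_gt0.
pose k := maxn k1 (maxn k2 (Num.truncn (B * c / (d / 2)))).
have k1k : (k1 <= k)%N by rewrite leq_maxl.
have k2k : (k2 <= k)%N by rewrite /k maxnCA leq_maxl.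
have k3k : (Num.truncn (B * c / (d / 2)) <= k)%N by rewrite /k maxnA leq_maxr.
pose w := @width R k; have w0 : 0 < w by exact: width_gt0.
have wn0 : 0 < w ^+ n by rewrite exprn_gt0.
pose st' := nextst C kb lam beta st k.
have ist' : stinv Omega C K st' by apply: (@next_inv R n Omega C kb lam beta K al st k).
have [d' [d'0 d'd ld']] := exists_lsc_radius ist' d20.
exists (GoodPair ist' d'0 ld'); split => //=.
- move=> x i; have h : `|sf st' x 0 i - sf st x 0 i| <= B * (c * (w / 4)).
    by apply: next_close_sup ia _ _ _ _ => //.
  rewrite (le_trans h)//.
  have bw : B * c * w <= d / 2.
    have t : B * c / (d / 2) < k.+1%:R.
      by apply: (lt_le_trans (truncnS_gt _)); rewrite ler_nat ltnS.
    rewrite ltr_pdivrMr// in t.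
    by rewrite /w /width ler_pdivrMr ?ltr0n// [leRHS]mulrC ltW.
  have z0 : 0 < B * c * w by rewrite !mulr_gt0.
  apply: (le_trans _ bw); have -> : B * (c * (w / 4)) = B * c * w / 4 by rewrite !mulrA.
  by move: (B * c * w) z0 => z z0; lra.
- by apply: next_sub.
- by move=> x; exact: next_notU.
split.
- by move=> x i j Ux nU; apply: (next_bound lam0 lam1 beta1 ia).
- apply: (@next_decay R n Omega C kb lam beta K al st k) => //; last exact: h1.
  have lw : (lam * (w / 4) *+ 2) ^+ n <= lam ^+ n * w ^+ n.
    rewrite -exprMn lerXn2r ?nnegrE ?mulrn_wge0 ?mulr_ge0 ?(ltW lam0) ?(ltW w0)//.
    have := mulr_gt0 lam0 w0; rewrite -mulr_natr; lra.
  apply: (@le_trans _ _ (c `^ p * (lam ^+ n * w ^+ n))).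
    by apply: ler_wpM2l => //; exact: powR_ge0.
  by rewrite mulrA; apply: ler_wpM2r => //; exact: ltW.
- apply: (@next_growth R n Omega C kb lam beta K al st k) => //; last exact: h2.
  rewrite -mulrA exprMn theta_width mulrA mulrA.
  by apply: ler_wpM2r => //; exact: ltW.
Qed.

Lemma run_exists (a : good_pair) : exists X : nat -> good_pair, X 0%N = a /\
  forall k, step_rel (X k) (X k.+1).
Proof.
have [F hF] := choice step_exists.
by exists (fun k => iter k F a); split => // k; exact: hF.
Qed.

End iteration.

(** * The initial stage *)

Section initial.
Context {R : realType} {n : nat}.
Local Notation V := 'rV[R]_n.
Local Notation mu := (@leb R n).
Variables (Omega : set V) (K rho : R) (x0 : V).
Hypotheses (oO : open Omega) (rho0 : 0 < rho) (n1 : (1 < n)%N).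

Definition core_ball : set V := [set x | sqd x0 x <= rho ^+ 2].
Hypothesis sub : core_ball `<=` Omega.

(** The bounding sphere of [core_ball] is taken out of the unfinished set, so that membership in the
    ball is locally constant on what remains. The sphere is null, so its points, where the identity
    has the wrong orientation, are exempt from [inv_good]. *)
Definition init_state : state R n := State (fun x => x) (fun=> 1%:M)
  [set x | Omega x /\ sqd x0 x <> rho ^+ 2] (fun=> 1).

Lemma closed_core_ball : closed core_ball.
Proof.
rewrite (_ : core_ball = ~` [set x | rho ^+ 2 < sqd x0 x]).
  by apply: open_closedC; rewrite openE => x hx; exact: near_sqd_gt.
by apply/seteqP; split => x; rewrite /core_ball /= leNgt => /negP.
Qed.

Lemma compact_core_ball kb : Omega `<=` @cubek R n kb -> compact core_ball.
Proof.
move=> Okb; apply: (subclosed_compact closed_core_ball (@compact_cubek R n kb)).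
exact: subset_trans Okb.
Qed.

Lemma init_loc : locally_similar core_ball init_state.
Proof.
move=> x [Ox hx].
have nO : \forall y \near x, Omega y by have := oO; rewrite openE; exact.
have nS : \forall y \near x, sqd x0 y <> rho ^+ 2 /\ (core_ball y <-> core_ball x).
  have [h|h|h] := ltgtP (sqd x0 x) (rho ^+ 2); last by exfalso; exact: hx.
    apply: filterS (near_sqd_lt h) => y hy; split; first by move=> E; rewrite E ltxx in hy.
    by split=> _; rewrite /core_ball/= ltW.
  apply: filterS (near_sqd_gt h) => y hy; split; first by move=> E; rewrite E ltxx in hy.
  by split; rewrite /core_ball/= leNgt ?hy ?h.
have /nbhs_ballP[e e0 he] : nbhs x [set y | Omega y /\
    (sqd x0 y <> rho ^+ 2 /\ (core_ball y <-> core_ball x))] by exact: (filterI nO nS).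
exists e => // y /he[Oy [sy Cy]]; split => //.
by rewrite scale1r addrC subrK.
Qed.

Lemma init_inv : stinv Omega core_ball K init_state.
Proof.
split => /=.
- by move=> i; exact: coord_continuous.
- exists 1 => i j x t; rewrite !mxE addrAC subrr add0r eqxx/= mul1r normrM ler_piMr//.
  by case: (i == j); rewrite ?normr1 ?normr0.
- by move=> i j; exact: measurable_cst.
- apply: negligibleS (negligible_set0 _) => x [_]; apply => i j.
  have dx := is_derive_coord (0 : V) x i j 1; rewrite mul1r in dx.
  have E : (fun y : V => y 0 i) = (fun y : V => 1 * (y 0 i - (0 : V) 0 i)).
    by apply/funext => y; rewrite mxE subr0 mul1r.
  by rewrite E [1%:M i j]mxE; exact: dx.
- exact: measurable_cst.
- by [].
- by exists 1.
- by move=> x [].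
- exact: init_loc.
- by [].
- apply: negligibleS (negligible_sqd_eq n1 x0 (rho ^+ 2)) => x [[Ox nU] _].
  by apply: contrapT => h; exact: nU.
Qed.

Lemma init_energy : (0 < \int[mu]_x (cweight core_ball init_state n%:R x)%:E)%E.
Proof.
apply: (@lt_le_trans _ _ ((rho / n%:R) ^+ n)%:E).
  by rewrite lte_fin exprn_gt0// divr_gt0// ltr0n ltnW.
apply: (le_trans (leb_ball_lower x0 n1 rho0)).
have mB : measurable ([set x | (sqd x0 x < rho ^+ 2)%R] : set (Rn R n)) by exact: measurable_sqd_lt.
have -> : (leb ([set x | (sqd x0 x < rho ^+ 2)%R] : set (Rn R n)) =
    \int[mu]_x (\1_([set x | (sqd x0 x < rho ^+ 2)%R] : set (Rn R n)) x)%:E)%E.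
  by rewrite integral_indic// setIT.
apply: ge0_le_integral => //.
- by apply/measurable_EFinP; exact: measurable_indic.
- apply/measurable_EFinP; apply: (measurable_cweight init_loc).
    exact: measurable_cst.
  by apply: closed_measurable_Rn; exact: closed_core_ball.
- move=> x _; rewrite lee_fin /cweight powR1 mulr1 !indicE.
  case: (pselect (sqd x0 x < rho ^+ 2)) => h; last by rewrite memNset.
  rewrite !mem_set//; split; last exact: ltW.
  by split; [apply: sub; exact: ltW|move=> E; rewrite E ltxx in h].
Qed.

End initial.

Theorem theorem1p1 (R : realType) (n : nat) (K p : R) (Omega : set 'rV[R]_n) :
  (3 <= n)%N -> 1 <= K ->
  open Omega -> connected Omega -> Omega !=set0 -> bounded_set Omega ->
  1 < p -> p < n%:R * K / (K + 1) ->
  exists f : 'rV[R]_n -> 'rV[R]_n,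
    [/\ W1p Omega p f, {within Omega, continuous f}, Linf_vec Omega f,
        weakly_K_quasiregular Omega K f & ~ quasiregular Omega f].
Proof.
move=> n3 K1 oO _ [x0 Ox0] bO p1 pK.
have n1 : (1 < n)%N by exact: leq_trans n3.
have n0 : (0 < n)%N by exact: ltnW.
pose j0 : 'I_n := Ordinal n0.
have K0 : 0 < K by rewrite (lt_le_trans ltr01).
have Kn : K != 0 by rewrite gt_eqF.
have [kb Okb] : exists kb, Omega `<=` @cubek R n kb.
  move: bO => [M [_ hM]]; exists (Num.truncn (M + 1)).+1 => x Ox i.
  rewrite (le_trans (norm_coord_le _ _))// (le_trans (hM (M + 1) _ x Ox)) ?ltrDl//.
  exact/ltW/truncnS_gt.
(* With this exponent the singular values on an annulus have ratio exactly [K], and [beta p < n] is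
   a rewriting of [p < nK/(K+1)]. *)
pose al := K^-1; pose beta := 1 + al.
have al0 : 0 < al by rewrite invr_gt0.
have al1 : al <= 1 by rewrite invf_le1.
have Kal : K * al = 1 by rewrite mulfV.
have beta1 : 1 < beta by rewrite ltrDl.
have bp : beta * p < n%:R.
  have -> : beta * p = p * (K + 1) / K by rewrite /beta /al; field.
  by rewrite ltr_pdivrMr// -ltr_pdivlMr// addr_gt0.
have th0 : 0 < @theta R n by exact: theta_gt0.
have [lam [lam0 lam1 small large]] := exists_lam n0 beta1 th0 bp.
have /nbhs_ballP[e e0 he] : nbhs x0 Omega by rewrite openE in oO; exact: oO.
(* Coordinates are bounded by the Euclidean distance, so the closed Euclidean ball of radius [e / 2]
   lies in the open sup-norm ball of radius [e]. *)
pose rho := e / 2; have rho0 : 0 < rho by rewrite divr_gt0.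
have sub : core_ball rho x0 `<=` Omega.
  move=> x hx; apply: he; apply/ball_rVP => // i; rewrite distrC.
  by rewrite (le_lt_trans (coord_sqd_le i (ltW rho0) hx))// /rho ltr_pdivrMr// ltr_pMr// ltr1n.
pose C := core_ball rho x0.
have cC : compact C by exact: (compact_core_ball sub Okb).
have mC : measurable (C : set (Rn R n)) by apply: closed_measurable_Rn; exact: closed_core_ball.
have i0 : stinv Omega C K (init_state Omega rho x0) by exact: init_inv.
have [d [d0 _ ld]] := exists_lsc_radius j0 Okb n1 oO sub mC i0 ltr01.
have p0 : 0 < p by exact: lt_trans p1.
have [X [X0 hX]] := run_exists Okb n1 oO sub mC lam0 lam1 beta1 al0 al1 Kal erefl p0 small large
  (GoodPair i0 d0 ld).
pose S k := gst (X k); pose D k := grad (X k).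
have hinv k : stinv Omega C K (S k) by exact: ginv.
have hD0 k : 0 < D k by exact: ggt0.
have hDS k : D k.+1 <= D k / 2 by have [] := hX k.
have hclose k x i : `|sf (S k.+1) x 0 i - sf (S k) x 0 i| <= D k / 2 by have [_ h] := hX k.
have hU k : sU (S k.+1) `<=` sU (S k) by have [_ _ h] := hX k.
have hG k x : ~ sU (S k) x -> sG (S k.+1) x = sG (S k) x by have [_ _ _ h _] := hX k; exact: h.
have hB k x i j : sU (S k) x -> ~ sU (S k.+1) x ->
    `|sG (S k.+1) x i j| <= cfac lam beta * (1 + beta) * ss (S k) x.
  by have [_ _ _ _ [h _ _]] := hX k; exact: h.
have hdec k : (\int[@leb R n]_x (weight (S k.+1) p x)%:E <=
    (1 - @theta R n / 4)%:E * \int[@leb R n]_x (weight (S k) p x)%:E)%E.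
  by have [_ _ _ _ [_ h _]] := hX k.
have hgrow k : (3%:E * \int[@leb R n]_x (cweight C (S k) n%:R x)%:E <=
    \int[@leb R n]_x (cweight C (S k.+1) n%:R x)%:E)%E.
  by have [_ _ _ _ [_ _ h]] := hX k.
have S0 : S 0%N = init_state Omega rho x0 by rewrite /S X0.
have hG0 x : ~ sU (S 0%N) x -> sG (S 0%N) x = 1%:M by rewrite S0.
have hE0 : (0 < \int[@leb R n]_x (cweight C (S 0%N) n%:R x)%:E)%E.
  by rewrite S0; exact: init_energy.
have kap1 : 1 - @theta R n / 4 < 1 by rewrite gtrBl divr_gt0.
have cge1 : 1 <= cfac lam beta by exact: (c_ge1 (n := n) 0%N lam0 lam1 beta1).
have B01 : 1 <= cfac lam beta * (1 + beta).
  by rewrite -[leLHS]mulr1 ler_pM// lerDl ltW// (lt_trans ltr01).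
have c00 : 0 < lsc_const (R := R) (n := n) by exact: lsc_const_gt0.
exists (flim S D); split.
- exact: (flim_W1p Okb oO p1 kap1 B01 hinv hD0 hDS hclose hU hG hB hdec hG0).
- apply: continuous_subspaceT; exact: (flim_continuous hinv hD0 hDS hclose).
- exact: (flim_Linf Okb oO hinv hD0 hDS hclose).
- exact: (flim_weakly_qr Okb oO p1 kap1 B01 hinv hD0 hDS hclose hU hG hB hdec hG0).
- apply: (flim_not_qr hD0 hDS hclose c00 cC sub hgrow hE0).
  by move=> k h G' wg cl; exact: (glsc wg cl).
Qed.
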